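(* Let $E$ be the fundamental solution of $Lu=0$ in $P=\mathbb{R}^n\times(t_0,t_1)$ described in the context. Then there exist constants $C>0$ and $\widetilde{C}>0$, depending only on $\Omega$, $\lambda$, $A$ and $T=t_1-t_0$, such that \[ \mathscr{G}_C(x-\xi,t-\tau)\le E(x,t;\xi,\tau)\le \mathscr{G}_{\widetilde{C}}(x-\xi,t-\tau) \] for all $(x,t),(\xi,\tau)\in P$ with $t>\tau$.
   Context: Summation over repeated indices is understood. Let $\Omega\subset\mathbb{R}^n$ be a bounded domain with $C^{1,1}$ boundary, $t_0<t_1$, $T=t_1-t_0$, $Q=\Omega\times(t_0,t_1)$, $P=\mathbb{R}^n\times(t_0,t_1)$. Consider \[ L=a_{ij}(x,t)\partial_{ij}^2+b_k(x,t)\partial_k+c(x,t)-\partial_t \] with, for given constants $\lambda>0$, $A>0$: (i) the matrix $(a_{ij}(x,t))$ is symmetric for every $(x,t)\in\overline{Q}$; (ii) $a_{ij}\in W^{1,\infty}(Q)$ and $b_k,c\in C([t_0,t_1],C^1(\overline{\Omega}))$; (iii) $a_{ij}(x,t)\xi_i\xi_j\ge\lambda|\xi|^2$ for $(x,t)\in\overline{Q}$, $\xi\in\mathbb{R}^n$; (iv) $\|a_{ij}\|_{W^{1,\infty}(Q)}+\|b_k\|_{L^\infty(Q)}+\|c\|_{L^\infty(Q)}\le A$. Extension to the whole space: the coefficients are extended, with the same regularity (with norms controlled in terms of $\Omega,\lambda,A$) and the same ellipticity constant $\lambda$, to a neighborhood $\widetilde{\Omega}$ of $\overline{\Omega}$;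 with $\psi\in C_0^\infty(\widetilde\Omega)$, $0\le\psi\le1$, $\psi=1$ in a neighborhood of $\overline{\Omega}$, they are then replaced by $a_{ij}\psi+\lambda\delta_{ij}(1-\psi)$, $b_k\psi$, $c\psi$, defined on $\mathbb{R}^n\times[t_0,t_1]$. The resulting operator, which coincides with $L$ on $Q$, is still denoted by $L$, and its coefficients by $a_{ij},b_k,c$. Gaussian kernels: $\mathscr{G}(x,t)=(4\pi t)^{-n/2}e^{-|x|^2/(4t)}$ for $x\in\mathbb{R}^n$, $t>0$, and $\mathscr{G}_c(x,t)=c^{-1}\mathscr{G}(\sqrt{c}\,x,t)$ for $c>0$. Fundamental solution: a fundamental solution of $Lu=0$ in $P$ is a function $E(x,t;\xi,\tau)$, of class $C^{2,1}$ for $t>\tau$, such that for every $(\xi,\tau)\in\mathbb{R}^n\times[t_0,t_1)$, $LE(\cdot,\cdot;\xi,\tau)=0$ in $\mathbb{R}^n\times\{\tau<t\le t_1\}$, and for every $f\in C_0(\mathbb{R}^n)$ and $x\in\mathbb{R}^n$, $\lim_{t\searrow\tau}\int_{\mathbb{R}^n}E(x,t;\xi,\tau)f(\xi)\,d\xi=f(x)$. Here $E$ is the one given by the parametrix construction: with $a=(a^{ij})$ the inverse matrix of $(a_{ij})$, $|a|$ its determinant, and \[ Z(x,t;\xi,\tau)=[4\pi(t-\tau)]^{-n/2}\sqrt{|a(\xi,\tau)|}\,e^{-\frac{a(\xi,\tau)(x-\xi)\cdot(x-\xi)}{4(t-\tau)}},\quad t>\tau, \] \[ E(x,t;\xi,\tau)=Z(x,t;\xi,\tau)+\int_\tau^t\int_{\mathbb{R}^n}Z(x,t;\eta,\sigma)\Phi(\eta,\sigma;\xi,\tau)\,d\eta\,d\sigma,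 \] where $\Phi=\sum_{\ell\ge1}\Phi_\ell$, $\Phi_1(x,t;\xi,\tau)=[LZ(\cdot,\cdot;\xi,\tau)](x,t)$ and $\Phi_{\ell+1}(x,t;\xi,\tau)=\int_\tau^t\int_{\mathbb{R}^n}\Phi_1(x,t;\eta,\sigma)\Phi_\ell(\eta,\sigma;\xi,\tau)\,d\eta\,d\sigma$. *)

(* Defs.v *)
From HB Require Import structures.
From mathcomp Require Import all_boot all_order all_algebra.
From mathcomp Require Import all_classical all_reals all_analysis.
Set Implicit Arguments.
Unset Strict Implicit.
Unset Printing Implicit Defensive.
Import Order.TTheory GRing.Theory Num.Theory.
Import numFieldNormedType.Exports.
Local Open Scope classical_set_scope.
Local Open Scope ring_scope.

(* The library has a Borel sigma-algebra on [n.-tuple R] but no n-dimensional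
   Lebesgue measure; it is built here as the iterated product of the
   one-dimensional one. Points of R^n are row vectors (these carry the
   topology), so integrals over R^n go through [rv_of]. *)
Section lebesgue_rn.
Context {R : realType}.
Local Notation RT := (measurableTypeR R).

Section step.
Variable n : nat.
Variable m : {sigma_finite_measure set (n.-tuple RT) -> \bar R}.

Definition tcons (p : RT * n.-tuple RT) : n.+1.-tuple RT :=
  [tuple of p.1 :: p.2].

Definition tuncons (y : n.+1.-tuple RT) : RT * n.-tuple RT :=
  (thead y, [tuple of behead y]).

Lemma tconsK : cancel tcons tuncons.
Proof. by case=> x y; congr pair; apply/val_inj. Qed.

Lemma measurable_tcons : measurable_fun [set: RT * n.-tuple RT] tcons.
Proof. exact: measurable_cons. Qed.

Lemma measurable_tuncons : measurable_fun [set: n.+1.-tuple RT] tuncons.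
Proof.
apply/measurable_fun_pairP; split.
- exact: measurable_tnth.
- exact: measurable_behead.
Qed.

Definition lebS : set (n.+1.-tuple RT) -> \bar R :=
  pushforward (lebesgue_measure \x m)%E tcons.

Let lebS0 : lebS set0 = 0%E.
Proof. by rewrite /lebS /pushforward preimage_set0 measure0. Qed.

Let lebS_ge0 A : (0 <= lebS A)%E.
Proof. by rewrite /lebS /pushforward; apply: (measure_ge0 (lebesgue_measure \x m)%E). Qed.

Let lebS_sigma_additive : semi_sigma_additive lebS.
Proof.
move=> F mF tF mUF; rewrite /lebS /pushforward preimage_bigcup.
apply: measure_semi_sigma_additive.
- by move=> k; rewrite -[X in measurable X]setTI; exact: measurable_tcons.
- apply/trivIsetP => /= i j _ _ ij; rewrite -preimage_setI.
  by move/trivIsetP : tF => /(_ _ _ _ _ ij) ->//; rewrite preimage_set0.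
- by rewrite -preimage_bigcup -[X in measurable X]setTI; exact: measurable_tcons.
Qed.

HB.instance Definition _ :=
  isMeasure.Build _ _ _ lebS lebS0 lebS_ge0 lebS_sigma_additive.

Lemma lebS_sigma_finite : sigma_finite setT lebS.
Proof.
have /sigma_finiteP[F [TF ndF Foo]] := sigma_finiteT (@lebesgue_measure R).
have /sigma_finiteP[G [TG ndG Goo]] := sigma_finiteT m.
exists (fun k => tuncons @^-1` (F k `*` G k)).
  rewrite -preimage_bigcup; apply/esym; rewrite -subTset => y _ /=.
  have [k _ Fk] : (\bigcup_k F k) (tuncons y).1 by rewrite -TF.
  have [l _ Gl] : (\bigcup_k G k) (tuncons y).2 by rewrite -TG.
  exists (maxn k l) => //; split.
  - by move: Fk; exact/subsetPset/ndF/leq_maxl.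
  - by move: Gl; exact/subsetPset/ndG/leq_maxr.
move=> k; have [mF Fk] := Foo k; have [mG Gk] := Goo k; split.
  by rewrite -[X in measurable X]setTI; apply: measurable_tuncons => //;
    exact: measurableX.
rewrite /lebS /pushforward -comp_preimage.
rewrite (_ : tuncons \o tcons = id); last by apply/funext => p; exact: tconsK.
by rewrite preimage_id product_measure1E// lte_mul_pinfty// ge0_fin_numE.
Qed.

HB.instance Definition _ :=
  Measure_isSigmaFinite.Build _ _ _ lebS lebS_sigma_finite.

Lemma lebS_cons (A : set RT) (B : set (n.-tuple RT)) :
  measurable A -> measurable B ->
  lebS [set y | A (thead y) /\ B [tuple of behead y]] =
  (lebesgue_measure A * m B)%E.
Proof.
move=> mA mB; rewrite -product_measure1E//; congr ((_ \x _)%E _).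
apply/seteqP; split=> -[x y] /=; rewrite theadE.
  by case=> Ax; rewrite (_ : [tuple of _] = y)//; exact/val_inj.
by case=> Ax By; split=> //; rewrite (_ : [tuple of _] = y)//; exact/val_inj.
Qed.

End step.

Fixpoint leb (n : nat) : {sigma_finite_measure set (n.-tuple RT) -> \bar R} :=
  if n is n'.+1 then lebS (leb n') else \d_([tuple] : 0.-tuple RT).

End lebesgue_rn.

Definition rv_of {R : realType} {n : nat} (y : n.-tuple (measurableTypeR R)) :
  'rV[R]_n := \row_i tnth y i.

Definition pt_of {R : realType} {n : nat}
    (z : n.-tuple (measurableTypeR R) * measurableTypeR R) : 'rV[R]_n * R :=
  (rv_of z.1, z.2).

Definition leb_st {R : realType} (n : nat) :
    {measure set (n.-tuple (measurableTypeR R) * measurableTypeR R) -> \bar R} :=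
  (leb n \x @lebesgue_measure R)%E.

Definition int_rn {R : realType} {n : nat} (f : 'rV[R]_n -> R) : R :=
  \int[leb n]_(y in setT) f (rv_of y).

Section domains.
Context {R : realType}.

Definition ebasis {n : nat} (i : 'I_n) : 'rV[R]_n := delta_mx 0 i.

Definition C11 {m : nat} (g : 'rV[R]_m -> R) : Prop :=
  exists dg : 'I_m -> 'rV[R]_m -> R,
    (forall i y, is_derive y (ebasis i) g (dg i y)) /\
    (forall i, lipschitz (dg i)).

(* Near each boundary point, in suitable orthonormal coordinates [x *m O], the
   set is the strict epigraph, in the direction of some coordinate [i], of a
   C^{1,1} function of the n.-1 other coordinates. *)
Definition C11_boundary {n : nat} (U : set 'rV[R]_n) : Prop :=
  forall p, closure U p -> ~ U p ->
    exists (O : 'M[R]_n) (i : 'I_n) (g : 'rV[R]_n.-1 -> R),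
      [/\ O *m O^T = 1%:M, C11 g &
          \forall x \near p, U x <-> g (col' i (x *m O)) < (x *m O) 0 i].

Definition C11_domain {n : nat} (U : set 'rV[R]_n) : Prop :=
  [/\ open U, connected U, U !=set0, bounded_set U & C11_boundary U].

(* C^oo: every iterated directional derivative is Frechet differentiable. *)
Definition smooth {V : normedModType R} (f : V -> R) : Prop :=
  forall (s : seq V) (x : V),
    differentiable (foldr (fun v g => fun y => 'D_v g y) f s) x.

Definition supp {V : normedModType R} (f : V -> R) : set V :=
  closure [set x | f x != 0].

Definition test_fun {V : normedModType R} (U : set V) (f : V -> R) : Prop :=
  [/\ smooth f, compact (supp f) & supp f `<=` U].

Section w1inf.
Context {n : nat}.
Implicit Types (Q : set ('rV[R]_n * R)) (f g : 'rV[R]_n * R -> R).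

Definition int_st Q f : R :=
  \int[leb_st n]_(z in pt_of @^-1` Q) f (pt_of z).

Definition measurable_on Q f : Prop :=
  measurable_fun (pt_of @^-1` Q) (f \o pt_of : _ -> measurableTypeR R).

Definition weak_deriv Q (v : 'rV[R]_n * R) f g : Prop :=
  measurable_on Q g /\
  forall phi, test_fun Q phi ->
    int_st Q (fun z => f z * 'D_v phi z) = - int_st Q (fun z => g z * phi z).

Definition Linf_norm Q f : \bar R :=
  Lnorm (leb_st n) +oo%E ((EFin \o f \o pt_of) \_ (pt_of @^-1` Q)).

(* The norm of W^{1,oo}(Q). Bounded weak derivatives are a.e. unique, so that
   the set below has at most one finite element; the infimum only selects it,
   and is +oo when there is no bounded weak gradient. *)
Definition W1inf_norm Q f : \bar R :=
  ereal_inf [set N | exists (df : 'I_n -> 'rV[R]_n * R -> R) dtf,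
    [/\ measurable_on Q f,
        forall i, weak_deriv Q (ebasis i, 0) f (df i),
        weak_deriv Q (0, 1) f dtf &
        N = (Linf_norm Q f + \sum_i Linf_norm Q (df i) + Linf_norm Q dtf)%E]].

End w1inf.

Definition C1_closure {n : nat} (U : set 'rV[R]_n) (f : 'rV[R]_n -> R) : Prop :=
  {within closure U, continuous f} /\
  forall k, exists2 df : 'rV[R]_n -> R, {within closure U, continuous df} &
    forall x, U x -> is_derive x (ebasis k) f (df x).

Definition CtC1 {n : nat} (t0 t1 : R) (U : set 'rV[R]_n)
    (f : 'rV[R]_n -> R -> R) : Prop :=
  (forall t, t0 <= t <= t1 -> C1_closure U (f^~ t)) /\
  forall t, t0 <= t <= t1 -> forall e : R, 0 < e ->
    \forall s \near within `[t0, t1] (nbhs t), forall x, U x ->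
      `|f x s - f x t| <= e /\
      forall k, `|'D_(ebasis k) (f^~ s) x - 'D_(ebasis k) (f^~ t) x| <= e.

End domains.

(* Only the values for t in [t0, t1] matter. *)
Record coeffs (R : realType) (n : nat) := Coeffs {
  ca : 'rV[R]_n -> R -> 'M[R]_n;
  cb : 'rV[R]_n -> R -> 'rV[R]_n;
  cc : 'rV[R]_n -> R -> R
}.

Section operator.
Context {R : realType} {n : nat}.
Implicit Types (L : coeffs R n) (U : set 'rV[R]_n) (x xi : 'rV[R]_n).

Definition quad (M : 'M[R]_n) (v : 'rV[R]_n) : R :=
  \sum_i \sum_j M i j * v 0 i * v 0 j.

Definition sqnorm (v : 'rV[R]_n) : R := \sum_i v 0 i ^+ 2.

(* The continuity requirement fixes the pointwise evaluated representative of
   a_ij in W^{1,oo}. *)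
Definition admissible U (t0 t1 lam A : R) L : Prop :=
  let Q := (U `*` `]t0, t1[) in
  [/\ (forall x t, closure U x -> t0 <= t <= t1 -> (ca L x t)^T = ca L x t),
      (forall i j,
         {within (closure U `*` `[t0, t1]), continuous (fun p => ca L p.1 p.2 i j)} /\
         (W1inf_norm Q (fun p => ca L p.1 p.2 i j) < +oo)%E) /\
      (forall k, CtC1 t0 t1 U (fun x t => cb L x t 0 k)) /\
      CtC1 t0 t1 U (cc L),
      (forall x t xi, closure U x -> t0 <= t <= t1 ->
         lam * sqnorm xi <= quad (ca L x t) xi) &
      (forall i j k,
         (W1inf_norm Q (fun p => ca L p.1 p.2 i j) +
          Linf_norm Q (fun p => cb L p.1 p.2 0%R k) +
          Linf_norm Q (fun p => cc L p.1 p.2) <= A%:E)%E)].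

Definition cutoff U (V : set 'rV[R]_n) (psi : 'rV[R]_n -> R) : Prop :=
  [/\ test_fun V psi, forall x, 0 <= psi x <= 1 &
      closure U `<=` interior [set x | psi x = 1]].

Definition extends U (t0 t1 : R) L0 L1 : Prop :=
  forall x t, closure U x -> t0 <= t <= t1 ->
    [/\ ca L1 x t = ca L0 x t, cb L1 x t = cb L0 x t & cc L1 x t = cc L0 x t].

Definition whole_space (lam : R) (psi : 'rV[R]_n -> R) L : coeffs R n :=
  {| ca := fun x t => psi x *: ca L x t + (lam * (1 - psi x))%:M;
     cb := fun x t => psi x *: cb L x t;
     cc := fun x t => psi x * cc L x t |}.

(* Time derivatives are taken along ]tau, t1]: two-sided for t < t1 and left
   derivatives at t = t1, beyond which nothing is prescribed. *)
Definition dt_quot (u : R -> R) (t s : R) : R :=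
  (s - t)^-1 * (u s - u t).

Definition t_derivable (tau t1 : R) (u : R -> R) (t : R) : Prop :=
  cvg (dt_quot u t s @[s --> within `]tau, t1] t^']).

Definition t_derive (tau t1 : R) (u : R -> R) (t : R) : R :=
  lim (dt_quot u t s @[s --> within `]tau, t1] t^']).

Definition d1 (u : 'rV[R]_n -> R -> R) (i : 'I_n) : 'rV[R]_n -> R -> R :=
  fun x t => 'D_(ebasis i) (u^~ t) x.

Definition d2 (u : 'rV[R]_n -> R -> R) (i j : 'I_n) : 'rV[R]_n -> R -> R :=
  d1 (d1 u j) i.

Definition Lop L (tau t1 : R) (u : 'rV[R]_n -> R -> R) x (t : R) : R :=
  \sum_i \sum_j ca L x t i j * d2 u i j x t
  + \sum_k cb L x t 0 k * d1 u k x t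
  + cc L x t * u x t - t_derive tau t1 (u x) t.

Definition C21 (tau t1 : R) (u : 'rV[R]_n -> R -> R) : Prop :=
  let D := [set p : 'rV[R]_n * R | tau < p.2 <= t1] in
  let cont v := {within D, continuous (fun p => v p.1 p.2)} in
  [/\ (forall x t, tau < t <= t1 ->
         [/\ forall i, derivable (u^~ t) x (ebasis i),
             forall i j, derivable ((d1 u j)^~ t) x (ebasis i) &
             t_derivable tau t1 (u x) t]),
      cont u,
      (forall i, cont (d1 u i)),
      (forall i j, cont (d2 u i j)) &
      cont (fun x t => t_derive tau t1 (u x) t)].

Definition gauss (x : 'rV[R]_n) (t : R) : R :=
  (4 * pi * t) `^ (- (n%:R / 2)) * expR (- (sqnorm x / (4 * t))).

Definition gauss_c (c : R) (x : 'rV[R]_n) (t : R) : R :=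
  c^-1 * gauss (Num.sqrt c *: x) t.

Definition fundamental_solution L (t0 t1 : R)
    (E : 'rV[R]_n -> R -> 'rV[R]_n -> R -> R) : Prop :=
  (forall xi tau, t0 <= tau < t1 ->
     C21 tau t1 (fun x t => E x t xi tau) /\
     forall x t, tau < t <= t1 ->
       Lop L tau t1 (fun y s => E y s xi tau) x t = 0) /\
  (forall tau, t0 <= tau < t1 ->
     forall f : 'rV[R]_n -> R, continuous f -> compact (supp f) ->
     forall x, int_rn (fun xi => E x t xi tau * f xi) @[t --> tau^'+] --> f x).

Definition parametrix L x (t : R) xi (tau : R) : R :=
  (4 * pi * (t - tau)) `^ (- (n%:R / 2))
  * Num.sqrt (\det (invmx (ca L xi tau)))
  * expR (- (quad (invmx (ca L xi tau)) (x - xi) / (4 * (t - tau)))).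

Definition st_conv (K1 K2 : 'rV[R]_n -> R -> 'rV[R]_n -> R -> R)
    x (t : R) xi (tau : R) : R :=
  \int[lebesgue_measure]_(s in `]tau, t[)
    int_rn (fun eta => K1 x t eta s * K2 eta s xi tau).

Definition Phi1 L (t1 : R) x (t : R) xi (tau : R) : R :=
  Lop L tau t1 (fun y s => parametrix L y s xi tau) x t.

(* [Phi_ l] is the term of index l + 1 of the series. *)
Fixpoint Phi_ L (t1 : R) (l : nat) : 'rV[R]_n -> R -> 'rV[R]_n -> R -> R :=
  if l is l'.+1 then st_conv (Phi1 L t1) (Phi_ L t1 l') else Phi1 L t1.

Definition Phi L (t1 : R) x (t : R) xi (tau : R) : R :=
  limn (series (fun l => Phi_ L t1 l x t xi tau)).

Definition parametrix_solution L (t1 : R) x (t : R) xi (tau : R) : R :=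
  parametrix L x t xi tau
  + st_conv (parametrix L) (Phi L t1) x t xi tau.

End operator.

(* Main.v *)
Require Import Defs.
From HB Require Import structures.
From mathcomp Require Import all_boot all_order all_algebra.
From mathcomp Require Import all_classical all_reals all_analysis.
From mathcomp Require Import measurable_realfun ess_sup_inf ring lra perm.
Import Order.TTheory GRing.Theory Num.Theory.
Import numFieldNormedType.Exports.
Local Open Scope classical_set_scope.
Local Open Scope ring_scope.

(* Write [th = t - tau] and [H_c = th^(-n/2) exp(- c |x - xi|^2 / th)].

   The coefficients of the extended operator are bounded, elliptic and Lipschitz
   in space and time. For [a_ij] this is read off the W^{1,oo} norm: testing the
   weak gradient against a product of mollifiers, one factor being replaced by a
   difference of two ramps, bounds the increments of [a_ij] along each coordinate
   direction; the one-dimensional bump needed for this is the restriction of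
   [psi] to a line.

   Lipschitz continuity gives [|Phi_1| <= C th^(-1/2) H_c]. Keeping only the
   singularity [th^(-3/4)] and inserting a weight [exp(mu th)] with [mu] large,
   each convolution with [Phi_1] halves the bound, so the series converges and
   [|E - Z| <= C th^(1/4) H_c], which yields the upper bound.

   For the lower bound, [E] is compared by the maximum principle with a Gaussian
   [H_al], [al] large, for short times, where [E] is controlled by [Z] near the
   pole, and then with the subsolution [th^(-m) exp(- al |x - xi|^2 / th)], [m]
   large, for the remaining times. *)

(** The parametrix alone gives no lower bound far from the pole: the error [th^(1/4) H_c] decays
    more slowly in space than the Gaussian that bounds [Z] from below, so it wins where
    [q = |x - xi|^2 / th] is large. Hence the split at [q = kap]. Beyond it the comparison rests on
    one computation: [L] multiplies [th^(-m) exp(- al |x - xi|^2 / th)] by a symbol whose part in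
    [q] is positive for large [al] and negative for small [al]. So [H_al] is a subsolution there and
    a flat [H_c1] a supersolution. Subtracting [A h^(1/4) H_c1] absorbs the parametrix error at the
    starting time [tau + h] and vanishes with [h].

    The iterated kernels are never shown to be measurable. Only upper bounds for absolute values of
    integrals occur, and these hold for arbitrary integrands dominated by a kernel whose integral is
    known.

    Convolving two singularities [th^(-1/2)] exactly would bring in Beta functions. The weaker
    [th^(-3/4)] has the primitive [4 th^(1/4)], and the power given away is what makes the weight
    [exp(mu th)] effective.

    All constants are fixed before the time interval and the operator are introduced. *)

Set Implicit Arguments.
Unset Strict Implicit.

(** * Directional derivatives *)

(* The library states these rules for operations on functions; here the
   functions are in applied form, which is what unification needs. *)
Section derivation_rules.
Context {R : realType} {V : normedModType R}.
Implicit Types (f g : V -> R) (x v : V).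

Lemma is_derive_addf f g x v a b : is_derive x v f a -> is_derive x v g b ->
  is_derive x v (fun y => f y + g y) (a + b).
Proof. exact: is_deriveD. Qed.

Lemma is_derive_subf f g x v a b : is_derive x v f a -> is_derive x v g b ->
  is_derive x v (fun y => f y - g y) (a - b).
Proof. exact: is_deriveB. Qed.

Lemma is_derive_oppf f x v a : is_derive x v f a ->
  is_derive x v (fun y => - f y) (- a).
Proof. exact: is_deriveN. Qed.

Lemma is_derive_mulf f g x v a b : is_derive x v f a -> is_derive x v g b ->
  is_derive x v (fun y => f y * g y) (a * g x + f x * b).
Proof.
move=> fa gb; have [d e] := is_deriveM fa gb; split; [exact: d|rewrite e].
by rewrite /GRing.scale/= addrC [g x * a]mulrC.
Qed.

Lemma is_derive_scalef c f x v a : is_derive x v f a ->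
  is_derive x v (fun y => c * f y) (c * a).
Proof. exact: is_deriveZ. Qed.

Lemma is_derive_cstf (c : R) x v : is_derive x v (fun=> c) 0.
Proof. exact: is_derive_cst. Qed.

Lemma is_derive_sumf (I : finType) (h : I -> V -> R) x v (dh : I -> R) :
  (forall i, is_derive x v (h i) (dh i)) ->
  is_derive x v (fun y => \sum_i h i y) (\sum_i dh i).
Proof.
move=> hd; have : forall s : seq I,
    is_derive x v (fun y => \sum_(i <- s) h i y) (\sum_(i <- s) dh i).
  elim=> [|i s IH].
    rewrite big_nil (_ : (fun _ => _) = fun=> 0); first exact: is_derive_cstf.
    by apply/funext => y; rewrite big_nil.
  rewrite big_cons (_ : (fun _ => _) = fun y => h i y + \sum_(j <- s) h j y).
    exact: is_derive_addf.
  by apply/funext => y; rewrite big_cons.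
exact.
Qed.

(* The derivative along [v] only involves the restriction to a line. *)
Lemma is_derive_lineP f x v a :
  is_derive (0 : R) (1 : R) (fun s : R => f (s *: v + x)) a <-> is_derive x v f a.
Proof.
have E : (fun h : R => h^-1 *: (((fun s : R => f (s *: v + x)) \o shift 0) (h *: (1 : R)) -
     f ((0 : R) *: v + x))) = (fun h : R => h^-1 *: ((f \o shift x) (h *: v) - f x)).
  by apply/funext => h/=; rewrite addr0 scale0r add0r /GRing.scale/= mulr1.
split=> -[d e]; split.
- by move: d; rewrite /derivable E.
- by rewrite -e /derive E.
- by rewrite /derivable E.
- by rewrite -e /derive E.
Qed.

Lemma is_derive_compf f (g : R -> R) x v a b : is_derive x v f a ->
  is_derive (f x) 1 g b -> is_derive x v (fun y => g (f y)) (b * a).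
Proof.
move=> /is_derive_lineP fa gb; apply/is_derive_lineP.
apply: (@is_derive1_comp _ g (fun s : R => f (s *: v + x))) => //.
by rewrite scale0r add0r.
Qed.

Lemma is_derive_expf f x v a : is_derive x v f a ->
  is_derive x v (fun y => expR (f y)) (expR (f x) * a).
Proof. by move=> fa; apply: is_derive_compf fa _; exact: is_derive_expR. Qed.

End derivation_rules.

Lemma is_derive_idf {R : realType} (x : R) : is_derive x (1 : R) (fun y : R => y) 1.
Proof. exact: is_derive_id. Qed.

(** [is_derive_lineP] only sees the parameter 0, so the line is recentred at [s *: v + x] and the
    parameter shifted back. *)
Lemma is_derive_line {R : realType} {V : normedModType R} (f : V -> R) x v (s l : R) :
  is_derive (s *: v + x) v f l -> is_derive s (1 : R) (fun r : R => f (r *: v + x)) l.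
Proof.
move=> /is_derive_lineP F.
have F' : is_derive (s - s) (1 : R) (fun r : R => f (r *: v + (s *: v + x))) l.
  by rewrite subrr.
have [d1 d2] := is_derive_compf (is_derive_subf (is_derive_idf s) (is_derive_cstf s s (1 : R))) F'.
rewrite subr0 mulr1 in d2.
have E : (fun y : R => f ((y - s) *: v + (s *: v + x))) = (fun r : R => f (r *: v + x)).
  by apply/funext => r; rewrite addrA -scalerDl subrK.
by rewrite E in d1 d2; split.
Qed.

(** * Quadratic forms *)

Section quadratic_forms.
Context {R : realType}.

Lemma quadE n (M : 'M[R]_n) v : quad M v = (v *m M *m v^T) 0 0.
Proof.
rewrite /quad !mxE exchange_big /=; apply: eq_bigr => j _.
rewrite !mxE big_distrl /=; apply: eq_bigr => i _; ring.
Qed.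

Lemma sqnormE n (v : 'rV[R]_n) : sqnorm v = (v *m v^T) 0 0.
Proof. by rewrite /sqnorm !mxE; apply: eq_bigr => i _; rewrite !mxE expr2. Qed.

Lemma sqnorm_ge0 n (v : 'rV[R]_n) : 0 <= sqnorm v.
Proof. by apply: sumr_ge0 => i _; exact: sqr_ge0. Qed.

Lemma coord_le_sqnorm n (v : 'rV[R]_n) i : v 0 i ^+ 2 <= sqnorm v.
Proof.
rewrite /sqnorm (bigD1 i)//= lerDl; apply: sumr_ge0 => j _; exact: sqr_ge0.
Qed.

Lemma sqnorm_gt0 n (v : 'rV[R]_n) : v != 0 -> 0 < sqnorm v.
Proof.
move=> v0; rewrite lt_def sqnorm_ge0 andbT; apply: contra v0 => /eqP s0.
apply/eqP/rowP => i; rewrite mxE; apply/eqP; rewrite -sqrf_eq0 eq_le sqr_ge0.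
by rewrite andbT -s0 coord_le_sqnorm.
Qed.

Lemma sqnormN n (v : 'rV[R]_n) : sqnorm (- v) = sqnorm v.
Proof. by apply: eq_bigr => i _; rewrite mxE sqrrN. Qed.

Lemma sqnormZ n a (v : 'rV[R]_n) : sqnorm (a *: v) = a ^+ 2 * sqnorm v.
Proof. by rewrite /sqnorm mulr_sumr; apply: eq_bigr => i _; rewrite mxE exprMn. Qed.

Lemma ler_absn n (v : 'rV[R]_n) i : `|v 0 i| <= Num.sqrt (sqnorm v).
Proof. by rewrite -sqrtr_sqr ler_wsqrtr// coord_le_sqnorm. Qed.

(** Cholesky factorization, by induction on the size. Eliminating the first row leaves the Schur
    complement [S - al^-1 r^T r]; its form at [v] is the form of [M] at [(u, v)] with the minimizing
    [u], hence positive. *)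
Lemma quad_gt0_det n (M : 'M[R]_n) : M^T = M ->
    (forall v : 'rV_n, v != 0 -> 0 < quad M v) ->
  exists C : 'M[R]_n, M = C^T *m C.
Proof.
elim: n M => [|n IH] M; first by exists 0; apply/matrixP => -[].
rewrite -[n.+1]/(1 + n)%N in M *.
move=> Ms Mp; rewrite -[M]submxK in Ms Mp *.
move: (ulsubmx M) (ursubmx M) (dlsubmx M) (drsubmx M) Ms Mp => a r r' S.
rewrite tr_block_mx => /eq_block_mx[_ _ <- Ssym] Mp {r'}.
set al := a 0 0; have aE : a = al%:M by rewrite [a]mx11_scalar.
have al0 : 0 < al.
  have := Mp (row_mx 1%:M 0); rewrite quadE tr_row_mx mul_row_block.
  rewrite mul_row_col !mul0mx !addr0 mul1mx !trmx0 mulmx0 addr0 trmx1 mulmx1; apply.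
  apply/eqP => /rowP/(_ (lshift n 0)); rewrite row_mxEl !mxE eqxx => /eqP.
  by rewrite oner_eq0.
have [||C CE] := IH (S - al^-1 *: (r^T *m r)).
- by rewrite linearB/= linearZ/= trmx_mul trmxK Ssym.
- move=> v v0; pose u : 'rV[R]_1 := - (al^-1 *: (v *m r^T)).
  have := Mp (row_mx u v); rewrite !quadE tr_row_mx mul_row_block mul_row_col.
  have -> : row_mx u v != 0.
    by apply: contra v0 => /eqP; rewrite -row_mx0 => /eq_row_mx[_ ->].
  move=> /(_ isT); congr (0 < fun_of_matrix _ _ _).
  rewrite aE mul_mx_scalar /u !scalerN scalerA divff ?gt_eqF// scale1r addNr mul0mx.
  rewrite add0r mulmxBr mulmxDl mulmxBl addrC; congr (_ + _).
  by rewrite !mulNmx -scalemxAr -!scalemxAl !mulmxA.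
pose s := Num.sqrt al; have s0 : s != 0 by rewrite gt_eqF// sqrtr_gt0.
exists (block_mx s%:M (s^-1 *: r) 0 C).
have rT : (s^-1 *: r)^T = s^-1 *: r^T by rewrite linearZ.
have ss : s * s = al by rewrite -expr2 sqr_sqrtr// ltW.
rewrite tr_block_mx mulmx_block !trmx0 tr_scalar_mx rT.
rewrite !mul0mx !mulmx0 !addr0 -CE !mul_scalar_mx mul_mx_scalar.
rewrite -scalemxAl -scalemxAr !scalerA divff// !scale1r.
by rewrite -invfM ss addrC subrK scale_scalar_mx ss -aE.
Qed.

Lemma quad_le n (M : 'M[R]_n) (B : R) (v : 'rV_n) :
  (forall i j, `|M i j| <= B) -> `|quad M v| <= n%:R * B * sqnorm v.
Proof.
move=> MB; apply: le_trans (ler_norm_sum _ _ _) _.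
have H (i : 'I_n) : `|\sum_j M i j * v 0 i * v 0 j| <=
    \sum_j B * (2^-1 * (v 0 i ^+ 2 + v 0 j ^+ 2)).
  apply: le_trans (ler_norm_sum _ _ _) _; apply: ler_sum => j _.
  rewrite -mulrA normrM; apply: ler_pM => //.
  have := sqr_ge0 (v 0 i - v 0 j); have := sqr_ge0 (v 0 i + v 0 j).
  by rewrite ler_norml => ? ?; apply/andP; split; nra.
apply: (le_trans (ler_sum _ (fun i _ => H i))).
rewrite le_eqVlt; apply/orP; left; apply/eqP.
under eq_bigr do rewrite -!mulr_sumr big_split/= sumr_const card_ord.
rewrite -!mulr_sumr big_split/= sumr_const card_ord -sumrMnl -/(sqnorm v).
rewrite -mulr_natl sumrMnl -/(sqnorm v) -mulr_natl; lra.
Qed.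

(** Cauchy-Schwarz, from the nonnegative squared norm of [sqnorm v *: u - d *: v]. *)
Lemma dot_sqr_le n (u v : 'rV[R]_n) :
  ((u *m v^T) 0 0) ^+ 2 <= sqnorm u * sqnorm v.
Proof.
have [->|v0] := eqVneq v 0.
  by rewrite trmx0 mulmx0 mxE expr0n/= mulr_ge0// sqnorm_ge0.
have sv := sqnorm_gt0 v0; set d := (u *m v^T) 0 0.
have := sqnorm_ge0 (sqnorm v *: u - d *: v).
have -> : sqnorm (sqnorm v *: u - d *: v) =
    sqnorm v * (sqnorm u * sqnorm v - d ^+ 2).
  have dE : d = \sum_i u 0 i * v 0 i.
    by rewrite /d mxE; apply: eq_bigr => i _; rewrite mxE.
  have E a : sqnorm (a *: u - d *: v) =
      a ^+ 2 * sqnorm u - 2 * a * d * (\sum_i u 0 i * v 0 i) + d ^+ 2 * sqnorm v.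
    rewrite /sqnorm !mulr_sumr -sumrB -big_split/=.
    by apply: eq_bigr => i _; rewrite !mxE; ring.
  by rewrite E -dE; ring.
by rewrite pmulr_rge0// subr_ge0.
Qed.

Section elliptic.
Variables (n : nat) (M : 'M[R]_n) (lam B : R).
Hypotheses (lam0 : 0 < lam) (Msym : M^T = M).
Hypothesis Mell : forall v : 'rV_n, lam * sqnorm v <= quad M v.
Hypothesis MB : forall i j, `|M i j| <= B.

Lemma elliptic_quad_gt0 (v : 'rV_n) : v != 0 -> 0 < quad M v.
Proof.
by move=> v0; apply: lt_le_trans (Mell v); rewrite mulr_gt0// sqnorm_gt0.
Qed.

Lemma elliptic_unitmx : M \in unitmx.
Proof.
rewrite -row_free_unit; apply/row_freeP; rewrite -/(row_free M).
suff : kermx M == 0 by rewrite kermx_eq0 => /row_freeP.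
apply/eqP/row_matrixP => i; rewrite row0; apply/eqP; apply: contraT => k0.
have := elliptic_quad_gt0 k0; rewrite quadE -row_mul mulmx_ker row0.
by rewrite mul0mx mxE ltxx.
Qed.

Lemma elliptic_det_gt0 : 0 < \det M.
Proof.
have [C CE] := quad_gt0_det Msym elliptic_quad_gt0.
have := elliptic_unitmx; rewrite unitmxE unitfE => d0.
by rewrite lt_def d0/= CE det_mulmx det_tr -expr2 sqr_ge0.
Qed.

Lemma det_le (N : 'M[R]_n) b : 0 <= b -> (forall i j, `|N i j| <= b) ->
  `|\det N| <= (n`!)%:R * b ^+ n.
Proof.
move=> b0 Nb; apply: le_trans (ler_norm_sum _ _ _) _.
rewrite mulr_natl -[X in _ *+ X]card_Sn -sumr_const.
apply: ler_sum => s _; rewrite normrM normr_sign mul1r normr_prod.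
rewrite -[X in _ ^+ X]card_ord -prodr_const.
by apply: ler_prod => i _; rewrite normr_ge0 Nb.
Qed.

(** The form of the inverse at [v] is the form of [M] at [w v], so that ellipticity and entry bounds
    of [M] transfer to [invmx M]. *)
Let w (v : 'rV_n) : 'rV_n := v *m invmx M.

Let wM v : w v *m M = v.
Proof. by rewrite mulmxKV// elliptic_unitmx. Qed.

Lemma invmx_sym : (invmx M)^T = invmx M.
Proof. by rewrite trmx_inv Msym. Qed.

Let quad_w v : quad (invmx M) v = quad M (w v).
Proof. by rewrite !quadE wM /w trmx_mul invmx_sym mulmxA. Qed.

Let sqnorm_w v : sqnorm (w v) <= lam^-1 ^+ 2 * sqnorm v.
Proof.
have H1 := Mell (w v); rewrite quadE wM in H1.
have H2 := dot_sqr_le v (w v); have H3 := sqnorm_ge0 (w v).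
have H4 := sqnorm_ge0 v.
set d := (v *m _) 0 0 in H1 H2; set a := sqnorm (w v) in H1 H2 H3 *.
have [a0|a0] := eqVneq a 0; first by rewrite a0 mulr_ge0// sqr_ge0.
have {a0 H3}a0 : 0 < a by rewrite lt_def a0.
rewrite exprVn ler_pdivlMl ?exprn_gt0//.
rewrite -(ler_pM2r a0); apply: le_trans H2.
have -> : lam ^+ 2 * a * a = (lam * a) ^+ 2 by ring.
by rewrite ler_sqr// nnegrE ?(le_trans _ H1)// mulr_ge0 ?ltW.
Qed.

(** With [q = quad M (w v)], which is also the scalar product of [v] and [w v], Cauchy-Schwarz and
    ellipticity give [q^2 <= |v|^2 |w v|^2 <= |v|^2 q / lam]. *)
Lemma quad_invmx_le v : quad (invmx M) v <= lam^-1 * sqnorm v.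
Proof.
rewrite quad_w; have H1 := Mell (w v).
have H := dot_sqr_le v (w v).
have q0 : 0 <= quad M (w v) by apply: le_trans H1; rewrite mulr_ge0 ?sqnorm_ge0 ?ltW.
have E : (v *m (w v)^T) 0 0 = quad M (w v) by rewrite quadE wM.
rewrite E in H; set q := quad M (w v) in H q0 H1 *.
have [->|q1] := eqVneq q 0; first by rewrite mulr_ge0 ?invr_ge0 ?sqnorm_ge0 ?ltW.
rewrite ler_pdivlMl//; have {q0 q1}q0 : 0 < q by rewrite lt_def q1.
rewrite -(ler_pM2r q0) -mulrA -expr2.
apply: le_trans (_ : lam * (sqnorm v * sqnorm (w v)) <= _); first by rewrite ler_pM2l.
by rewrite mulrCA ler_wpM2l// sqnorm_ge0.
Qed.

(** Ellipticity bounds the form below by [lam |w v|^2], and [v = w v *m M] has norm at most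
    [n B |w v|]. *)
Lemma quad_invmx_ge v : 0 < B ->
  lam / (n%:R * B) ^+ 2 * sqnorm v <= quad (invmx M) v.
Proof.
move=> B0; rewrite quad_w; apply: le_trans (Mell _); rewrite -mulrA ler_pM2l//.
(* In dimension 0 the divisor [n B] vanishes, so this case is treated apart. *)
have [n0|n0] := posnP n.
  rewrite {1}/sqnorm big1 ?mulr0 ?sqnorm_ge0// => i _.
  by have := ltn_ord i; rewrite [X in (_ < X)%N]n0.
rewrite ler_pdivrMl ?exprn_gt0 ?mulr_gt0 ?ltr0n//.
rewrite -{1}[v]wM; move: (w v) => u.
have H (j : 'I_n) : (u *m M) 0 j ^+ 2 <= n%:R * B ^+ 2 * sqnorm u.
  have -> : (u *m M) 0 j = (u *m (row j M)^T) 0 0.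
    by rewrite !mxE; apply: eq_bigr => k _; rewrite !mxE -{2}Msym mxE.
  apply: le_trans (dot_sqr_le _ _) _; rewrite mulrC ler_wpM2r ?sqnorm_ge0//.
  rewrite mulr_natl -[X in _ *+ X]card_ord -sumr_const; apply: ler_sum => k _.
  by rewrite mxE -real_normK ?num_real// ler_sqr ?nnegrE ?normr_ge0 ?(ltW B0) ?MB.
rewrite {1}/sqnorm; apply: (le_trans (ler_sum _ (fun j _ => H j))).
by rewrite sumr_const card_ord -[leLHS]mulr_natl exprMn expr2 !mulrA.
Qed.

Lemma invmx_entry_le i j : `|invmx M i j| <= lam^-1.
Proof.
have : invmx M i j = w (delta_mx 0 i) 0 j by rewrite /w -rowE mxE.
move=> ->; apply: le_trans (ler_absn _ _) _.
have l0 : 0 <= lam^-1 by rewrite invr_ge0 ltW.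
rewrite -[leRHS](ger0_norm l0) -sqrtr_sqr ler_wsqrtr//.
apply: le_trans (sqnorm_w _) _; rewrite ler_piMr ?sqr_ge0//.
rewrite /sqnorm (bigD1 i)//= mxE !eqxx expr1n big1 ?addr0// => k ki.
by rewrite mxE (negbTE ki) expr0n.
Qed.

Lemma det_invmx_le : \det (invmx M) <= (n`!)%:R * lam^-1 ^+ n.
Proof.
apply: le_trans (ler_norm _) (det_le _ invmx_entry_le).
by rewrite invr_ge0 ltW.
Qed.

Lemma det_invmx_ge : 0 <= B -> ((n`!)%:R * B ^+ n)^-1 <= \det (invmx M).
Proof.
move=> B0; rewrite det_inv lef_pV2 ?posrE ?elliptic_det_gt0//.
  exact: le_trans (ler_norm _) (det_le B0 MB).
exact: lt_le_trans elliptic_det_gt0 (le_trans (ler_norm _) (det_le B0 MB)).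
Qed.

End elliptic.

(* Write [M = C^T *m C]: the trace of [M *m H] is the sum of the values of the
   quadratic form [H] at the rows of [C]. *)
Lemma sum_elliptic_le0 n (M H : 'M[R]_n) : M^T = M ->
    (forall v : 'rV_n, v != 0 -> 0 < quad M v) ->
    (forall v : 'rV_n, quad H v <= 0) ->
  \sum_i \sum_j M i j * H i j <= 0.
Proof.
move=> Ms Mp Hn; have [C ->] := quad_gt0_det Ms Mp.
have -> : \sum_i \sum_j (C^T *m C) i j * H i j = \sum_k quad H (row k C).
  rewrite /quad [RHS]exchange_big/=; apply: eq_bigr => i _.
  rewrite [RHS]exchange_big/=; apply: eq_bigr => j _.
  by rewrite mxE mulr_suml; apply: eq_bigr => k _; rewrite !mxE; ring.
by apply: sumr_le0 => k _; exact: Hn.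
Qed.

End quadratic_forms.

(** * Integrals *)

Section integral_bounds.
Context d (T : measurableType d) (R : realType) (mu : {measure set T -> \bar R}).
Local Open Scope ereal_scope.
Import HBNNSimple.

(* The integral of a nonnegative function is a supremum over the simple
   functions below it, hence is monotone even on non-measurable functions. *)
Lemma ge0_le_integral_nomeas (D : set T) (f g : T -> \bar R) :
  (forall x, D x -> 0 <= f x) -> (forall x, D x -> f x <= g x) ->
  \int[mu]_(x in D) f x <= \int[mu]_(x in D) g x.
Proof.
move=> f0 fg; rewrite !ge0_integralE//; last first.
  by move=> x Dx; exact: le_trans (f0 _ Dx) (fg _ Dx).
apply: ereal_sup_le => _ [h/= hf <-]; exists h => //= x; apply: le_trans (hf x) _; rewrite !patchE.
by case: ifPn => // /set_mem; exact: fg.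
Qed.

(** The integrals of the positive and of the negative part both lie between 0 and the integral of
    [g]; so does the absolute value of their difference. *)
Lemma abse_integral_le (D : set T) (f g : T -> \bar R) :
  (forall x, D x -> `|f x| <= g x) ->
  `|\int[mu]_(x in D) f x| <= \int[mu]_(x in D) g x.
Proof.
move=> fg; rewrite integralE.
have fp : 0 <= \int[mu]_(x in D) f^\+ x <= \int[mu]_(x in D) g x.
  apply/andP; split; first exact: integral_ge0.
  apply: ge0_le_integral_nomeas => // x Dx; apply: le_trans (fg _ Dx).
  by rewrite funeposE ge_max lee_abs abse_ge0.
have fn : 0 <= \int[mu]_(x in D) f^\- x <= \int[mu]_(x in D) g x.
  apply/andP; split; first exact: integral_ge0.
  apply: ge0_le_integral_nomeas => // x Dx; apply: le_trans (fg _ Dx).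
  by rewrite funenegE ge_max abse_ge0 -abseN lee_abs.
move: fp fn; move: (integral _ _ f^\+) (integral _ _ f^\-) (integral _ _ g).
case=> [a||] [b||] [c||]//=; rewrite ?lee_fin ?leey ?leNye ?andbF//=.
by move=> /andP[? ?] /andP[? ?]; rewrite ler_norml; apply/andP; split; lra.
Qed.

(** The bound by a real [B] excludes infinite values, so nothing is lost in passing to the
    real-valued integral. No measurability of [f] is involved, which is why the iterated kernels can
    be estimated directly. *)
Lemma Rintegral_le (D : set T) (f g : T -> R) (B : R) :
  (forall x, D x -> `|f x| <= g x)%R ->
  \int[mu]_(x in D) (g x)%:E <= B%:E ->
  (`|\int[mu]_(x in D) f x|%R <= B)%R.
Proof.
move=> fg gB.
have : `|\int[mu]_(x in D) (f x)%:E| <= B%:E.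
  by apply: le_trans gB; apply: abse_integral_le => x Dx; rewrite lee_fin fg.
by rewrite /Rintegral; case: (integral _ _ _).
Qed.

End integral_bounds.

Section integral_real.
Context {R : realType}.
Notation mu := (@lebesgue_measure R).

(** The integrand may blow up at both end points: the fundamental theorem is applied on compact
    subintervals that exhaust []a, b[], and monotone convergence concludes. *)
Lemma ge0_integral_le_FTC (f F : R -> R) (a b M : R) : a < b ->
  (forall x, x \in `]a, b[ -> 0 <= f x) ->
  (forall x, x \in `]a, b[ -> {for x, continuous f}) ->
  (forall x, x \in `]a, b[ -> is_derive x 1 F (f x)) ->
  (forall x y, x \in `]a, b[ -> y \in `]a, b[ -> F y - F x <= M) ->
  (\int[mu]_(x in `]a, b[) (f x)%:E <= M%:E)%E.
Proof.
move=> ab f0 fc Ff FM.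
(* The offset 3 makes [2 * e k < b - a] already for [k = 0], so that no [I k] is degenerate. *)
pose e k : R := (b - a) / k.+3%:R.
have e0 k : 0 < e k by rewrite divr_gt0// subr_gt0.
have e1 k : e k *+ 2 < b - a.
  rewrite /e -mulrnAr gtr_pMr ?subr_gt0// -mulr_natl ltr_pdivrMr// mul1r ltr_nat.
  by [].
pose I k : set R := `[a + e k, b - e k]%classic.
have Isub k : I k `<=` `]a, b[.
  move=> x; rewrite /I/= !in_itv/= => /andP[? ?]; have := e0 k; lra.
have UI : \bigcup_k I k = `]a, b[%classic.
  apply/seteqP; split; first by move=> x [k _]; exact: Isub.
  move=> x; rewrite /= in_itv/= => /andP[ax xb].
  pose k := maxn (Num.bound ((b - a) / (x - a))) (Num.bound ((b - a) / (b - x))).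
  have kP (y : R) : 0 < y -> (Num.bound ((b - a) / y) <= k)%N -> e k <= y.
    move=> y0 yk; rewrite /e ler_pdivrMr// mulrC -ler_pdivrMr//.
    apply: le_trans (ltW (archi_boundP _)) _; first by rewrite divr_ge0 ?subr_ge0 ?ltW.
    by rewrite ler_nat (leq_trans yk)// -addn3 leq_addr.
  exists k => //; rewrite /I/= in_itv/=.
  have := kP (x - a); rewrite subr_gt0 => /(_ ax (leq_maxl _ _)).
  have := kP (b - x); rewrite subr_gt0 => /(_ xb (leq_maxr _ _)).
  by move=> ? ?; apply/andP; split; lra.
have Ile k : (\int[mu]_(x in I k) (f x)%:E <= M%:E)%E.
  have ek : a + e k < b - e k by have := e1 k; rewrite mulr2n; lra.
  have Ik x : x \in `[a + e k, b - e k] -> x \in `]a, b[ by exact: Isub.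
  rewrite (@continuous_FTC2 _ f F)//.
  - by rewrite -EFinB lee_fin FM// Ik// in_itv/= lexx ltW.
  - apply: continuous_in_subspaceT => x /set_mem xI; exact/fc/Ik.
  - split=> [x||].
    + by move=> /subset_itv_oo_cc /Ik /Ff[].
    + apply: cvg_at_right_filter; apply: differentiable_continuous.
      apply/derivable1_diffP.
      by apply: (@ex_derive _ _ _ _ _ _ _ (Ff _ _)); apply: Ik; rewrite in_itv/= lexx ltW.
    + apply: cvg_at_left_filter; apply: differentiable_continuous.
      apply/derivable1_diffP.
      by apply: (@ex_derive _ _ _ _ _ _ _ (Ff _ _)); apply: Ik; rewrite in_itv/= lexx ltW.
  - by move=> x /subset_itv_oo_cc /Ik /Ff[_]; rewrite derive1E.
rewrite -UI.
have mI k : measurable (I k) by exact: measurable_itv.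
have ndI : nondecreasing_seq I.
  apply/nondecreasing_seqP => k; apply/subsetPset => x; rewrite /I/= !in_itv/=.
  have ek : e k.+1 <= e k.
    rewrite /e ler_pM2l ?subr_gt0// lef_pV2 ?posrE// ler_nat//.
  by move=> /andP[? ?]; apply/andP; split; lra.
have mf k : measurable_fun (I k) (EFin \o f).
  apply/measurable_EFinP; apply: subspace_continuous_measurable_fun => //.
  by apply: continuous_in_subspaceT => x /set_mem xI; exact/fc/Isub/xI.
have cv : (\int[mu]_(x in I k) (f x)%:E @[k --> \oo] -->
    \int[mu]_(x in \bigcup_k I k) (f x)%:E)%E.
  apply: ge0_nondecreasing_set_cvg_integral => // k x /Isub xI.
  by rewrite lee_fin f0.
rewrite -(cvg_lim _ cv)//; apply: lime_le; first by apply/cvg_ex; eexists; exact: cv.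
by near=> k; exact: Ile.
Unshelve. all: by end_near. Qed.

(** The fourth root, as an iterated square root; [4 * root4 r] is a primitive of [r^(-3/4)], which
    appears below as [(root4 r * Num.sqrt r)^-1]. *)
Definition root4 (x : R) := Num.sqrt (Num.sqrt x).

Lemma root4_ge0 x : 0 <= root4 x.
Proof. exact: sqrtr_ge0. Qed.

Lemma root4_gt0 x : (0 < root4 x) = (0 < x).
Proof. by rewrite /root4 !sqrtr_gt0. Qed.

Lemma ler_root4 x y : x <= y -> root4 x <= root4 y.
Proof. by move=> xy; rewrite /root4 !ler_wsqrtr. Qed.

Lemma is_derive_root4 (x : R) : 0 < x ->
  is_derive x (1 : R) root4 (4^-1 * (root4 x * Num.sqrt x)^-1).
Proof.
move=> x0; have sx0 : 0 < Num.sqrt x by rewrite sqrtr_gt0.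
apply: is_derive_eq (is_derive_compf (is_derive1_sqrt x0) (is_derive1_sqrt sx0)) _.
rewrite /root4; have := lt0r_neq0 sx0; move: sx0; rewrite -(sqrtr_gt0 (Num.sqrt x)).
by move=> /lt0r_neq0 ? ?; field; apply/andP.
Qed.

(** The primitive is [4 C (root4 (s - a) - root4 (b - s))]; each of its two terms varies by at most
    [4 C root4 (b - a)], whence the 8. *)
Lemma integral_itv_root4 (a b C : R) : a < b -> 0 <= C ->
  (\int[mu]_(s in `]a, b[) (C * ((root4 (s - a) * Num.sqrt (s - a))^-1
                               + (root4 (b - s) * Num.sqrt (b - s))^-1))%:E
    <= (8 * C * root4 (b - a))%:E)%E.
Proof.
move=> ab C0.
pose g r := (root4 r * Num.sqrt r)^-1.
have cg r : 0 < r -> {for r, continuous g}.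
  move=> r0; apply: continuousV.
    by rewrite mulf_neq0 ?gt_eqF ?root4_gt0 ?sqrtr_gt0.
  apply: continuousM; last exact: sqrt_continuous.
  by apply: continuous_comp; exact: sqrt_continuous.
have g0 r : 0 <= g r by rewrite invr_ge0 mulr_ge0 ?root4_ge0.
apply: (@ge0_integral_le_FTC (fun s => C * (g (s - a) + g (b - s)))
  (fun s => 4 * C * (root4 (s - a) - root4 (b - s))) a b _ ab).
- by move=> x _; rewrite mulr_ge0// addr_ge0.
- move=> x; rewrite in_itv/= => /andP[ax xb].
  apply: continuousM; first exact: cst_continuous.
  apply: continuousD.
  + apply: (@continuous_comp _ _ _ (fun s => s - a) g); last by apply: cg; rewrite subr_gt0.
    by apply: continuousB; [exact: cvg_id|exact: cst_continuous].
  + apply: (@continuous_comp _ _ _ (fun s => b - s) g); last by apply: cg; rewrite subr_gt0.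
    by apply: continuousB; [exact: cst_continuous|exact: cvg_id].
- move=> x; rewrite in_itv/= => /andP[ax xb].
  have xa : 0 < x - a by rewrite subr_gt0.
  have bx : 0 < b - x by rewrite subr_gt0.
  have H1 : is_derive x (1 : R) (fun s => s - a) 1.
    apply: is_derive_eq (is_derive_subf (is_derive_idf x) (is_derive_cstf a x (1 : R))) _.
    by rewrite subr0.
  have H2 : is_derive x (1 : R) (fun s => b - s) (- 1).
    apply: is_derive_eq (is_derive_subf (is_derive_cstf b x (1 : R)) (is_derive_idf x)) _.
    by rewrite sub0r.
  apply: is_derive_eq (is_derive_scalef (4 * C) (is_derive_subf
    (is_derive_compf H1 (is_derive_root4 xa)) (is_derive_compf H2 (is_derive_root4 bx)))) _.
  by rewrite -/(g (x - a)) -/(g (b - x)); field.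
- move=> x y; rewrite !in_itv/= => /andP[ax xb] /andP[ay yb].
  have ya : root4 (y - a) <= root4 (b - a) by rewrite ler_root4// lerB// ltW.
  have bx : root4 (b - x) <= root4 (b - a) by rewrite ler_root4// lerB// ltW.
  have := root4_ge0 (x - a); have := root4_ge0 (b - y) => h1 h2.
  rewrite -mulrBr [8 * _](_ : _ = 4 * C * 2); last by ring.
  by rewrite -mulrA ler_wpM2l ?mulr_ge0//; lra.
Qed.

Lemma integral_gauss (c m : R) : 0 < c ->
  (\int[mu]_y (expR (- (c * (y - m) ^+ 2)))%:E = (Num.sqrt (pi / c))%:E)%E.
Proof.
(* The standard deviation for which the normal density has exponent [c (y - m)^2]; its total mass 1
   then gives the integral. *)
move=> c0; pose s := Num.sqrt (c^-1 / 2).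
have s0 : s != 0 by rewrite gt_eqF// sqrtr_gt0 divr_gt0// invr_gt0.
have s2 : s ^+ 2 *+ 2 = c^-1.
  rewrite sqr_sqrtr ?divr_ge0 ?invr_ge0 ?(ltW c0)//.
  by rewrite -mulr_natr mulfVK.
have := integral_normal_pdf m s; rewrite normal_pdfE//.
under eq_integral do rewrite EFinM.
rewrite ge0_integralZl//=; last 3 first.
- by apply/measurable_EFinP; exact: measurable_normal_fun.
- by move=> x _; rewrite lee_fin normal_fun_ge0.
- by rewrite lee_fin normal_peak_ge0.
have p0 := normal_peak_gt0 s0.
have pE : normal_peak s = (Num.sqrt (pi / c))^-1.
  by rewrite /normal_peak -mulrnAl s2 mulrC.
have E y : expR (- (c * (y - m) ^+ 2)) = normal_fun m s y.
  by rewrite /normal_fun s2 invrK mulNr mulrC.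
under [in X in _ -> X]eq_integral do rewrite E.
rewrite pE in p0 *; set I := integral _ _ _; set p := Num.sqrt _ in p0 *.
have I0 : (0 <= I)%E by apply: integral_ge0 => x _; rewrite lee_fin normal_fun_ge0.
case: I I0 => [r _|_|//].
  rewrite -EFinM => -[/(congr1 ( *%R p))]; rewrite mulr1 mulrA divff ?mul1r; first by move=> ->.
  by rewrite gt_eqF// -invr_gt0.
by rewrite mulry gtr0_sg// mul1e.
Qed.

End integral_real.

Section integral_leb.
Context {R : realType}.
Notation mu := (@lebesgue_measure R).
Notation RT := (measurableTypeR R).

Lemma measurable_prod_tnth n (g : 'I_n -> R -> R) :
  (forall i, measurable_fun setT (g i)) ->
  measurable_fun setT (fun y : n.-tuple RT => \prod_i g i (tnth y i)).
Proof.
move=> mg; apply: measurable_prod => i _.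
exact: (measurableT_comp (mg i) (measurable_tnth i)).
Qed.

Lemma integral_leb_prod n (g : 'I_n -> R -> R) (I : 'I_n -> R) :
    (forall i, measurable_fun setT (g i)) -> (forall i x, 0 <= g i x) ->
    (forall i, \int[mu]_x (g i x)%:E = (I i)%:E)%E ->
  (\int[leb n]_y (\prod_i g i (tnth y i))%:E = (\prod_i I i)%:E)%E.
Proof.
elim: n g I => [|n IH] g I mg g0 gI.
  rewrite /leb integral_dirac// ?diracT ?mul1e ?big_ord0//.
  by apply/measurable_EFinP; exact: measurable_prod_tnth.
have mp := measurable_prod_tnth mg.
rewrite /= ge0_integral_pushforward//; last 3 first.
- exact: measurable_tcons.
- exact/measurable_EFinP.
- by move=> y _; rewrite lee_fin prodr_ge0.
rewrite preimage_setT fubini_tonelli1; last 2 first.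
- apply/measurable_EFinP. apply: (measurableT_comp mp). exact: measurable_tcons.
- by move=> y; rewrite lee_fin prodr_ge0.
have FE x : fubini_F (leb n)
    ((fun y : n.+1.-tuple RT => (\prod_i g i (tnth y i))%:E) \o tcons (n:=n)) x =
    ((g ord0 x)%:E * (\prod_(i < n) I (lift ord0 i))%:E)%E.
  rewrite -(IH (fun i => g (lift ord0 i)))// -ge0_integralZl//=; last 3 first.
  - apply/measurable_EFinP; apply: (@measurable_prod_tnth _ (fun i => g (lift ord0 i))) => i.
    exact: mg.
  - by move=> y _; rewrite lee_fin prodr_ge0.
  - by rewrite lee_fin g0.
  apply: eq_integral => y _ /=; rewrite -EFinM big_ord_recl; congr (_ * _)%:E.
  by apply: eq_bigr => i _; congr (g _ _); rewrite !(tnth_nth x).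
under eq_integral do rewrite FE.
have P0 : 0 <= \prod_(i < n) I (lift ord0 i).
  by apply: prodr_ge0 => i _; rewrite -lee_fin -gI integral_ge0// => x _; rewrite lee_fin.
rewrite ge0_integralZr//=; last 2 first.
- by apply/measurable_EFinP; exact: mg.
- by move=> x _; rewrite lee_fin.
by rewrite gI big_ord_recl EFinM.
Qed.

Lemma integral_gauss_conv n (p q : R) (x xi : 'rV[R]_n) : 0 < p -> 0 < q ->
  (\int[leb n]_y (expR (- (p * sqnorm (x - rv_of y)))
                  * expR (- (q * sqnorm (rv_of y - xi))))%:E =
  (Num.sqrt (pi / (p + q)) ^+ n
   * expR (- (p * q / (p + q) * sqnorm (x - xi))))%:E)%E.
Proof.
move=> p0 q0; have pq : 0 < p + q by exact: addr_gt0.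
(* Completing the square in each coordinate: [m] is the weighted mean, and [p q / (p + q)] times the
   squared distance is left over. *)
pose m i := (p * x 0 i + q * xi 0 i) / (p + q).
pose g i (s : R) := expR (- ((p + q) * (s - m i) ^+ 2)).
set e := expR (- (p * q / _ * _)).
transitivity (\int[leb n]_y (e%:E * (\prod_i g i (tnth y i))%:E))%E.
  apply: eq_integral => y _; rewrite -EFinM -expR_sum -!expRD; congr (expR _)%:E.
  rewrite /sqnorm -!mulrN -!sumrN !mulr_sumr -!big_split/=; apply: eq_bigr => i _.
  by rewrite !mxE /m; field; rewrite gt_eqF.
rewrite ge0_integralZl//=; last 3 first.
- apply/measurable_EFinP; apply: (@measurable_prod_tnth _ g) => i.
  apply: measurableT_comp => //; apply: measurableT_comp => //.
  by apply: measurable_funM => //; apply: measurable_funX; exact: measurable_funB.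
- by move=> y _; rewrite lee_fin prodr_ge0// => i _; exact: expR_ge0.
- by rewrite lee_fin expR_ge0.
rewrite (@integral_leb_prod _ g (fun=> Num.sqrt (pi / (p + q)))).
- by rewrite prodr_const card_ord -EFinM mulrC.
- move=> i; apply: measurableT_comp => //; apply: measurableT_comp => //.
  by apply: measurable_funM => //; apply: measurable_funX; exact: measurable_funB.
- by move=> i s; exact: expR_ge0.
- by move=> i; exact: integral_gauss.
Qed.

End integral_leb.

(** * Gaussian kernels *)

Section time_derivative.
Context {R : realType}.
Implicit Types (u : R -> R) (tau t l : R).

(** Uniqueness of the limit that defines [t_derive] needs a proper filter. At [t = t1] only points
    to the left of [t] are available, so the witness is taken there. *)
Lemma left_within_proper tau (t1 : R) t : tau < t <= t1 ->
  ProperFilter (within `]tau, t1] t^').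
Proof.
move=> /andP[taut tt1]; apply: Build_ProperFilter_ex => P.
rewrite /within/= => -[e /= e0 H].
pose d := Num.min (e / 2) ((t - tau) / 2).
have d0 : 0 < d by rewrite lt_min !divr_gt0// subr_gt0.
have de : d < e by rewrite /d gt_min; apply/orP; left; rewrite ltr_pdivrMr// ltr_pMr// ltr1n.
have dt : d < t - tau.
  by rewrite /d gt_min; apply/orP; right; rewrite ltr_pdivrMr// ltr_pMr ?subr_gt0// ltr1n.
exists (t - d); apply: H; rewrite /ball_/=.
- by rewrite opprB addrC subrK gtr0_norm.
- by rewrite lt_eqF// gtrBl.
- by rewrite in_itv/=; apply/andP; split; lra.
Qed.

Lemma is_derive_dt_quot u t l :
  is_derive t (1 : R) u l -> dt_quot u t s @[s --> t^'] --> l.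
Proof.
move=> [d <-]; move: d; rewrite /derivable /derive => d.
have : (fun s => s - t) @ t^' --> 0^'.
  move=> P [e /= e0 H]; exists e => //= s /= st neq; apply: H => /=.
    by rewrite sub0r opprB.
  by rewrite subr_eq0.
move=> /cvg_comp /(_ d); apply: cvg_trans; apply: near_eq_cvg.
near=> s; rewrite /dt_quot/= /GRing.scale/= mulr1 subrK//.
Unshelve. all: by end_near. Qed.

Lemma is_derive_t_derive tau (t1 : R) u t l : tau < t <= t1 ->
  is_derive t (1 : R) u l -> t_derivable tau t1 u t /\ t_derive tau t1 u t = l.
Proof.
move=> tt /is_derive_dt_quot d; have PF := left_within_proper tt.
have c : dt_quot u t s @[s --> within `]tau, t1] t^'] --> l.
  by apply: cvg_trans d; apply: cvg_app; exact: cvg_within.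
by split; [apply/cvg_ex; exists l|exact: cvg_lim c].
Qed.

End time_derivative.

Lemma Lop_derive {R : realType} {n : nat} (L : coeffs R n) (tau t1 : R)
    (u : 'rV[R]_n -> R -> R) (x : 'rV[R]_n) (t : R) (u1 : 'I_n -> 'rV[R]_n -> R)
    (u2 : 'I_n -> 'I_n -> R) (ut : R) : tau < t <= t1 ->
    (forall i y, is_derive y (ebasis i) (u^~ t) (u1 i y)) ->
    (forall i j, is_derive x (ebasis i) (u1 j) (u2 i j)) ->
    is_derive t (1 : R) (u x) ut ->
  Lop L tau t1 u x t =
  \sum_i \sum_j ca L x t i j * u2 i j + \sum_k cb L x t 0 k * u1 k x
  + cc L x t * u x t - ut.
Proof.
move=> tt H1 H2 Ht; rewrite /Lop.
have [_ ->] := is_derive_t_derive tt Ht.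
have E1 i : (d1 u i)^~ t = u1 i.
  by apply/funext => y; rewrite /d1; have [_ ->] := H1 i y.
congr (_ + _ + _ - _).
  apply: eq_bigr => i _; apply: eq_bigr => j _; congr (_ * _).
  by rewrite /d2 {1}/d1 E1; have [_ ->] := H2 i j.
by apply: eq_bigr => k _; rewrite -E1.
Qed.

Section gaussian_kernels.
Context {R : realType} {n : nat}.
Implicit Types (M : 'M[R]_n) (x z xi : 'rV[R]_n) (m t th tau : R).

(** [th^(-m) exp(- quad M z / th)], the power being put under the exponential so that each
    derivative is the kernel times a rational factor. The parametrix ([M] a quarter of the inverse
    matrix) and the barriers ([M] scalar) are both instances. *)
Definition gker m M z th := expR (- (m * ln th) - quad M z / th).

Definition mv M z (i : 'I_n) := \sum_k M i k * z 0 k.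

Lemma gker_gt0 m M z th : 0 < gker m M z th.
Proof. exact: expR_gt0. Qed.

Lemma is_derive_coord x i k :
  is_derive x (ebasis i) (fun y : 'rV[R]_n => y 0 k) (i == k)%:R.
Proof.
apply/is_derive_lineP.
rewrite (_ : (fun _ => _) = fun s : R => s * (i == k)%:R + x 0 k); last first.
  by apply/funext => s; rewrite !mxE eqxx/= eq_sym.
have H := is_derive_addf (is_derive_mulf (is_derive_idf (0 : R)) (is_derive_cstf (i == k)%:R (0 : R) (1 : R)))
  (is_derive_cstf (x 0 k) (0 : R) (1 : R)).
by apply: is_derive_eq H _; rewrite mul1r mul0r !addr0.
Qed.

Lemma is_derive_mv M x xi i j :
  is_derive x (ebasis i) (fun y => mv M (y - xi) j) (M j i).
Proof.
rewrite (_ : (fun _ => _) = fun y : 'rV[R]_n => \sum_k M j k * (y 0 k - xi 0 k)); last first.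
  by apply/funext => y; apply: eq_bigr => k _; rewrite !mxE.
apply: is_derive_eq.
  apply: is_derive_sumf => k; apply: is_derive_scalef.
  exact: (is_derive_subf (is_derive_coord x i k) (is_derive_cstf _ _ _)).
rewrite (bigD1 i)//= eqxx subr0 mulr1 big1 ?addr0// => k ki.
by rewrite eq_sym (negbTE ki) subr0 mulr0.
Qed.

Lemma quad_mv M z : quad M z = \sum_i z 0 i * mv M z i.
Proof.
apply: eq_bigr => i _; rewrite /mv mulr_sumr; apply: eq_bigr => j _; ring.
Qed.

Lemma is_derive_quad M x xi i : M^T = M ->
  is_derive x (ebasis i) (fun y => quad M (y - xi)) (2 * mv M (x - xi) i).
Proof.
move=> Ms.
rewrite (_ : (fun _ => _) = fun y : 'rV[R]_n => \sum_k (y 0 k - xi 0 k) * mv M (y - xi) k); last first.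
  by apply/funext => y; rewrite quad_mv; apply: eq_bigr => k _; rewrite !mxE.
apply: is_derive_eq.
  apply: is_derive_sumf => k; apply: is_derive_mulf (is_derive_mv M x xi i k).
  exact: (is_derive_subf (is_derive_coord x i k) (is_derive_cstf _ _ _)).
rewrite big_split/= (bigD1 i)//= eqxx subr0 mul1r big1 ?addr0; last first.
  by move=> k ki; rewrite eq_sym (negbTE ki) subr0 mul0r.
rewrite mulr2n mulrDl mul1r; congr (_ + _); apply: eq_bigr => k _.
by rewrite -{1}Ms !mxE mulrC.
Qed.

Section derivatives.
Variables (m tau : R) (M : 'M[R]_n) (xi : 'rV[R]_n).
Hypothesis Msym : M^T = M.
Let u x t := gker m M (x - xi) (t - tau).

Lemma is_derive_gker x t i :
  is_derive x (ebasis i) (u^~ t) (u x t * (- (2 * mv M (x - xi) i / (t - tau)))).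
Proof.
rewrite /u /gker; apply: is_derive_expf.
have H := is_derive_mulf (is_derive_quad x xi i Msym) (is_derive_cstf (t - tau)^-1 x (ebasis i)).
apply: is_derive_eq (is_derive_subf (is_derive_cstf (- (m * ln (t - tau))) x (ebasis i)) H) _.
by rewrite mulr0 addr0 sub0r.
Qed.

Lemma is_derive2_gker x t i j :
  is_derive x (ebasis i)
    (fun y => u y t * (- (2 * mv M (y - xi) j / (t - tau))))
    (u x t * (4 * mv M (x - xi) i * mv M (x - xi) j / (t - tau) ^+ 2
              - 2 * M i j / (t - tau))).
Proof.
have H := is_derive_oppf (is_derive_mulf (is_derive_scalef 2 (is_derive_mv M x xi i j))
  (is_derive_cstf (t - tau)^-1 x (ebasis i))).
apply: is_derive_eq (is_derive_mulf (is_derive_gker x t i) H) _.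
have -> : M j i = M i j by rewrite -{1}Msym mxE.
rewrite expr2 invfM; ring.
Qed.

Lemma is_derive_t_gker x t : tau < t ->
  is_derive t (1 : R) (u x)
    (u x t * (- (m / (t - tau)) + quad M (x - xi) / (t - tau) ^+ 2)).
Proof.
move=> tt; have th0 : 0 < t - tau by rewrite subr_gt0.
rewrite /u /gker; apply: is_derive_expf.
have H1 : is_derive t (1 : R) (fun s => s - tau) 1.
  by apply: is_derive_eq (is_derive_subf (is_derive_idf t) (is_derive_cstf tau t (1 : R))) _; rewrite subr0.
have H2 := is_derive_oppf (is_derive_scalef m (is_derive_compf H1 (is_derive1_ln th0))).
have H3 : is_derive t (1 : R) (fun s => (s - tau)^-1) (- (t - tau) ^- 2).
  have [d e] := @is_deriveV _ (fun s => s - tau) _ _ _ (lt0r_neq0 th0) H1; split; first exact: d.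
  by rewrite e /GRing.scale/= mulr1.
apply: is_derive_eq (is_derive_subf H2 (is_derive_scalef (quad M (x - xi)) H3)) _.
by rewrite mulr1 mulrN opprK.
Qed.

(** The factor by which the operator multiplies the kernel; see [Lop_gker]. All later uses of the
    equation reduce to the size or the sign of this expression. *)
Definition symbol (L : coeffs R n) x t : R :=
  \sum_i \sum_j ca L x t i j *
      (4 * mv M (x - xi) i * mv M (x - xi) j / (t - tau) ^+ 2 - 2 * M i j / (t - tau))
  - \sum_k cb L x t 0 k * (2 * mv M (x - xi) k / (t - tau))
  + cc L x t + m / (t - tau) - quad M (x - xi) / (t - tau) ^+ 2.

Lemma Lop_gker (L : coeffs R n) t1 k x t : tau < t <= t1 ->
  Lop L tau t1 (fun y s => k * u y s) x t = k * u x t * symbol L x t.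
Proof.
move=> tt; have /andP[tt' _] := tt.
rewrite (Lop_derive L tt (fun i y => is_derive_scalef k (is_derive_gker y t i))
  (fun i j => is_derive_scalef k (is_derive2_gker x t i j))
  (is_derive_scalef k (is_derive_t_gker x tt'))).
rewrite /symbol.
set B := fun i j => 4 * mv M (x - xi) i * mv M (x - xi) j / (t - tau) ^+ 2 - 2 * M i j / (t - tau).
rewrite (_ : \sum_i \sum_j _ = k * u x t * \sum_i \sum_j ca L x t i j * B i j); last first.
  rewrite mulr_sumr; apply: eq_bigr => i _; rewrite mulr_sumr; apply: eq_bigr => j _.
  rewrite -/(B i j); ring.
rewrite (_ : \sum_k0 cb L x t 0 k0 * _ = - (k * u x t * \sum_k0 cb L x t 0 k0 * (2 * mv M (x - xi) k0 / (t - tau)))).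
  by rewrite /B; ring.
rewrite mulr_sumr -sumrN; apply: eq_bigr => i _; ring.
Qed.

End derivatives.
End gaussian_kernels.

(** The interface between the coefficient estimates at the end and everything in between: [Lam] is
    the only constant through which the coefficients enter, besides [lam]. *)
Definition regular {R : realType} {n : nat} (lam Lam t0 t1 : R) (L : coeffs R n) :=
  forall x t, t0 < t < t1 ->
  [/\ (ca L x t)^T = ca L x t,
      forall v, lam * sqnorm v <= quad (ca L x t) v,
      forall i j, `|ca L x t i j| <= Lam,
      (forall k, `|cb L x t 0 k| <= Lam) /\ `|cc L x t| <= Lam &
      forall y s, t0 < s < t1 -> forall i j,
        `|ca L x t i j - ca L y s i j| <= Lam * (Num.sqrt (sqnorm (x - y)) + `|t - s|)].

(** * The operator applied to the parametrix *)

Section parametrix_bounds.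
Context {R : realType} {n : nat}.
Implicit Types (M : 'M[R]_n) (x z xi : 'rV[R]_n) (m t th tau s r : R).

Lemma mvE M z i : mv M z i = (z *m M^T) 0 i.
Proof. by rewrite mxE; apply: eq_bigr => k _; rewrite mxE mulrC. Qed.

Lemma mv_le M z i b : 0 <= b -> (forall j k, `|M j k| <= b) ->
  `|mv M z i| <= n%:R * b * Num.sqrt (sqnorm z).
Proof.
move=> b0 Mb; apply: le_trans (ler_norm_sum _ _ _) _.
rewrite -mulrA mulr_natl -[X in _ *+ X]card_ord -sumr_const; apply: ler_sum => k _.
by rewrite normrM ler_pM// ler_absn.
Qed.

Lemma quadZ a M z : quad (a *: M) z = a * quad M z.
Proof.
rewrite /quad mulr_sumr; apply: eq_bigr => i _; rewrite mulr_sumr.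
by apply: eq_bigr => j _; rewrite mxE !mulrA.
Qed.

Lemma quad_scalar a z : quad a%:M z = a * sqnorm z.
Proof.
rewrite /quad mulr_sumr; apply: eq_bigr => i _.
rewrite (bigD1 i)//= mxE eqxx mulr1n big1 ?addr0; first by rewrite expr2 mulrA.
by move=> j ji; rewrite mxE eq_sym (negbTE ji) mulr0n !mul0r.
Qed.

(* With [M = a^-1 / 4] and [m = n / 2], the kernel solves the heat equation of
   the frozen matrix [a]. *)
Lemma frozen_symbol (a : 'M[R]_n) z th : a \in unitmx -> (invmx a)^T = invmx a ->
    th != 0 -> let M := 4^-1 *: invmx a in
  \sum_i \sum_j a i j * (4 * mv M z i * mv M z j / th ^+ 2 - 2 * M i j / th)
  + n%:R / 2 / th - quad M z / th ^+ 2 = 0.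
Proof.
move=> au asym th0 M.
have Ms : M^T = M by rewrite /M linearZ/= asym.
have E1 : \sum_i \sum_j a i j * mv M z i * mv M z j = 4^-1 * quad M z.
  transitivity (quad a (z *m M)).
    by apply: eq_bigr => i _; apply: eq_bigr => j _; rewrite !mvE Ms.
  rewrite !quadE trmx_mul Ms !mulmxA /M.
  by rewrite -!(scalemxAr, scalemxAl) !scalerA mulmxKV// [LHS]mxE [X in _ = _ * X]mxE mulrA.
have E2 : \sum_i \sum_j a i j * M i j = 4^-1 * n%:R.
  transitivity (\tr (a *m M)).
    by apply: eq_bigr => i _; rewrite mxE; apply: eq_bigr => j _; rewrite -{1}Ms [M^T _ _]mxE.
  by rewrite -scalemxAr mulmxV// mxtraceZ mxtrace_scalar.
rewrite (_ : \sum_i _ = 4 / th ^+ 2 * (4^-1 * quad M z) - 2 / th * (4^-1 * n%:R)).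
  by field.
rewrite -E1 -E2 [4 / _ * _]mulr_sumr [2 / _ * _]mulr_sumr -sumrB; apply: eq_bigr => i _.
rewrite [4 / _ * _]mulr_sumr [2 / _ * _]mulr_sumr -sumrB; apply: eq_bigr => j _.
by move: (mv M z i) (mv M z j) => p q; field.
Qed.

Section fixed_coefficients.
Variables (lam Lam T t0 t1 : R) (L : coeffs R n).
Hypotheses (lam0 : 0 < lam) (Lam0 : 0 < Lam) (T0 : 0 < T) (t01 : t1 - t0 = T).
Hypothesis Lreg : regular lam Lam t0 t1 L.

Let kap : R := n%:R * (4 * lam)^-1.

(** The three terms come from the increment of the leading coefficients, the drift and the
    zero-order term; the powers of [Num.sqrt T] put all of them over the same denominator [s]. *)
Definition symbol_const : R :=
  (n%:R * (n%:R * ((4 * kap ^+ 2 + 2 * (4 * lam)^-1) * (Lam * (1 + Num.sqrt T)))))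
  + n%:R * (Lam * (2 * kap)) + Lam * Num.sqrt T.

(** Subtracting [frozen_symbol], which vanishes, leaves [a(x,t) - a(xi,tau)] against the
    second-order factor. With [r] the distance in parabolic scaling, the latter is of size
    [s^-2 (1 + r)^2] and Lipschitz continuity contributes [s (1 + r)]: only one negative power of
    [s] survives. *)
Lemma parametrix_symbol_le x t xi tau s r : t0 < tau -> tau < t -> t < t1 ->
    s = Num.sqrt (t - tau) -> r = Num.sqrt (sqnorm (x - xi)) / s ->
  `|symbol (n%:R / 2) tau (4^-1 *: invmx (ca L xi tau)) xi L x t| <=
  symbol_const / s * (1 + r) ^+ 3.
Proof.
move=> t0tau taut tt1 sE rE; set M := _ *: _.
have th0 : 0 < t - tau by rewrite subr_gt0.
have s0 : 0 < s by rewrite sE sqrtr_gt0.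
have ss : t - tau = s ^+ 2 by rewrite sE sqr_sqrtr// ltW.
have sT : s <= Num.sqrt T by rewrite sE -t01 ler_wsqrtr// lerB// ltW.
have tau01 : t0 < tau < t1 by apply/andP; split; lra.
have tt01 : t0 < t < t1 by apply/andP; split; lra.
have [asym aell ab _ _] := Lreg xi (t := tau) tau01.
have [_ _ _ [bb cbd] alip] := Lreg x (t := t) tt01.
have fs := @frozen_symbol _ (x - xi) (t - tau) (elliptic_unitmx lam0 aell)
  (invmx_sym asym) (lt0r_neq0 th0).
have nz0 : 0 <= Num.sqrt (sqnorm (x - xi)) by exact: sqrtr_ge0.
have nzE : Num.sqrt (sqnorm (x - xi)) = r * s by rewrite rE divfK// gt_eqF.
have r0 : 0 <= r by rewrite rE divr_ge0// ltW.
have Mb i j : `|M i j| <= (4 * lam)^-1.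
  rewrite mxE normrM ger0_norm ?invr_ge0// invfM ler_wpM2l ?invr_ge0//.
  exact: invmx_entry_le lam0 aell i j.
have kap0 : 0 <= kap by rewrite mulr_ge0// invr_ge0 mulr_ge0// ltW.
have mvb i : `|mv M (x - xi) i| <= kap * (r * s).
  by rewrite -nzE; apply: mv_le Mb; rewrite invr_ge0 mulr_ge0// ltW.
have Bb i j : `|4 * mv M (x - xi) i * mv M (x - xi) j / (t - tau) ^+ 2
    - 2 * M i j / (t - tau)| <= (4 * kap ^+ 2 + 2 * (4 * lam)^-1) / s ^+ 2 * (1 + r) ^+ 2.
  apply: le_trans (ler_normB _ _) _; rewrite ss.
  rewrite !normrM !normrV ?unitfE ?expf_neq0 ?gt_eqF//.
  rewrite (ger0_norm (sqr_ge0 (s ^+ 2))) (ger0_norm (sqr_ge0 s)) !(@ger0_norm _ _%:R)//.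
  have H1 : 4 * `|mv M (x - xi) i| * `|mv M (x - xi) j| <= 4 * (kap * (r * s)) * (kap * (r * s)).
    by apply: ler_pM => //; rewrite ?mulr_ge0// ler_wpM2l.
  have H2 : 2 * `|M i j| <= 2 * (4 * lam)^-1 by rewrite ler_wpM2l.
  have i0 : 0 <= s ^- 2 by rewrite invr_ge0 sqr_ge0.
  have i4 : 0 <= (s ^+ 2) ^- 2 by rewrite invr_ge0 sqr_ge0.
  apply: le_trans (lerD (ler_wpM2r i4 H1) (ler_wpM2r i0 H2)) _.
  have -> : 4 * (kap * (r * s)) * (kap * (r * s)) / (s ^+ 2) ^+ 2 =
     4 * kap ^+ 2 / s ^+ 2 * r ^+ 2 by field; rewrite gt_eqF.
  rewrite (mulrDl (4 * _)) (mulrDl (4 * _ / _)); apply: lerD.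
    apply: ler_wpM2l; first exact: (mulr_ge0 (mulr_ge0 (ler0n R 4) (sqr_ge0 kap)) i0).
    by rewrite ler_pXn2r// ?nnegrE//; lra.
  rewrite -[leLHS]mulr1; apply: ler_wpM2l.
    by rewrite !mulr_ge0// invr_ge0 mulr_ge0// ltW.
  by rewrite expr_ge1//; lra.
have Db i j : `|ca L x t i j - ca L xi tau i j| <= Lam * (1 + Num.sqrt T) * s * (1 + r).
  apply: le_trans (alip xi tau tau01 i j) _.
  rewrite nzE gtr0_norm// ss -!mulrA ler_pM2l//.
  have := sqrtr_ge0 T; nra.
have -> : symbol (n%:R / 2) tau M xi L x t =
  \sum_i \sum_j (ca L x t i j - ca L xi tau i j) *
     (4 * mv M (x - xi) i * mv M (x - xi) j / (t - tau) ^+ 2 - 2 * M i j / (t - tau))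
  - \sum_k cb L x t 0 k * (2 * mv M (x - xi) k / (t - tau)) + cc L x t.
  rewrite /symbol.
  under [X in _ = X - _ + _]eq_bigr do (under eq_bigr do rewrite mulrBl; rewrite sumrB).
  rewrite sumrB; move: fs => /=; rewrite -/M.
  set S0 := \sum_i \sum_j ca L xi tau i j * _; set S1 := \sum_i \sum_j ca L x t i j * _.
  by set S2 := \sum_k _ => fs; lra.
have S1b : `|\sum_i \sum_j (ca L x t i j - ca L xi tau i j) *
     (4 * mv M (x - xi) i * mv M (x - xi) j / (t - tau) ^+ 2 - 2 * M i j / (t - tau))| <=
     (n%:R * (n%:R * ((4 * kap ^+ 2 + 2 * (4 * lam)^-1) * (Lam * (1 + Num.sqrt T)))))
       / s * (1 + r) ^+ 3.
  have -> : (n%:R * (n%:R * ((4 * kap ^+ 2 + 2 * (4 * lam)^-1) * (Lam * (1 + Num.sqrt T)))))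
       / s * (1 + r) ^+ 3 = \sum_(i < n) \sum_(j < n) (Lam * (1 + Num.sqrt T) * s * (1 + r) *
         ((4 * kap ^+ 2 + 2 * (4 * lam)^-1) / s ^+ 2 * (1 + r) ^+ 2)).
    rewrite !sumr_const !card_ord -[RHS]mulr_natl -[X in _ = _ * X]mulr_natl.
    by field; rewrite !gt_eqF.
  apply: le_trans (ler_norm_sum _ _ _) _; apply: ler_sum => i _.
  apply: le_trans (ler_norm_sum _ _ _) _; apply: ler_sum => j _.
  by rewrite normrM ler_pM.
have r3 : 1 <= (1 + r) ^+ 3 by rewrite expr_ge1//; lra.
have rr3 : r <= (1 + r) ^+ 3.
  by rewrite (@le_trans _ _ (1 + r))//; [lra|rewrite ler_eXnr//; lra].
have S2b : `|\sum_k cb L x t 0 k * (2 * mv M (x - xi) k / (t - tau))| <=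
    n%:R * (Lam * (2 * kap)) / s * (1 + r) ^+ 3.
  apply: (@le_trans _ _ (n%:R * (Lam * (2 * kap)) / s * r)); last first.
    by apply: ler_wpM2l => //; exact: divr_ge0 (mulr_ge0 (ler0n _ _) (mulr_ge0 (ltW Lam0) (mulr_ge0 (ler0n _ 2) kap0))) (ltW s0).
  have -> : n%:R * (Lam * (2 * kap)) / s * r = \sum_(k < n) Lam * (2 * (kap * (r * s)) / s ^+ 2).
    by rewrite sumr_const card_ord -mulr_natl; field; rewrite gt_eqF.
  apply: le_trans (ler_norm_sum _ _ _) _; apply: ler_sum => k _.
  rewrite normrM ler_pM// !normrM normrV ?unitfE ?gt_eqF// ss.
  rewrite (@ger0_norm _ 2)// (ger0_norm (sqr_ge0 s)) ler_wpM2r ?invr_ge0 ?sqr_ge0//.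
  by rewrite ler_wpM2l.
have S3b : `|cc L x t| <= Lam * Num.sqrt T / s * (1 + r) ^+ 3.
  have h : 1 <= Num.sqrt T / s by rewrite ler_pdivlMr// mul1r.
  apply: le_trans cbd _; rewrite -!mulrA ler_peMr ?(ltW Lam0)// mulrA.
  exact: mulr_ege1 h r3.
apply: le_trans (ler_normD _ _) _.
apply: le_trans (lerD (le_trans (ler_normB _ _) (lerD S1b S2b)) S3b) _.
by rewrite -!mulrDl.
Qed.

End fixed_coefficients.
End parametrix_bounds.

(** With [y = c r^2 / 4], both [(1 + r)^2 <= K (1 + y)] and [1 + y <= exp y] hold; squaring bounds
    the fourth power of [1 + r], hence the cube. *)
Lemma expR_cube_bound {R : realType} (c r : R) : 0 < c -> 0 <= r ->
  (1 + r) ^+ 3 <= (2 * (1 + 4 / c)) ^+ 2 * expR (c / 2 * r ^+ 2).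
Proof.
move=> c0 r0; have c4 : 0 < 4 / c by rewrite divr_gt0.
set K := 2 * (1 + 4 / c); pose y := c / 4 * r ^+ 2.
have K0 : 0 <= K by rewrite mulr_ge0// addr_ge0// ltW.
have y0 : 0 <= y by rewrite mulr_ge0 ?sqr_ge0// divr_ge0// ltW.
have H1 : (1 + r) ^+ 2 <= K * (1 + y).
  have -> : K * (1 + y) = 2 * (1 + r ^+ 2 + y + 4 / c).
    by rewrite /K /y; field; rewrite gt_eqF.
  have := sqr_ge0 (1 - r); lra.
have H2 : 1 + y <= expR y by exact: expR_ge1Dx.
have -> : c / 2 * r ^+ 2 = y + y by rewrite /y; field.
rewrite expRD -expr2 -exprMn; apply: (@le_trans _ _ (((1 + r) ^+ 2) ^+ 2)).
  by rewrite -exprM ler_weXn2l//; lra.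
apply: lerXn2r; rewrite ?nnegrE ?sqr_ge0//.
  by rewrite mulr_ge0 ?expR_ge0.
by apply: le_trans H1 _; rewrite ler_wpM2l.
Qed.

Section hker.
Context {R : realType} {n : nat}.
Implicit Types (x z xi : 'rV[R]_n) (c p q t th tau : R).

Definition hker c z th := gker (n%:R / 2) c%:M z th.

Lemma hkerE c z th : hker c z th = expR (- (n%:R / 2 * ln th) - c * sqnorm z / th).
Proof. by rewrite /hker /gker quad_scalar. Qed.

Lemma hker_gt0 c z th : 0 < hker c z th.
Proof. exact: gker_gt0. Qed.

Lemma hker_le c d z th : c <= d -> 0 < th -> hker d z th <= hker c z th.
Proof.
move=> cd th0; rewrite !hkerE ler_expR lerD2l lerN2 ler_pM2r ?invr_gt0//.
by rewrite ler_wpM2r ?sqnorm_ge0.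
Qed.

Lemma sqrt_exprn p : 0 < p -> Num.sqrt p ^+ n = expR (n%:R / 2 * ln p).
Proof.
move=> p0; rewrite -powR12_sqrt ?ltW// -powR_mulrn ?powR_ge0// -powRrM.
by rewrite /powR gt_eqF// [2^-1 * _]mulrC.
Qed.

Lemma measurable_sqnormB (v : 'rV[R]_n) :
  measurable_fun setT (fun y : n.-tuple (measurableTypeR R) => sqnorm (v - rv_of y)).
Proof.
apply: measurable_sum => i; apply: measurable_funX.
rewrite (_ : (fun _ => _) = fun y : n.-tuple (measurableTypeR R) => v 0 i - tnth y i).
  by apply: measurable_funB => //; exact: measurable_tnth.
by apply/funext => y; rewrite !mxE.
Qed.

Lemma measurable_hker c x xi p q :
  measurable_fun setT (fun y : n.-tuple (measurableTypeR R) =>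
    hker c (x - rv_of y) p * hker c (rv_of y - xi) q).
Proof.
have H (v : 'rV[R]_n) r : measurable_fun setT
    (fun y : n.-tuple (measurableTypeR R) => hker c (v - rv_of y) r).
  under eq_fun do rewrite hkerE.
  apply: measurableT_comp => //; apply: measurable_funB => //.
  by apply: measurable_funM => //; apply: measurable_funM => //; exact: measurable_sqnormB.
apply: measurable_funM => //.
by under eq_fun do rewrite hkerE -sqnormN opprB -hkerE; exact: H.
Qed.

(** The Chapman-Kolmogorov identity; the factor is there because [hker] is not normalized. The
    exponent [c] is reproduced, which is what allows the convolutions to be iterated without
    loss. *)
Lemma integral_hker c x xi p q : 0 < c -> 0 < p -> 0 < q ->
  (\int[leb n]_y (hker c (x - rv_of y) p * hker c (rv_of y - xi) q)%:E =
   (Num.sqrt (pi / c) ^+ n * hker c (x - xi) (p + q))%:E)%E.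
Proof.
move=> c0 p0 q0; have pq0 : 0 < p + q by rewrite addr_gt0.
have cp : 0 < c / p by rewrite divr_gt0.
have cq : 0 < c / q by rewrite divr_gt0.
pose k := expR (- (n%:R / 2 * ln p)) * expR (- (n%:R / 2 * ln q)).
transitivity (k%:E * \int[leb n]_y (expR (- (c / p * sqnorm (x - rv_of y)))
                  * expR (- (c / q * sqnorm (rv_of y - xi))))%:E)%E.
  rewrite -ge0_integralZl//=; last 2 first.
  - apply/measurable_EFinP; apply: measurable_funM.
      apply: measurableT_comp => //; apply: measurableT_comp => //.
      by apply: measurable_funM => //; exact: measurable_sqnormB.
    apply: measurableT_comp => //; apply: measurableT_comp => //.
    apply: measurable_funM => //; under eq_fun do rewrite -sqnormN opprB.
    exact: measurable_sqnormB.
  - by rewrite lee_fin mulr_ge0 ?expR_ge0.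
  apply: eq_integral => y _; rewrite -EFinM !hkerE !expRD /k; congr (_%:E).
  rewrite mulrACA; congr (_ * (expR _ * expR _)); rewrite -mulNr; ring.
rewrite integral_gauss_conv// -EFinM; congr (_%:E).
have pc : 0 < pi / c by rewrite divr_gt0// pi_gt0.
have pd : 0 < pi / (c / p + c / q) by rewrite divr_gt0 ?pi_gt0// addr_gt0.
rewrite (sqrt_exprn pc) (sqrt_exprn pd) hkerE /k -!expRD; congr expR.
have nz : c * q + c * p != 0 by rewrite gt_eqF// addr_gt0// mulr_gt0.
have -> : pi / (c / p + c / q) = pi / c * (p * q / (p + q)).
  by field; rewrite nz !(gt_eqF c0, gt_eqF p0, gt_eqF q0, gt_eqF pq0).
have pq : 0 < p * q / (p + q) by rewrite divr_gt0// mulr_gt0.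
have -> : ln (pi / c * (p * q / (p + q))) = ln (pi / c) + (ln p + ln q - ln (p + q)).
  by rewrite lnM ?posrE// [ln (p * _ / _)]ln_div ?posrE ?mulr_gt0// [ln (p * q)]lnM ?posrE.
have -> : c / p * (c / q) / (c / p + c / q) = c / (p + q).
  by field; rewrite nz !(gt_eqF c0, gt_eqF p0, gt_eqF q0, gt_eqF pq0).
ring.
Qed.

End hker.

(** * Convolution of weakly singular Gaussian bounds *)

Section convolution_bounds.
Context {R : realType}.
Implicit Types (a b mu : R).

Lemma root4M a b : 0 <= a -> 0 <= b -> root4 (a * b) = root4 a * root4 b.
Proof. by move=> a0 b0; rewrite /root4 !sqrtrM// sqrtr_ge0. Qed.

Lemma root4_le_expR a : 0 <= a -> root4 a <= expR a.
Proof.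
move=> a0; apply: le_trans (expR_ge1Dx a).
have H (y : R) : 0 <= y -> Num.sqrt y <= 1 + y.
  move=> y0; have := sqr_ge0 (1 - Num.sqrt y); have := sqr_sqrtr y0; have := sqrtr_ge0 y; nra.
have := H _ (sqrtr_ge0 a); have := H _ a0.
have [s1|s1] := leP (Num.sqrt a) 1.
  rewrite /root4 => _ _; apply: (@le_trans _ _ (Num.sqrt 1)); first exact: ler_wsqrtr.
  by rewrite sqrtr1; lra.
move=> h _; apply: le_trans h; rewrite /root4 -[leRHS]ger0_norm ?sqrtr_ge0//.
rewrite -sqrtr_sqr ler_wsqrtr// expr2 ler_peMl//; exact: ltW.
Qed.

Lemma inv_sqrt_half a th : 0 < th -> th / 2 <= a ->
  (Num.sqrt a)^-1 <= Num.sqrt 2 / Num.sqrt th.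
Proof.
move=> th0 tha; have a0 : 0 < a by apply: lt_le_trans tha; rewrite divr_gt0.
have -> : Num.sqrt 2 / Num.sqrt th = (Num.sqrt (th / 2))^-1.
  by rewrite sqrtrM ?ltW// sqrtrV// invfM invrK mulrC.
by rewrite lef_pV2 ?posrE ?sqrtr_gt0 ?divr_gt0// ler_wsqrtr.
Qed.

Definition w34 a : R := (root4 a * Num.sqrt a)^-1.

Lemma w34_ge0 a : 0 <= w34 a.
Proof. by rewrite invr_ge0 mulr_ge0 ?root4_ge0 ?sqrtr_ge0. Qed.

(** Since [root4 y <= exp y], the weight is at most [(mu a)^(-1/4)]: a small factor is gained at the
    price of one quarter power of singularity. The larger of [a] and [b] is at least half of the
    sum, so its inverse square root can be pulled out. *)
Lemma weight_le mu a b : 0 < mu -> 0 < a -> 0 < b ->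
  expR (- (mu * a)) / (Num.sqrt a * Num.sqrt b) <=
  (root4 mu)^-1 * (Num.sqrt 2 / Num.sqrt (a + b)) * (w34 b + w34 a).
Proof.
move=> mu0 a0 b0; have ab0 : 0 < a + b by rewrite addr_gt0.
have sa : 0 < Num.sqrt a by rewrite sqrtr_gt0.
have sb : 0 < Num.sqrt b by rewrite sqrtr_gt0.
have ra : 0 < root4 a by rewrite root4_gt0.
have rb : 0 < root4 b by rewrite root4_gt0.
have rmu : 0 < root4 mu by rewrite root4_gt0.
have s0 : 0 <= Num.sqrt 2 / Num.sqrt (a + b) by rewrite divr_ge0 ?sqrtr_ge0.
have H : expR (- (mu * a)) <= (root4 mu)^-1 * (root4 a)^-1.
  rewrite expRN -invfM lef_pV2 ?posrE ?expR_gt0 ?mulr_gt0//.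
  by rewrite -(root4M (ltW mu0) (ltW a0)) root4_le_expR// mulr_ge0// ltW.
apply: (@le_trans _ _ ((root4 mu)^-1 * (root4 a)^-1 / (Num.sqrt a * Num.sqrt b))).
  by rewrite ler_wpM2r// invr_ge0 mulr_ge0 ?sqrtr_ge0.
rewrite -!mulrA ler_wpM2l ?invr_ge0 ?root4_ge0// mulrA.
have wa := w34_ge0 a; have wb := w34_ge0 b.
have [ab|ab] := leP a b.
  apply: (@le_trans _ _ (Num.sqrt 2 / Num.sqrt (a + b) * w34 a)); last first.
    by apply: ler_wpM2l => //; lra.
  rewrite [_ * w34 a]mulrC /w34 !invfM mulrA ler_wpM2l ?mulr_ge0 ?invr_ge0 ?root4_ge0 ?sqrtr_ge0//.
  by apply: inv_sqrt_half => //; lra.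
apply: (@le_trans _ _ (Num.sqrt 2 / Num.sqrt (a + b) * w34 b)); last first.
  by apply: ler_wpM2l => //; lra.
rewrite /w34 invfM mulrCA ler_pM ?mulr_ge0 ?invr_ge0 ?root4_ge0 ?sqrtr_ge0//.
  by apply: inv_sqrt_half => //; lra.
rewrite -invfM lef_pV2 ?posrE ?mulr_gt0// ler_wpM2r ?sqrtr_ge0//.
exact/ler_root4/ltW.
Qed.

(** The space integral is [integral_hker], the time integral [integral_itv_root4]. Only the product
    [B1 * B2] is constrained, so that a weight can be shared between the two factors. *)
Lemma st_conv_le n (K1 K2 : 'rV[R]_n -> R -> 'rV[R]_n -> R -> R) (c C : R)
    (B1 B2 : R -> R) x t xi tau : 0 < c -> tau < t -> 0 <= C ->
    (forall s eta, tau < s < t -> `|K1 x t eta s| <= B1 s * hker c (x - eta) (t - s)) ->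
    (forall s eta, tau < s < t -> `|K2 eta s xi tau| <= B2 s * hker c (eta - xi) (s - tau)) ->
    (forall s, tau < s < t -> 0 <= B1 s * B2 s <= C * (w34 (s - tau) + w34 (t - s))) ->
  `|st_conv K1 K2 x t xi tau| <=
  8 * C * (Num.sqrt (pi / c) ^+ n) * root4 (t - tau) * hker c (x - xi) (t - tau).
Proof.
move=> c0 taut C0 K1b K2b Bb; set M := Num.sqrt _ ^+ n; set H := hker _ _ _.
have M0 : 0 <= M by rewrite exprn_ge0// sqrtr_ge0.
have H0 : 0 <= H by rewrite ltW// hker_gt0.
rewrite /st_conv; apply: (@Rintegral_le _ (measurableTypeR R) R lebesgue_measure `]tau, t[%classic _
  (fun s => (C * M * H) * (w34 (s - tau) + w34 (t - s)))).
  move=> s; rewrite /= in_itv/= => ts; have /andP[B0 BC] := Bb _ ts.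
  have /andP[tau_s st] := ts.
  have C1 : 0 <= M * H by rewrite mulr_ge0.
  apply: (@le_trans _ _ (B1 s * B2 s * (M * H))); last first.
    by apply: le_trans (ler_wpM2r C1 BC) _; rewrite le_eqVlt; apply/orP; left; apply/eqP; ring.
  apply: (@Rintegral_le _ _ _ _ _ _
    (fun y => B1 s * B2 s * (hker c (x - rv_of y) (t - s) * hker c (rv_of y - xi) (s - tau)))).
    move=> y _; rewrite normrM mulrACA; apply: ler_pM => //; [exact: K1b|exact: K2b].
  under eq_integral do rewrite EFinM.
  rewrite ge0_integralZl//=.
  - rewrite integral_hker ?subr_gt0// -EFinM lee_fin.
    by rewrite (_ : t - s + (s - tau) = t - tau)//; ring.
  - by apply/measurable_EFinP; exact: measurable_hker.
  - by move=> y _; rewrite lee_fin mulr_ge0 ?ltW ?hker_gt0.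
apply: (@le_trans _ _ (8 * (C * M * H) * root4 (t - tau))%:E).
  by apply: integral_itv_root4 => //; rewrite !mulr_ge0.
by rewrite lee_fin le_eqVlt; apply/orP; left; apply/eqP; ring.
Qed.

Lemma normr_lim_series_le (u : R^nat) (b : R) : (forall l, `|u l| <= b * 2^-1 ^+ l) ->
  `|limn (series u)| <= 2 * b.
Proof.
move=> ub; have h2 : `|2^-1 : R| < 1 by rewrite ger0_norm ?invr_ge0//; lra.
have cg := @cvg_geometric_series R b 2^-1 h2.
have cn : cvgn [normed series u].
  apply: (@series_le_cvg _ _ (geometric b 2^-1)) => //.
  - by move=> l; exact: normr_ge0.
  - by move=> l; apply: le_trans (ub l); exact: normr_ge0.
  - by apply/cvg_ex; eexists; exact: cg.
apply: le_trans (lim_series_norm cn) _.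
have -> : 2 * b = limn (series (geometric b 2^-1)).
  by rewrite (cvg_lim _ cg)//; field.
by apply: lim_series_le => //; apply/cvg_ex; eexists; exact: cg.
Qed.

End convolution_bounds.

(** * Estimates of the parametrix *)

(** The closed form of the parametrix as a multiple of [gker] only holds after the time [tau]; the
    time derivative, being a limit along []tau, t1]], sees no other times. *)
Lemma eq_Lop {R : realType} {n : nat} (L : coeffs R n) (tau t1 : R)
    (u v : 'rV[R]_n -> R -> R) x t : tau < t <= t1 ->
  (forall y s, tau < s <= t1 -> u y s = v y s) -> Lop L tau t1 u x t = Lop L tau t1 v x t.
Proof.
move=> tt uv.
have uvt : u^~ t = v^~ t by apply/funext => y; exact: uv.
have E1 k : (d1 u k)^~ t = (d1 v k)^~ t by apply/funext => y; rewrite /d1 uvt.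
have E1x k : d1 u k x t = d1 v k x t by rewrite /d1 uvt.
have E2 i j : d2 u i j x t = d2 v i j x t.
  by rewrite /d2 -[LHS]/('D_(ebasis i) ((d1 u j)^~ t) x) E1.
have E3 : t_derive tau t1 (u x) t = t_derive tau t1 (v x) t.
  rewrite /t_derive; set F := (X in lim X = _); set G := (X in _ = lim X).
  suff -> : F = G by [].
  apply/funext => P; rewrite /F /G /fmap/= /within/=.
  set A := (X in t^' X = _); set B := (X in _ = t^' X).
  suff -> : A = B by [].
  apply/funext => s; apply/propext; rewrite /A /B /=.
  by split=> H Ds; move: (H Ds); rewrite /= in_itv/= in Ds; rewrite /dt_quot !uv.
have S1 : \sum_i \sum_j ca L x t i j * d2 u i j x t =
    \sum_i \sum_j ca L x t i j * d2 v i j x t.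
  by apply: eq_bigr => i _; apply: eq_bigr => j _; rewrite E2.
have S2 : \sum_k cb L x t 0 k * d1 u k x t = \sum_k cb L x t 0 k * d1 v k x t.
  by apply: eq_bigr => k _; rewrite E1x.
exact: (congr2 (fun p q => p - q) (congr2 +%R (congr2 +%R S1 S2)
  (congr1 ( *%R (cc L x t)) (uv x t tt))) E3).
Qed.

Section parametrix_estimates.
Context {R : realType} {n : nat}.
Variables (lam Lam T : R).
Hypotheses (n0 : (0 < n)%N) (lam0 : 0 < lam) (Lam0 : 0 < Lam) (T0 : 0 < T).

(** By [quad_invmx_ge] the exponent of the parametrix is at least [2 c]: one half stays in [H_c],
    the other one pays for the polynomial factor [(1 + r)^3]. *)
Let c : R := lam / (n%:R * Lam) ^+ 2 / 8.
Let P0 : R := (4 * pi) `^ (- (n%:R / 2)).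
Let Zmax : R := P0 * Num.sqrt ((n`!)%:R * lam^-1 ^+ n).
Let Zmin : R := P0 * Num.sqrt (((n`!)%:R * Lam ^+ n)^-1).
Let A1 : R := Zmax * @symbol_const R n lam Lam T * (2 * (1 + 4 / (2 * c))) ^+ 2.
Let Mc : R := Num.sqrt (pi / c) ^+ n.
(** Chosen so that [8 A1 sqrt 2 Mc root4 T / root4 mu = 1/2], the factor that one convolution with
    [Phi1] costs. *)
Let mu : R := (16 * A1 * Num.sqrt 2 * Mc * root4 T) ^+ 4.
Let A2 : R := 8 * (Zmax * (2 * A1 * expR (mu * T) * root4 T)) * Mc.

Let nR : 0 < n%:R :> R. Proof. by rewrite ltr0n. Qed.

Let c_gt0 : 0 < c.
Proof. by rewrite !divr_gt0// exprn_gt0// mulr_gt0. Qed.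

Let P0_gt0 : 0 < P0.
Proof. by rewrite powR_gt0// mulr_gt0// pi_gt0. Qed.

Let Zmax_gt0 : 0 < Zmax.
Proof.
by rewrite mulr_gt0// sqrtr_gt0 mulr_gt0 ?ltr0n ?fact_gt0// exprn_gt0// invr_gt0.
Qed.

Let Zmin_gt0 : 0 < Zmin.
Proof.
by rewrite mulr_gt0// sqrtr_gt0 invr_gt0 mulr_gt0 ?ltr0n ?fact_gt0// exprn_gt0.
Qed.

Let symbol_const_gt0 : 0 < @symbol_const R n lam Lam T.
Proof.
rewrite /symbol_const ltr_wpDl//; last by rewrite mulr_gt0// sqrtr_gt0.
have l4 : 0 <= (4 * lam)^-1 by rewrite invr_ge0 mulr_ge0// ltW.
have s0 := sqrtr_ge0 T; have L0 := ltW Lam0; have n1 := ltW nR.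
by rewrite addr_ge0// !(mulr_ge0, addr_ge0, sqr_ge0).
Qed.

Let A1_gt0 : 0 < A1.
Proof.
apply: mulr_gt0; first exact: mulr_gt0.
by rewrite exprn_gt0// mulr_gt0// addr_gt0// divr_gt0// mulr_gt0.
Qed.

Let Mc_gt0 : 0 < Mc.
Proof. by rewrite exprn_gt0// sqrtr_gt0 divr_gt0// pi_gt0. Qed.

Let g_gt0 : 0 < 16 * A1 * Num.sqrt 2 * Mc * root4 T.
Proof.
by rewrite mulr_gt0 ?root4_gt0// mulr_gt0// mulr_gt0 ?sqrtr_gt0// mulr_gt0.
Qed.

Let mu_gt0 : 0 < mu. Proof. by rewrite exprn_gt0. Qed.

Let root4_mu : root4 mu = 16 * A1 * Num.sqrt 2 * Mc * root4 T.
Proof.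
rewrite /mu /root4 -[4%N]/(2 * 2)%N exprM sqrtr_sqr ger0_norm ?sqr_ge0//.
by rewrite sqrtr_sqr gtr0_norm.
Qed.

Section estimates.
Variables (t0 t1 : R) (L : coeffs R n).
Hypotheses (t01 : t1 - t0 = T) (Lreg : regular lam Lam t0 t1 L).
Implicit Types (x xi eta : 'rV[R]_n) (t tau s : R).

Let kpar xi tau : R := P0 * Num.sqrt (\det (invmx (ca L xi tau))).

Let parametrixE x t xi tau : tau < t ->
  parametrix L x t xi tau =
  kpar xi tau * gker (n%:R / 2) (4^-1 *: invmx (ca L xi tau)) (x - xi) (t - tau).
Proof.
move=> tt; have th0 : 0 < t - tau by rewrite subr_gt0.
rewrite /parametrix /kpar /gker powRM ?mulr_ge0 ?pi_ge0 ?ltW//.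
rewrite -/P0 /powR (gt_eqF th0) expRD mulNr quadZ invfM !mulrA.
by rewrite -[P0 * _ * _]mulrA [expR _ * Num.sqrt _]mulrC !mulrA [quad _ _ / 4]mulrC.
Qed.

Let kpar_bounds xi tau : t0 < tau < t1 ->
  Zmin <= kpar xi tau <= Zmax.
Proof.
move=> tt; have [asym aell ab _ _] := Lreg xi tt.
apply/andP; split; rewrite ler_pM2l// ler_wsqrtr//.
- exact: (det_invmx_ge lam0 asym aell ab (ltW Lam0)).
- exact: det_invmx_le lam0 aell.
Qed.

(** In the upper bound the second half of the exponent is kept as a separate factor: [Z_le] discards
    it, [Phi1_le] spends it. *)
Let gker_bounds x t xi tau : t0 < tau -> tau < t -> t < t1 ->
  hker (4 * lam)^-1 (x - xi) (t - tau) <=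
  gker (n%:R / 2) (4^-1 *: invmx (ca L xi tau)) (x - xi) (t - tau) <=
  expR (- (c * (sqnorm (x - xi) / (t - tau)))) * hker c (x - xi) (t - tau).
Proof.
move=> t0tau taut tt1; have th0 : 0 < t - tau by rewrite subr_gt0.
have tt : t0 < tau < t1 by apply/andP; split; lra.
have [asym aell ab _ _] := Lreg xi tt.
rewrite !hkerE /gker -expRD !ler_expR quadZ; apply/andP; split.
  rewrite lerD2l lerN2 ler_pM2r ?invr_gt0// invfM -mulrA ler_pM2l ?invr_gt0//.
  exact: quad_invmx_le lam0 asym aell _.
rewrite [leRHS](_ : _ = - (n%:R / 2 * ln (t - tau)) - 2 * c * sqnorm (x - xi) / (t - tau)); last by ring.
rewrite lerD2l lerN2 ler_pM2r ?invr_gt0//.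
have := quad_invmx_ge lam0 asym aell ab (x - xi) Lam0.
by rewrite /c; lra.
Qed.

Let Z_ge x t xi tau : t0 < tau -> tau < t -> t < t1 ->
  Zmin * hker (4 * lam)^-1 (x - xi) (t - tau) <= parametrix L x t xi tau.
Proof.
move=> t0tau taut tt1; rewrite parametrixE//.
have tt : t0 < tau < t1 by apply/andP; split; lra.
have /andP[k1 _] := kpar_bounds xi tt; have /andP[g1 _] := gker_bounds x xi t0tau taut tt1.
by apply: ler_pM => //; apply: ltW => //; exact: hker_gt0.
Qed.

Let Z_le x t xi tau : t0 < tau -> tau < t -> t < t1 ->
  `|parametrix L x t xi tau| <= Zmax * hker c (x - xi) (t - tau).
Proof.
move=> t0tau taut tt1; rewrite parametrixE//.
have tt : t0 < tau < t1 by apply/andP; split; lra.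
have /andP[k0 k1] := kpar_bounds xi tt; have /andP[_ g1] := gker_bounds x xi t0tau taut tt1.
have k2 : 0 <= kpar xi tau by apply: le_trans k0; exact: ltW.
rewrite normrM (ger0_norm k2) gtr0_norm ?gker_gt0//.
apply: ler_pM => //; first by apply: ltW; exact: gker_gt0.
apply: le_trans g1 _; rewrite ler_piMl ?(ltW (hker_gt0 _ _ _))//.
have th0 : 0 <= t - tau by rewrite subr_ge0 ltW.
rewrite -expR0 ler_expR lerNl oppr0.
exact: mulr_ge0 (ltW c_gt0) (divr_ge0 (sqnorm_ge0 _) th0).
Qed.

Let Phi1_le x t xi tau : t0 < tau -> tau < t -> t < t1 ->
  `|Phi1 L t1 x t xi tau| <= A1 / Num.sqrt (t - tau) * hker c (x - xi) (t - tau).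
Proof.
move=> t0tau taut tt1.
have tt : t0 < tau < t1 by apply/andP; split; lra.
have [asym aell ab _ _] := Lreg xi tt.
have Ms : (4^-1 *: invmx (ca L xi tau))^T = 4^-1 *: invmx (ca L xi tau).
  by rewrite linearZ/= invmx_sym.
have tt1' : tau < t <= t1 by rewrite taut ltW.
have th0 : 0 < t - tau by rewrite subr_gt0.
have -> : Phi1 L t1 x t xi tau = kpar xi tau *
    gker (n%:R / 2) (4^-1 *: invmx (ca L xi tau)) (x - xi) (t - tau) *
    symbol (n%:R / 2) tau (4^-1 *: invmx (ca L xi tau)) xi L x t.
  have E := @Lop_gker R n (n%:R / 2) tau _ xi Ms L t1 (kpar xi tau) x t tt1'.
  rewrite /Phi1 -[RHS]E; apply: eq_Lop => // y s /andP[taus _].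
  exact: parametrixE.
have /andP[k0 k1] := kpar_bounds xi tt; have /andP[_ g1] := gker_bounds x xi t0tau taut tt1.
have k2 : 0 <= kpar xi tau by apply: le_trans k0; exact: ltW.
set r := Num.sqrt (sqnorm (x - xi)) / Num.sqrt (t - tau).
have r0 : 0 <= r by rewrite divr_ge0 ?sqrtr_ge0.
have r2 : r ^+ 2 = sqnorm (x - xi) / (t - tau).
  by rewrite expr_div_n !sqr_sqrtr ?sqnorm_ge0 ?(ltW th0).
have S := parametrix_symbol_le lam0 Lam0 t01 Lreg t0tau taut tt1 erefl (erefl r).
have c2 : 0 < 2 * c by rewrite mulr_gt0.
have E := expR_cube_bound c2 r0.
rewrite 2!normrM (ger0_norm k2) gtr0_norm ?gker_gt0//.
set H := hker c _ _ in g1 *; set K := (2 * (1 + _)) ^+ 2 in E.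
have H0 : 0 < H by exact: hker_gt0.
have K0 : 0 <= K by exact: sqr_ge0.
have s0 : 0 < Num.sqrt (t - tau) by rewrite sqrtr_gt0.
apply: (@le_trans _ _ (Zmax * (expR (- (c * r ^+ 2)) * H) *
    (@symbol_const R n lam Lam T / Num.sqrt (t - tau) * (K * expR (2 * c / 2 * r ^+ 2))))).
  apply: ler_pM => //.
  - by rewrite mulr_ge0// ltW// gker_gt0.
  - by apply: ler_pM => //; [exact/ltW/gker_gt0|rewrite r2].
  - apply: le_trans S _; apply: ler_wpM2l => //.
    by rewrite divr_ge0// ltW.
have -> : 2 * c / 2 * r ^+ 2 = c * r ^+ 2 by field.
rewrite expRN le_eqVlt; apply/orP; left; apply/eqP.
by rewrite /A1 -/K; field; rewrite !gt_eqF// expR_gt0.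
Qed.

(** In the convolution, [exp(mu (u - tau))] is split as [exp(mu (t - tau)) exp(- mu (t - u))]: the
    first factor reproduces the weight of the claim, the second one is what [weight_le] turns into
    the ratio 1/2. *)
Let Phi_le l x t xi tau : t0 < tau -> tau < t -> t < t1 ->
  `|Phi_ L t1 l x t xi tau| <=
  A1 * expR (mu * (t - tau)) / Num.sqrt (t - tau) * hker c (x - xi) (t - tau) * 2^-1 ^+ l.
Proof.
elim: l x t => [|l IH] x t t0tau taut tt1.
  rewrite expr0 mulr1; apply: le_trans (Phi1_le x xi t0tau taut tt1) _.
  apply: ler_wpM2r; first exact/ltW/hker_gt0.
  apply: ler_wpM2r; first by rewrite invr_ge0 sqrtr_ge0.
  rewrite ler_peMr ?(ltW A1_gt0)// -expR0 ler_expR mulr_ge0 ?(ltW mu_gt0)// subr_ge0.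
  exact: ltW.
have th0 : 0 < t - tau by rewrite subr_gt0.
set s := Num.sqrt (t - tau); have s0 : 0 < s by rewrite sqrtr_gt0.
set e := expR (mu * (t - tau)); have e0 : 0 < e by exact: expR_gt0.
pose C := A1 * A1 * 2^-1 ^+ l * e * ((root4 mu)^-1 * (Num.sqrt 2 / s)).
have h0 : 0 <= 2^-1 ^+ l :> R by rewrite exprn_ge0// invr_ge0.
have C0 : 0 <= C.
  have A0 := ltW A1_gt0; apply: mulr_ge0.
    by apply: mulr_ge0 (ltW e0); apply: mulr_ge0 h0; exact: mulr_ge0.
  apply: mulr_ge0; first by rewrite invr_ge0 root4_ge0.
  exact: divr_ge0 (sqrtr_ge0 _) (ltW s0).
have := @st_conv_le R n (Phi1 L t1) (Phi_ L t1 l) c C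
  (fun u => A1 / Num.sqrt (t - u))
  (fun u => A1 * expR (mu * (u - tau)) / Num.sqrt (u - tau) * 2^-1 ^+ l)
  x t xi tau c_gt0 taut C0.
move=> /(_ _ _ _)/le_trans; apply.
- move=> u eta /andP[tu ut]; apply: Phi1_le => //; exact: lt_trans tu.
- move=> u eta /andP[tu ut]; apply: le_trans (IH _ _ t0tau tu (lt_trans ut tt1)) _.
  by rewrite mulrAC.
- move=> u /andP[tu ut].
  have tu0 : 0 < t - u by rewrite subr_gt0.
  have ut0 : 0 < u - tau by rewrite subr_gt0.
  have W := weight_le mu_gt0 tu0 ut0.
  have stu : 0 < Num.sqrt (t - u) by rewrite sqrtr_gt0.
  have sut : 0 < Num.sqrt (u - tau) by rewrite sqrtr_gt0.
  have -> : A1 / Num.sqrt (t - u) * (A1 * expR (mu * (u - tau)) / Num.sqrt (u - tau) * 2^-1 ^+ l)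
     = A1 * A1 * 2^-1 ^+ l * e * (expR (- (mu * (t - u))) / (Num.sqrt (t - u) * Num.sqrt (u - tau))).
    have -> : expR (mu * (u - tau)) = e * expR (- (mu * (t - u))).
      by rewrite /e -expRD; congr expR; ring.
    by field; rewrite !gt_eqF.
  have AA : 0 <= A1 * A1 * 2^-1 ^+ l * e.
    have A0 := ltW A1_gt0.
    by apply: mulr_ge0 (ltW e0); apply: mulr_ge0 h0; exact: mulr_ge0.
  apply/andP; split.
    by rewrite mulr_ge0// divr_ge0 ?expR_ge0 ?mulr_ge0 ?sqrtr_ge0.
  rewrite /C -[leRHS]mulrA; apply: ler_wpM2l => //; apply: le_trans W _.
  by rewrite [t - u + _](_ : _ = t - tau)//; ring.
rewrite -/Mc exprS.
have H0 : 0 < hker c (x - xi) (t - tau) by exact: hker_gt0.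
set H := hker _ _ _ in H0 *.
have rT : root4 (t - tau) <= root4 T by apply: ler_root4; rewrite -t01 lerB// ltW.
have rT0 : 0 < root4 T by rewrite root4_gt0.
apply: (@le_trans _ _ (8 * C * Mc * root4 T * H)).
  apply: ler_wpM2r (ltW H0) _ _ _; apply: ler_wpM2l rT.
  exact: mulr_ge0 (mulr_ge0 (ler0n R 8) C0) (ltW Mc_gt0).
have q2 : 0 < Num.sqrt (2 : R) by rewrite sqrtr_gt0.
rewrite le_eqVlt; apply/orP; left; apply/eqP; rewrite /C root4_mu.
by field; rewrite !gt_eqF.
Qed.

Lemma parametrix_estimates_aux x t xi tau : t0 < tau -> tau < t -> t < t1 ->
  [/\ Zmin * hker (4 * lam)^-1 (x - xi) (t - tau) <= parametrix L x t xi tau,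
      parametrix L x t xi tau <= Zmax * hker c (x - xi) (t - tau) &
      `|parametrix_solution L t1 x t xi tau - parametrix L x t xi tau| <=
      A2 * root4 (t - tau) * hker c (x - xi) (t - tau)].
Proof.
move=> t0tau taut tt1; split.
- exact: Z_ge.
- exact: le_trans (ler_norm _) (Z_le x xi t0tau taut tt1).
rewrite /parametrix_solution addrAC subrr add0r.
(* The 2 is the sum of the geometric series, and [root4 T] is the cost of replacing
   [(u - tau)^(-1/2)] by [w34 (u - tau)]. *)
pose C := Zmax * (2 * A1 * expR (mu * T) * root4 T).
have AE : 0 <= 2 * A1 * expR (mu * T).
  exact: mulr_ge0 (mulr_ge0 (ler0n _ 2) (ltW A1_gt0)) (expR_ge0 _).
have C0 : 0 <= C by exact: mulr_ge0 (ltW Zmax_gt0) (mulr_ge0 AE (root4_ge0 _)).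
have := @st_conv_le R n (parametrix L) (Phi L t1) c C (fun=> Zmax)
  (fun u => 2 * A1 * expR (mu * T) / Num.sqrt (u - tau))
  x t xi tau c_gt0 taut C0.
move=> /(_ _ _ _)/le_trans; apply.
- move=> u eta /andP[tu ut]; apply: Z_le => //; exact: lt_trans tu.
- move=> u eta /andP[tu ut].
  have P := fun l => Phi_le l eta xi t0tau tu (lt_trans ut tt1).
  apply: le_trans (normr_lim_series_le P) _.
  rewrite mulrA; apply: ler_wpM2r; first exact/ltW/hker_gt0.
  rewrite mulrA; apply: ler_wpM2r; first by rewrite invr_ge0 sqrtr_ge0.
  rewrite mulrA; apply: ler_wpM2l; first by rewrite mulr_ge0// ltW.
  rewrite ler_expR ler_pM2l// -t01; apply: lerB; first by rewrite ltW// (lt_trans ut).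
  exact: ltW.
- move=> u /andP[tu ut].
  have ut0 : 0 < u - tau by rewrite subr_gt0.
  have sut : 0 < Num.sqrt (u - tau) by rewrite sqrtr_gt0.
  have rut : 0 < root4 (u - tau) by rewrite root4_gt0.
  apply/andP; split.
    exact: mulr_ge0 (ltW Zmax_gt0) (divr_ge0 AE (sqrtr_ge0 _)).
  apply: (@le_trans _ _ (C * w34 (u - tau))); last first.
    by apply: ler_wpM2l => //; rewrite lerDl w34_ge0.
  rewrite /C -(mulrA Zmax); apply: ler_wpM2l; first exact: ltW.
  rewrite -(mulrA (2 * A1 * _)); apply: ler_wpM2l => //.
  rewrite /w34 invfM mulrA ler_peMl ?invr_ge0 ?sqrtr_ge0//.
  rewrite ler_pdivlMr// mul1r ler_root4// -t01; apply: lerB; last exact: ltW.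
  by rewrite ltW// (lt_trans ut).
by rewrite /A2 -/C.
Qed.

End estimates.

Lemma parametrix_estimates :
  exists A a c B : R, [/\ 0 < A, 0 < a, 0 < c, 0 < B &
  forall t0 t1 (L : coeffs R n), t1 - t0 = T -> regular lam Lam t0 t1 L ->
  forall x t xi tau, t0 < tau -> tau < t -> t < t1 ->
  [/\ a * hker B (x - xi) (t - tau) <= parametrix L x t xi tau,
      parametrix L x t xi tau <= A * hker c (x - xi) (t - tau) &
      `|parametrix_solution L t1 x t xi tau - parametrix L x t xi tau| <=
      A * root4 (t - tau) * hker c (x - xi) (t - tau)]].
Proof.
exists (Num.max Zmax A2), Zmin, c, (4 * lam)^-1; split => //.
- by rewrite lt_max Zmax_gt0.
- by rewrite invr_gt0 mulr_gt0.
move=> t0 t1 L t01 Lreg x t xi tau h1 h2 h3.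
have [E1 E2 E3] := parametrix_estimates_aux t01 Lreg x xi h1 h2 h3.
have H0 := ltW (hker_gt0 c (x - xi) (t - tau)).
split=> //.
  by apply: le_trans E2 _; apply: ler_wpM2r => //; rewrite le_max lexx.
apply: le_trans E3 _; apply: ler_wpM2r => //; apply: ler_wpM2r; first exact: root4_ge0.
by rewrite le_max lexx orbT.
Qed.

End parametrix_estimates.

(** * The maximum principle *)

Section line_derivatives.
Context {R : realType}.

Lemma is_derive_continuous (f : R -> R) (x a : R) :
  is_derive x (1 : R) f a -> {for x, continuous f}.
Proof.
by move=> [d _]; apply: differentiable_continuous; apply/derivable1_diffP.
Qed.

Lemma is_derive_cvg {V : normedModType R} (f : V -> R) (x v : V) (l : R) :
  is_derive x v f l <-> h^-1 * (f (h *: v + x) - f x) @[h --> (0 : R)^'] --> l.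
Proof.
split; first by move=> [d <-].
move=> c; split; first by apply/cvg_ex; exists l.
exact: cvg_lim c.
Qed.

Lemma MVT_bound (f df : R -> R) (b c e : R) :
  (forall x, `|x| <= `|b| -> is_derive x (1 : R) f (df x)) ->
  (forall x, `|x| <= `|b| -> `|df x - c| <= e) ->
  `|f b - f 0 - c * b| <= e * `|b|.
Proof.
move=> fd de; have [b0|b0|<-] := ltgtP 0 b; last by rewrite mulr0 !subrr normr0 mulr0.
- have H x : x \in `[0, b] -> `|x| <= `|b|.
    by rewrite in_itv/= => /andP[? ?]; rewrite !ger0_norm// ltW.
  have [|y yb ->] := @MVT _ f df 0 b b0 (fun x xb => fd x (H x (subset_itv_oo_cc xb))).
    apply: continuous_in_subspaceT => x /set_mem/H/fd; exact: is_derive_continuous.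
  by rewrite subr0 -mulrBl normrM ler_wpM2r// de// H// (subset_itv_oo_cc yb).
- have H x : x \in `[b, 0] -> `|x| <= `|b|.
    by rewrite in_itv/= => /andP[? ?]; rewrite !ler0_norm ?lerN2// ltW.
  have [|y yb E] := @MVT _ f df b 0 b0 (fun x xb => fd x (H x (subset_itv_oo_cc xb))).
    apply: continuous_in_subspaceT => x /set_mem/H/fd; exact: is_derive_continuous.
  have -> : f b - f 0 - c * b = (df y - c) * b by lra.
  by rewrite normrM ler_wpM2r// de// H// (subset_itv_oo_cc yb).
Qed.

(** If [c] were positive, [g1] would be positive just to the right of 0, and by the mean value
    theorem [g] would exceed [g 0] there. *)
Lemma second_derivative_at_max (g g1 : R -> R) (c d : R) : 0 < d ->
  (forall s, is_derive s (1 : R) g (g1 s)) -> is_derive (0 : R) (1 : R) g1 c ->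
  (forall s, `|s| < d -> g s <= g 0) -> g1 0 = 0 /\ c <= 0.
Proof.
move=> d0 gd g1d gmax.
have g10 : g1 0 = 0.
  have md : - d <= d by lra.
  have H : is_derive (0 : R) (1 : R) g 0.
    apply: (derive1_at_max md).
    - by move=> t _; have [] := gd t.
    - by rewrite in_itv/= oppr_lt0 d0.
    - by move=> t; rewrite in_itv/= => ?; apply: gmax; rewrite ltr_norml.
  by have [_ <-] := gd 0; have [_ ->] := H.
split=> //; rewrite leNgt; apply/negP => c0.
have /is_derive_cvg/cvgrPdist_lt/(_ (c / 2)) := g1d.
rewrite divr_gt0// => /(_ isT) [e /= e0 He].
pose s := Num.min e d / 2.
have m0 : 0 < Num.min e d by rewrite lt_min e0.
have s0 : 0 < s by rewrite divr_gt0.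
have [se sd] : s < e /\ s < d.
  have : Num.min e d <= e by rewrite ge_min lexx.
  have : Num.min e d <= d by rewrite ge_min lexx orbT.
  by rewrite /s; lra.
have [y|y ys E] := @MVT _ g g1 0 s s0 (fun x _ => gd x).
  by apply: continuous_in_subspaceT => x _; exact: is_derive_continuous (gd x).
move: ys; rewrite in_itv/= => /andP[y0 ys].
have := He y; rewrite /ball_/= sub0r normrN gtr0_norm// => /(_ (lt_trans ys se)).
rewrite gt_eqF// => /(_ isT); rewrite addr0 g10 subr0 /GRing.scale/= mulr1.
rewrite ltr_norml => /andP[_ H].
have g1y : 0 < g1 y.
  have : 0 < y^-1 * g1 y by lra.
  by rewrite pmulr_rgt0// invr_gt0.
have := gmax s; rewrite gtr0_norm// => /(_ sd).
have : 0 < g1 y * s by rewrite mulr_gt0.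
by rewrite subr0 in E; lra.
Qed.

End line_derivatives.

Section gateaux.
Context {R : realType} {n : nat}.
Implicit Types (x v y : 'rV[R]_n).

Lemma row_sum_ebasis v : v = \sum_i v 0 i *: ebasis i.
Proof. by rewrite {1}[v]row_sum_delta. Qed.

(* Mean value theorem along one coordinate at a time. *)
Lemma is_derive_partials (f : 'rV[R]_n -> R) (D : 'I_n -> 'rV[R]_n -> R) x v :
  (forall i y, is_derive y (ebasis i) f (D i y)) ->
  (forall i, {for x, continuous (D i)}) ->
  is_derive x v f (\sum_i v 0 i * D i x).
Proof.
move=> fD Dc; rewrite [v in is_derive _ v]row_sum_ebasis.
elim: (index_enum _) => [|k s IH].
  rewrite !big_nil; apply/is_derive_cvg.
  under eq_fun do rewrite scaler0 add0r subrr mulr0.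
  exact: cvg_cst.
rewrite !big_cons; set w := \sum_(i <- s) _ in IH *; set a := v 0 k.
apply/is_derive_cvg.
have E h : h^-1 * (f (h *: (a *: ebasis k + w) + x) - f x) =
   h^-1 * (f (h *: w + x + (h * a) *: ebasis k) - f (h *: w + x)) +
   h^-1 * (f (h *: w + x) - f x).
  rewrite -mulrDr; congr (_ * _); rewrite addrA subrK; congr (f _ - _).
  by rewrite scalerDr scalerA -addrA addrC.
under eq_fun do rewrite E.
apply: cvgD; last exact/is_derive_cvg.
apply/cvgrPdist_le => e e0.
have e1 : 0 < e / (`|a| + 1) by rewrite divr_gt0// ltr_wpDl.
have /cvgrPdist_le/(_ _ e1)/nbhs_ballP [d /= d0 Hd] := Dc k.
pose N := `|w| + `|a| * `|ebasis k : 'rV[R]_n| + 1.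
have N0 : 0 < N by rewrite ltr_wpDl// addr_ge0// mulr_ge0.
exists (d / N); first by rewrite /= divr_gt0.
move=> h; rewrite /ball_/= sub0r normrN => hd h0.
have hN : `|h| * N < d by rewrite -ltr_pdivlMr.
have H := @MVT_bound R (fun r => f (h *: w + x + r *: ebasis k))
   (fun r => D k (h *: w + x + r *: ebasis k)) (h * a) (D k x) (e / (`|a| + 1)).
have {}H : `|f (h *: w + x + (h * a) *: ebasis k) - f (h *: w + x) - D k x * (h * a)|
    <= e / (`|a| + 1) * `|h * a|.
  rewrite scale0r addr0 in H; apply: H => r rb.
    set y := h *: w + x.
    have /is_derive_lineP := fD k (y + r *: ebasis k).
    move=> F; have F' : is_derive (r - r) (1 : R) (fun s : R => f (s *: ebasis k + (y + r *: ebasis k)))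
       (D k (y + r *: ebasis k)) by rewrite subrr.
    have G := is_derive_compf (is_derive_subf (is_derive_idf r) (is_derive_cstf r r (1 : R))) F'.
    have [d1 d2] := G; rewrite subr0 mulr1 in d2.
    have EE : (fun y0 : R => f ((y0 - r) *: ebasis k + (y + r *: ebasis k))) =
              (fun s : R => f (y + s *: ebasis k)).
      by apply/funext => z; congr f; rewrite addrCA -scalerDl subrK.
    by rewrite EE in d1 d2; split.
  rewrite distrC; apply: Hd; rewrite -ball_normE/= -opprB normrN.
  rewrite addrAC addrK; apply: le_lt_trans (ler_normD _ _) _; rewrite !normrZ.
  apply: le_lt_trans hN; rewrite /N.
  apply: (@le_trans _ _ (`|h| * `|w| + `|h * a| * `|ebasis k : 'rV[R]_n|)).
    by rewrite lerD2l ler_wpM2r.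
  by rewrite normrM -mulrA -mulrDr; apply: ler_wpM2l => //; rewrite lerDl.
rewrite distrC -[X in `|X|](mulKf h0) normrM normfV ler_pdivrMl ?normr_gt0//.
rewrite mulrBr mulVKf// (_ : h * (a * D k x) = D k x * (h * a)); last by ring.
apply: le_trans H _; rewrite normrM mulrCA ler_wpM2l//.
rewrite mulrAC ler_pdivrMr ?ltr_wpDl// ler_pM2l// lerDl//.
Qed.

(** The function is restricted to every line through the maximum. [is_derive_partials] is used
    twice, for [f] and for its partial derivatives, to differentiate along directions that are not
    coordinate directions. *)
Lemma hessian_at_max (f : 'rV[R]_n -> R) (D : 'I_n -> 'rV[R]_n -> R)
    (H : 'I_n -> 'I_n -> 'rV[R]_n -> R) x :
  (forall i y, is_derive y (ebasis i) f (D i y)) ->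
  (forall i, continuous (D i)) ->
  (forall i j y, is_derive y (ebasis i) (D j) (H i j y)) ->
  (forall i j, continuous (H i j)) ->
  (forall y, f y <= f x) ->
  (forall i, D i x = 0) /\ forall v : 'rV_n, quad (\matrix_(i, j) H i j x) v <= 0.
Proof.
move=> fD Dc DH Hc fmax.
pose g1 v s := \sum_i v 0 i * D i (s *: v + x).
have gd v s : is_derive s (1 : R) (fun s : R => f (s *: v + x)) (g1 v s).
  have HD := @is_derive_partials f D (s *: v + x) v fD (fun i => Dc i _).
  exact: is_derive_line HD.
have g1d v : is_derive (0 : R) (1 : R) (g1 v) (quad (\matrix_(i, j) H i j x) v).
  apply: is_derive_eq.
    apply: is_derive_sumf => i; apply: is_derive_scalef.
    exact/is_derive_lineP/(@is_derive_partials (D i) (H^~ i) x v (DH^~ i) (fun j => Hc j i _)).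
  rewrite /quad exchange_big/=; apply: eq_bigr => i _; rewrite mulr_sumr.
  by apply: eq_bigr => j _; rewrite mxE; ring.
have K v := @second_derivative_at_max _ _ _ _ 1 ltr01 (gd v) (g1d v).
have {}K v : g1 v 0 = 0 /\ quad (\matrix_(i, j) H i j x) v <= 0.
  by apply: K => s _; rewrite scale0r add0r.
split=> [i|v]; last by have [] := K v.
have [+ _] := K (ebasis i); rewrite /g1 (bigD1 i)//= scale0r add0r big1 ?addr0.
  by rewrite mxE !eqxx mul1r.
by move=> j ji; rewrite mxE (negbTE ji) andbF mul0r.
Qed.

End gateaux.

Section maximum_principle.
Context {R : realType} {n : nat}.
Implicit Types (L : coeffs R n) (v : 'rV[R]_n -> R -> R) (x y : 'rV[R]_n).

(** Only the derivative from the left in time is recorded: the maximum may be attained at the final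
    time, and the comparison with earlier times is all that is used. *)
Definition subsolution_at L v x (t : R) :=
  exists (v1 : 'I_n -> 'rV[R]_n -> R) (v2 : 'I_n -> 'I_n -> 'rV[R]_n -> R) (vt : R),
  [/\ (forall i y, is_derive y (ebasis i) (v^~ t) (v1 i y)) /\
        (forall i, continuous (v1 i)),
      (forall i j y, is_derive y (ebasis i) (v1 j) (v2 i j y)) /\
        (forall i j, continuous (v2 i j)),
      dt_quot (v x) t s @[s --> t^'-] --> vt &
      0 <= \sum_i \sum_j ca L x t i j * v2 i j x + \sum_k cb L x t 0 k * v1 k x
           + cc L x t * v x t - vt].

Lemma exists_space_time_max v (a b r : R) x0 s0 :
  {within [set p | a <= p.2 <= b], continuous (fun p : 'rV[R]_n * R => v p.1 p.2)} ->
  a <= s0 <= b -> `|x0| <= r ->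
  exists x t, a <= t <= b /\
    forall y s, `|y| <= r -> a <= s <= b -> v y s <= v x t.
Proof.
move=> vc s0ab x0r.
pose B : set ('rV[R]_n * R) := [set x | `|x| <= r] `*` `[a, b].
have cB : compact B.
  apply: compact_setX; last exact: segment_compact.
  apply: bounded_closed_compact.
    exists r; split; first exact: num_real.
    by move=> M rM x /= xr; exact: le_trans xr (ltW rM).
  rewrite (_ : [set x | _] = (fun x => `|x|) @^-1` [set z | z <= r])//.
  by apply: closed_comp; [move=> x _; exact: norm_continuous|exact: closed_le].
have B0 : B !=set0 by exists (x0, s0); split => //=; rewrite in_itv.
have Bs : B `<=` [set p | a <= p.2 <= b] by move=> p [_]; rewrite /= in_itv.
have [p /set_mem[_ pt] pmax] := compact_EVT_max B0 cB (continuous_subspaceW Bs vc).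
exists p.1, p.2; split; first by rewrite /= in_itv in pt.
move=> y s yr sab; apply: (pmax (y, s)); apply/mem_set; split => //=.
Qed.

(* At a positive maximum of [exp(-K t) v] the spatial terms are nonpositive
   and the time derivative of [v] is at least about [K v]. *)
Lemma maximum_principle L v (Lam a b : R) :
  (forall x t, a < t <= b -> [/\ (ca L x t)^T = ca L x t,
     forall w : 'rV_n, w != 0 -> 0 < quad (ca L x t) w & `|cc L x t| <= Lam]) ->
  {within [set p | a <= p.2 <= b], continuous (fun p : 'rV[R]_n * R => v p.1 p.2)} ->
  (forall e : R, 0 < e -> exists r : R, forall x t, a <= t <= b -> r < `|x| -> v x t <= e) ->
  (forall x, v x a <= 0) ->
  (forall x t, a < t <= b -> 0 < v x t -> subsolution_at L v x t) ->
  forall x t, a <= t <= b -> v x t <= 0.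
Proof.
move=> Lreg vc vdecay v0 vsub x0 s0 s0ab; rewrite leNgt; apply/negP => vpos.
have Lam0 : 0 <= Lam.
  have /andP[as0 s0b] := s0ab.
  have as0' : a < s0.
    by rewrite lt_neqAle as0 andbT; apply: contraTneq vpos => <-; rewrite -leNgt.
  have [|_ _] := Lreg x0 s0; first by rewrite as0'.
  exact: le_trans.
(* [Lam + 1] would already make [cc * v - vt] negative at the maximum; the additional unit absorbs
   the error made in linearizing the exponential for [s] close to [t]. *)
pose K := Lam + 2.
pose w x t := expR (- (K * t)) * v x t.
have w0 : 0 < w x0 s0 by rewrite mulr_gt0// expR_gt0.
(* Outside radius [r] the weighted function stays below half of the positive value [w x0 s0], since
   [exp(- K s) <= exp(- K a)]; a maximum over a ball is then global. *)
have [r Hr] := vdecay (w x0 s0 / 2 * expR (K * a)) ltac:(by rewrite mulr_gt0 ?divr_gt0 ?expR_gt0).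
have K0 : 0 < K by rewrite /K; lra.
have wc : {within [set p | a <= p.2 <= b], continuous (fun p : 'rV[R]_n * R => w p.1 p.2)}.
  move=> p; apply: (@continuousM R (subspace [set p : 'rV[R]_n * R | a <= p.2 <= b])
    (fun p => expR (- (K * p.2))) (fun p => v p.1 p.2)); last exact: vc.
  apply: continuous_subspaceT => q.
  apply: continuous_comp; last exact: continuous_expR.
  apply: continuousN; apply: continuousM; first exact: cst_continuous.
  exact: cvg_snd.
have x0r : `|x0| <= Num.max r `|x0| by rewrite le_max lexx orbT.
have [x [t [tab wmaxr]]] := exists_space_time_max wc s0ab x0r.
have wx : w x0 s0 <= w x t by exact: wmaxr.
have wmax y s : a <= s <= b -> w y s <= w x t.
  move=> sab; have [|yr] := leP `|y| (Num.max r `|x0|); first by move=> ?; exact: wmaxr.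
  have {}yr : r < `|y| by apply: le_lt_trans yr; rewrite le_max lexx.
  have /andP[as_ _] := sab.
  apply: le_trans wx; apply: (@le_trans _ _ (w x0 s0 / 2)); last lra.
  apply: le_trans (ler_wpM2l (expR_ge0 _) (Hr _ _ sab yr)) _.
  rewrite mulrCA -expRD ler_piMr//; first by rewrite divr_ge0// ltW.
  by rewrite -expR0 ler_expR -mulrN -mulrDr; apply: mulr_ge0_le0; [exact: ltW|lra].
have vxt : 0 < v x t.
  have : 0 < w x t by exact: lt_le_trans wx.
  by rewrite pmulr_rgt0// expR_gt0.
have /andP[at_ tb] := tab.
have {}at_ : a < t.
  by rewrite lt_neqAle at_ andbT; apply: contraTneq vxt => <-; rewrite -leNgt.
have tab' : a < t <= b by rewrite at_.
have [asym aell cL] := Lreg x t tab'.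
have [v1 [v2 [vt [[D1 C1] [D2 C2] Dt Dpos]]]] := vsub _ _ tab' vxt.
have vmax y : v y t <= v x t.
  by have := wmax y _ tab; rewrite /w ler_pM2l// expR_gt0.
have [g0 Hq] := hessian_at_max D1 C1 D2 C2 vmax.
have S1 : \sum_i \sum_j ca L x t i j * v2 i j x <= 0.
  have := sum_elliptic_le0 asym aell Hq; congr (_ <= _).
  by apply: eq_bigr => i _; apply: eq_bigr => j _; rewrite mxE.
have S2 : \sum_k cb L x t 0 k * v1 k x = 0.
  by rewrite big1// => k _; rewrite g0 mulr0.
have S3 : (Lam + 1) * v x t <= vt.
  apply: (cvgr_to_ge Dt); near=> s.
  have st : s < t by near: s; exact: nbhs_left_lt.
  have as_ : a < s by near: s; exact: nbhs_left_gt.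
  have sab : a <= s <= b by rewrite ltW//= (le_trans (ltW st)).
  have ts0 : 0 < t - s by rewrite subr_gt0.
  have Kts : K * (t - s) * (Lam + 1) <= 1.
    have tsd : t - (K * (Lam + 1))^-1 < s.
      near: s; apply: nbhs_left_gt; rewrite gtrBl invr_gt0 mulr_gt0//; lra.
    rewrite mulrAC -ler_pdivlMl ?mulr1; last by rewrite mulr_gt0//; lra.
    lra.
  have E : v x s <= expR (- (K * (t - s))) * v x t.
    have := wmax x s sab; rewrite /w -(ler_pM2l (expR_gt0 (K * s))) !mulrA -!expRD.
    by rewrite subrr expR0 mul1r [K * s - _](_ : _ = - (K * (t - s)))//; ring.
  have F : expR (- (K * (t - s))) * (1 + K * (t - s)) <= 1.
    apply: (@le_trans _ _ (expR (- (K * (t - s))) * expR (K * (t - s)))).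
      by rewrite ler_pM2l ?expR_gt0// expR_ge1Dx.
    by rewrite -expRD addNr expR0.
  rewrite /dt_quot [_^-1 * _]mulrC ler_ndivlMr ?subr_lt0//.
  set y := K * (t - s) in Kts E F; have y0 : 0 < y by rewrite mulr_gt0.
  have {}F : expR (- y) <= (1 + y)^-1.
    by rewrite -[leRHS]mul1r ler_pdivlMr//; lra.
  have G : (1 + y)^-1 <= 1 - (Lam + 1) * (t - s).
    rewrite -[leLHS]mul1r ler_pdivrMr; last lra.
    have -> : (1 - (Lam + 1) * (t - s)) * (1 + y) =
        1 + (t - s) * (K - (Lam + 1) - y * (Lam + 1)) by rewrite /y; ring.
    by rewrite lerDl mulr_ge0 ?(ltW ts0)// /K; lra.
  have : v x s <= (1 - (Lam + 1) * (t - s)) * v x t.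
    by apply: le_trans E _; rewrite ler_pM2r//; exact: le_trans G.
  by lra.
have cv : cc L x t * v x t <= Lam * v x t.
  by rewrite ler_pM2r// (le_trans (ler_norm _)).
by move: Dpos; rewrite S2 addr0; lra.
Unshelve. all: by end_near. Qed.

End maximum_principle.

(** * Gaussian barriers *)

Section gaussian_barriers.
Context {R : realType} {n : nat}.
Variables (lam Lam t0 t1 T : R) (L : coeffs R n).
Hypotheses (lam0 : 0 < lam) (Lam0 : 0 < Lam) (t01 : t1 - t0 = T).
Hypothesis Lreg : regular lam Lam t0 t1 L.
Implicit Types (x xi z : 'rV[R]_n) (t tau m al : R).

Lemma symbol_scalar m al tau xi x t : let z := x - xi in let th := t - tau in
  symbol m tau al%:M xi L x t =
  4 * al ^+ 2 * quad (ca L x t) z / th ^+ 2 - 2 * al * \tr (ca L x t) / th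
  - \sum_k (2 * al / th) * (cb L x t 0 k * z 0 k) + cc L x t + m / th
  - al * (sqnorm z / th) / th.
Proof.
move=> z th.
have mvs i : mv al%:M z i = al * z 0 i.
  by rewrite mvE tr_scalar_mx mul_mx_scalar mxE.
rewrite /symbol -/z -/th quad_scalar (_ : al * sqnorm z / th ^+ 2 = al * (sqnorm z / th) / th); last first.
  by rewrite expr2 invfM; ring.
congr (_ - _ + _ + _ - _); last first.
  by apply: eq_bigr => k _; rewrite mvs; ring.
rewrite /quad /mxtrace mulr_sumr mulr_suml [2 * al * _]mulr_sumr mulr_suml -sumrB.
apply: eq_bigr => i _.
have -> : 2 * al * ca L x t i i / th = \sum_j ca L x t i j * (2 * (al *+ (i == j)) / th).
  rewrite (bigD1 i)//= eqxx mulr1n big1 ?addr0; first ring.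
  by move=> j ji; rewrite eq_sym (negbTE ji) mulr0n mulr0 mul0r mulr0.
rewrite mulr_sumr mulr_suml -sumrB; apply: eq_bigr => j _.
rewrite !mvs (_ : al%:M i j = al *+ (i == j)); first ring.
by rewrite mxE.
Qed.

Lemma trace_le x t : t0 < t < t1 -> `|\tr (ca L x t)| <= n%:R * Lam.
Proof.
move=> tt; have [_ _ ab _ _] := Lreg x tt.
apply: le_trans (ler_norm_sum _ _ _) _.
by rewrite mulr_natl -[X in _ *+ X]card_ord -sumr_const; apply: ler_sum => i _.
Qed.

(* Young's inequality, with weights [p] and [1 / p]. *)
Lemma drift_le (b z : 'rV[R]_n) (g p : R) : 0 < p -> (forall k, `|b 0 k| <= Lam) ->
  `|\sum_k g * (b 0 k * z 0 k)| <= p * g ^+ 2 * sqnorm z / 4 + n%:R * Lam ^+ 2 / p.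
Proof.
move=> p0 bb; have -> : p * g ^+ 2 * sqnorm z / 4 + n%:R * Lam ^+ 2 / p =
   \sum_k (p * g ^+ 2 * z 0 k ^+ 2 / 4 + Lam ^+ 2 / p).
  rewrite big_split/= sumr_const card_ord /sqnorm mulr_sumr mulr_suml.
  by rewrite -[X in _ = _ + X]mulr_natl mulrA.
apply: le_trans (ler_norm_sum _ _ _) _; apply: ler_sum => k _.
rewrite mulrCA normrM.
apply: (@le_trans _ _ (Lam * `|g * z 0 k|)); first by rewrite ler_wpM2r.
have E : (g * z 0 k) ^+ 2 = `|g * z 0 k| ^+ 2 by rewrite real_normK ?num_real.
rewrite -[X in X / 4]mulrA -exprMn E; set y := `|_|.
rewrite -subr_ge0.
have -> : p * y ^+ 2 / 4 + Lam ^+ 2 / p - Lam * y = p^-1 * (p * y / 2 - Lam) ^+ 2.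
  by field; rewrite gt_eqF.
by rewrite mulr_ge0 ?sqr_ge0// invr_ge0 ltW.
Qed.

Let D : R := n%:R * Lam ^+ 2 / lam + Lam.

(** With [S = al^2 lam q / th], the leading term is at least [4 S], the drift takes [S] by
    [drift_le] with weight [lam], and the time derivative takes [al q / th <= S] because
    [lam * al >= 1]. What remains is [2 S >= 2 al q / th]. *)
Lemma symbol_scalar_ge m al tau xi x t : t0 < t < t1 -> tau < t -> lam^-1 <= al ->
  (2 * al * (sqnorm (x - xi) / (t - tau)) - 2 * al * (n%:R * Lam) + m) / (t - tau) - D <=
  symbol m tau al%:M xi L x t.
Proof.
move=> tt taut al0; have th0 : 0 < t - tau by rewrite subr_gt0.
have [asym aell ab [bb cbd] _] := Lreg x tt.
rewrite symbol_scalar; set z := x - xi; set th := t - tau in th0 *; set q := sqnorm z / th.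
have al1 : 0 < al by apply: lt_le_trans al0; rewrite invr_gt0.
have lal : 1 <= lam * al by rewrite mulrC -ler_pdivrMr// div1r.
have i0 : 0 <= th^-1 by rewrite invr_ge0 ltW.
have q0 : 0 <= q by rewrite divr_ge0 ?sqnorm_ge0// ltW.
have H1 : 4 * al ^+ 2 * (lam * q / th) <= 4 * al ^+ 2 * quad (ca L x t) z / th ^+ 2.
  have -> : 4 * al ^+ 2 * quad (ca L x t) z / th ^+ 2 =
    4 * al ^+ 2 * (quad (ca L x t) z / th / th) by field; rewrite gt_eqF.
  apply: ler_wpM2l; first by rewrite mulr_ge0 ?sqr_ge0.
  by rewrite /q mulrA; apply: ler_wpM2r => //; apply: ler_wpM2r => //; exact: aell.
have H2 : 2 * al * \tr (ca L x t) / th <= 2 * al * (n%:R * Lam) / th.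
  apply: ler_wpM2r => //; apply: ler_wpM2l; first by rewrite mulr_ge0// ltW.
  exact: le_trans (ler_norm _) (trace_le x tt).
have := @drift_le (cb L x t) z (2 * al / th) lam lam0 bb.
rewrite (_ : lam * (2 * al / th) ^+ 2 * sqnorm z / 4 = al ^+ 2 * (lam * q / th)); last first.
  by rewrite /q; field; rewrite gt_eqF.
rewrite ler_norml => /andP[_ H3].
move: cbd; rewrite ler_norml => /andP[H4 _].
have H5 : al * q / th <= al ^+ 2 * (lam * q / th).
  have -> : al ^+ 2 * (lam * q / th) = lam * al * (al * q / th) by ring.
  by apply: ler_peMl => //; apply: mulr_ge0 => //; apply: mulr_ge0 => //; exact: ltW.
rewrite (_ : _ / th - D = 2 * (al * q / th) - 2 * al * (n%:R * Lam) / th + m / th - D); last by ring.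
rewrite /D; have E1 : 4 * al ^+ 2 * (lam * q / th) = 4 * (al ^+ 2 * (lam * q / th)) by ring.
rewrite E1 in H1; move: H1 H2 H3 H4 H5.
move: (\sum_k _) (al ^+ 2 * (lam * q / th)) => s1 s2.
move: (4 * _ * quad _ _ / _) (2 * al * \tr _ / th) (al * q / th) => s3 s4 s5.
move: (2 * al * (n%:R * Lam) / th) (n%:R * Lam ^+ 2 / lam) (m / th) (cc L x t) => s9 s6 s7 s8.
lra.
Qed.

Let D2 al : R := 4 * al * (n%:R * Lam ^+ 2) + Lam.

(** For small [al] the term [- al q / th] of the time derivative dominates: the leading term takes
    half of it, the drift, with weight [(4 * al)^-1], one quarter, and the last quarter is left. *)
Lemma symbol_scalar_le m al tau xi x t : t0 < t < t1 -> tau < t -> 0 < al ->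
  8 * al * (n%:R * Lam) <= 1 ->
  symbol m tau al%:M xi L x t <=
  (- (al / 4 * (sqnorm (x - xi) / (t - tau))) + 2 * al * (n%:R * Lam) + m) / (t - tau) + D2 al.
Proof.
move=> tt taut al0 al8; have th0 : 0 < t - tau by rewrite subr_gt0.
have [asym aell ab [bb cbd] _] := Lreg x tt.
rewrite symbol_scalar; set z := x - xi; set th := t - tau in th0 *; set q := sqnorm z / th.
have i0 : 0 <= th^-1 by rewrite invr_ge0 ltW.
have q0 : 0 <= q by rewrite divr_ge0 ?sqnorm_ge0// ltW.
have H1 : 4 * al ^+ 2 * quad (ca L x t) z / th ^+ 2 <= al / 2 * q / th.
  apply: (@le_trans _ _ (4 * al ^+ 2 * (n%:R * Lam * sqnorm z) / th ^+ 2)).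
    apply: ler_wpM2r; first by rewrite invr_ge0 sqr_ge0.
    apply: ler_wpM2l; first by rewrite mulr_ge0 ?sqr_ge0.
    exact: le_trans (ler_norm _) (quad_le _ ab).
  have -> : 4 * al ^+ 2 * (n%:R * Lam * sqnorm z) / th ^+ 2 =
     (8 * al * (n%:R * Lam)) * (al / 2 * q / th) by rewrite /q; field; rewrite gt_eqF.
  apply: ler_piMl => //.
  exact: mulr_ge0 (mulr_ge0 (divr_ge0 (ltW al0) (ler0n _ 2)) q0) i0.
have H2 : - (2 * al * (n%:R * Lam) / th) <= 2 * al * \tr (ca L x t) / th.
  rewrite -mulNr; apply: ler_wpM2r => //; rewrite -mulrN; apply: ler_wpM2l.
    by rewrite mulr_ge0// ltW.
  by have := trace_le x tt; rewrite ler_norml => /andP[].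
have i4 : 0 < (4 * al)^-1 by rewrite invr_gt0 mulr_gt0.
have := @drift_le (cb L x t) z (2 * al / th) (4 * al)^-1 i4 bb.
rewrite (_ : (4 * al)^-1 * (2 * al / th) ^+ 2 * sqnorm z / 4 = al / 4 * q / th); last first.
  by rewrite /q; field; rewrite !gt_eqF.
rewrite ler_norml => /andP[H3 _].
move: cbd; rewrite ler_norml => /andP[_ H4].
rewrite invrK in H3.
have E1 : al * q / th = 2 * (al / 2 * q / th) by field; rewrite gt_eqF.
have E2 : al / 4 * q / th = al / 2 * q / th / 2 by field; rewrite gt_eqF.
rewrite (_ : (_ + m) / th = - (al / 4 * q / th) + 2 * al * (n%:R * Lam) / th + m / th); last by ring.
rewrite E1 E2 /D2; rewrite E2 in H3; move: H1 H2 H3 H4.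
rewrite [4 * al * _]mulrC.
move: (\sum_k _) (al / 2 * q / th) => s1 s2.
move: (4 * _ * quad _ _ / _) (2 * al * \tr _ / th) (2 * al * (n%:R * Lam) / th) => s3 s4 s5.
move: (n%:R * Lam ^+ 2 * _) (m / th) (cc L x t) => s6 s7 s8.
lra.
Qed.

End gaussian_barriers.

Section continuity_rules.
Context {R : realType} {T : topologicalType}.
Implicit Types (f g : T -> R) (x : T).

Lemma continuous_mulf f g x : {for x, continuous f} -> {for x, continuous g} ->
  {for x, continuous (fun y => f y * g y)}.
Proof. exact: continuousM. Qed.

Lemma continuous_subf f g x : {for x, continuous f} -> {for x, continuous g} ->
  {for x, continuous (fun y => f y - g y)}.
Proof. exact: continuousB. Qed.

Lemma continuous_oppf f x : {for x, continuous f} -> {for x, continuous (fun y => - f y)}.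
Proof. exact: continuousN. Qed.

Lemma continuous_cstf (c : R) x : {for x, continuous (fun=> c)}.
Proof. exact: cst_continuous. Qed.

Lemma continuous_compf f (h : R -> R) x : {for x, continuous f} ->
  {for f x, continuous h} -> {for x, continuous (fun y => h (f y))}.
Proof. exact: continuous_comp. Qed.

Lemma continuous_sumf (I : finType) (h : I -> T -> R) x :
  (forall i, {for x, continuous (h i)}) -> {for x, continuous (fun y => \sum_i h i y)}.
Proof.
move=> hc; elim: (index_enum I) => [|i s IH].
  rewrite (_ : (fun _ => _) = fun=> 0); first exact: continuous_cstf.
  by apply/funext => y; rewrite big_nil.
rewrite (_ : (fun _ => _) = fun y => h i y + \sum_(j <- s) h j y).
  exact: (@continuousD _ _ _ (h i) (fun y => \sum_(j <- s) h j y)).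
by apply/funext => y; rewrite big_cons.
Qed.

End continuity_rules.

Section gker_continuity.
Context {R : realType} {n : nat}.
Implicit Types (M : 'M[R]_n) (x y z xi : 'rV[R]_n) (m t tau : R) (p : 'rV[R]_n * R).

Lemma continuous_coordB xi p i :
  {for p, continuous (fun p : 'rV[R]_n * R => (p.1 - xi) 0 i)}.
Proof.
rewrite (_ : (fun _ => _) = fun p : 'rV[R]_n * R => p.1 0 i - xi 0 i); last first.
  by apply/funext => q; rewrite !mxE.
apply: continuous_subf; last exact: continuous_cstf.
apply: (@continuous_comp _ _ _ (@fst 'rV[R]_n R) (fun y : 'rV[R]_n => y 0 i)).
  exact: cvg_fst.
exact: coord_continuous.
Qed.

Lemma continuous_mvB M xi p i :
  {for p, continuous (fun p : 'rV[R]_n * R => mv M (p.1 - xi) i)}.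
Proof.
apply: continuous_sumf => k; apply: continuous_mulf; first exact: continuous_cstf.
exact: continuous_coordB.
Qed.

Lemma continuous_gker m M xi tau p : tau < p.2 ->
  {for p, continuous (fun p : 'rV[R]_n * R => gker m M (p.1 - xi) (p.2 - tau))}.
Proof.
move=> tp; have th0 : 0 < p.2 - tau by rewrite subr_gt0.
have cth : {for p, continuous (fun p : 'rV[R]_n * R => p.2 - tau)}.
  by apply: continuous_subf; [exact: cvg_snd|exact: continuous_cstf].
apply: (@continuous_compf _ _ (fun p : 'rV[R]_n * R =>
  - (m * ln (p.2 - tau)) - quad M (p.1 - xi) / (p.2 - tau)) expR); last exact: continuous_expR.
apply: continuous_subf.
  apply: continuous_oppf; apply: continuous_mulf; first exact: continuous_cstf.
  by apply: (continuous_compf cth); exact: continuous_ln.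
apply: continuous_mulf; last by apply: continuousV => //; exact: lt0r_neq0.
rewrite (_ : (fun _ => _) = fun p : 'rV[R]_n * R =>
    \sum_i (p.1 - xi) 0 i * mv M (p.1 - xi) i); last first.
  by apply/funext => q; rewrite quad_mv.
apply: continuous_sumf => i; apply: continuous_mulf; first exact: continuous_coordB.
exact: continuous_mvB.
Qed.

Lemma continuous_slice (F : 'rV[R]_n * R -> R) x t :
  {for (x, t), continuous F} -> {for x, continuous (fun y => F (y, t))}.
Proof.
move=> Fc; apply: (@continuous_comp _ _ _ (fun y : 'rV[R]_n => (y, t)) F) => //.
by apply: (@cvg_pair _ _ _ (nbhs x) (nbhs x) (nbhs t)); [exact: cvg_id|exact: cvg_cst].
Qed.

(** At the final time the solution is only continuous from within the domain, but a slice at fixed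
    time stays inside it. *)
Lemma within_continuous_slice (D : set ('rV[R]_n * R)) (F : 'rV[R]_n * R -> R) t :
  (forall y, D (y, t)) -> {within D, continuous F} -> continuous (fun y => F (y, t)).
Proof.
move=> Dt Fc x; have cF : F p @[p --> within D (nbhs (x, t))] --> F (x, t).
  by rewrite nbhs_subspace_in; [exact: (Fc (x, t))|exact: Dt].
have H : (fun y => (y, t)) @ x --> within D (nbhs (x, t)).
  move=> P HP; have c : (fun y : 'rV[R]_n => (y, t)) @ x --> (x, t).
    by apply: (@cvg_pair _ _ _ (nbhs x) (nbhs x) (nbhs t)); [exact: cvg_id|exact: cvg_cst].
  by move: (c _ HP); apply: (@filterS _ (nbhs x)) => y /=; apply; exact: Dt.
exact: (cvg_comp _ _ H cF).
Qed.

End gker_continuity.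

(** * Comparison of solutions with Gaussian barriers *)

Section comparison.
Context {R : realType} {n : nat}.
Implicit Types (x y z xi : 'rV[R]_n) (m al t tau : R).

Lemma dt_quot_left (tau t1 : R) (u : R -> R) (t l : R) : tau < t <= t1 ->
  dt_quot u t s @[s --> within `]tau, t1] t^'] --> l -> dt_quot u t s @[s --> t^'-] --> l.
Proof.
move=> /andP[taut tt1]; apply: cvg_trans; apply: cvg_app => P; rewrite /within/= => HP.
case: HP => e /= e0 He; near=> s.
have st : s < t by near: s; exact: nbhs_left_lt.
have ts : tau < s by near: s; exact: nbhs_left_gt.
apply: He; last by rewrite in_itv/= ts (le_trans (ltW st)).
- rewrite /ball_/= gtr0_norm ?subr_gt0// ltrBlDl -ltrBlDr.
  by near: s; apply: nbhs_left_gt; rewrite gtrBl.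
- by rewrite lt_eqF.
Unshelve. all: by end_near. Qed.

End comparison.

Section comparison.
Context {R : realType} {n : nat}.
Implicit Types (x y z xi : 'rV[R]_n) (m al t tau : R).

Lemma norm_le_sqnorm z : `|z| ^+ 2 <= sqnorm z.
Proof.
rewrite -(sqr_sqrtr (sqnorm_ge0 z)) ler_pXn2r// ?nnegrE ?sqrtr_ge0//.
rewrite [X in X <= _]mx_normrE; apply: bigmax_le; first exact: sqrtr_ge0.
by move=> [i j] _ /=; rewrite (ord1 i) ler_absn.
Qed.

Lemma gker_decay m al xi tau (h t : R) : 0 < h -> 0 < al -> 0 <= m -> tau + h <= t ->
  forall e : R, 0 < e -> exists r : R, forall x s, tau + h <= s <= t -> r < `|x| ->
    gker m al%:M (x - xi) (s - tau) <= e.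
Proof.
move=> h0 al0 m0 ht e e0; pose C := expR (- (m * ln h)).
have C0 : 0 < C by exact: expR_gt0.
have T0 : 0 < t - tau by lra.
(* Makes [al |x - xi|^2 / (s - tau)] at least [C / e], where [C = h^(-m)] bounds the power of time;
   then [exp y >= 1 + y] suffices. The summand 1 gives [rho ^+ 2 >= rho - 1] without a square
   root. *)
pose rho := 1 + C * (t - tau) / (al * e).
have d0 : 0 < C * (t - tau) / (al * e) by rewrite divr_gt0// mulr_gt0.
exists (`|xi| + rho) => x s /andP[hs st] rx.
have th0 : 0 < s - tau by lra.
have zr : rho <= `|x - xi|.
  by have := lerB_dist x xi; lra.
have sq : C * (t - tau) / (al * e) <= sqnorm (x - xi).
  apply: le_trans (norm_le_sqnorm _); apply: (@le_trans _ _ (rho ^+ 2)).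
    by rewrite /rho; move: d0; set d := _ / _ => d0; nra.
  by rewrite ler_pXn2r// ?nnegrE//; rewrite /rho; lra.
rewrite /gker quad_scalar expRD; apply: (@le_trans _ _ (C * (e / C))); last first.
  by rewrite mulrC divfK// gt_eqF.
apply: ler_pM; rewrite ?expR_ge0//.
  by rewrite ler_expR lerN2 ler_wpM2l// ler_ln ?posrE//; lra.
rewrite expRN -[e / C]invrK lef_pV2 ?posrE ?expR_gt0 ?invr_gt0 ?divr_gt0//.
apply: le_trans (expR_ge1Dx _); rewrite invf_div.
apply: (@le_trans _ _ (al * sqnorm (x - xi) / (s - tau))); last lra.
rewrite ler_pdivlMr//; apply: (@le_trans _ _ (al * (C * (t - tau) / (al * e)))).
  have -> : al * (C * (t - tau) / (al * e)) = C / e * (t - tau).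
    by field; rewrite !gt_eqF.
  by rewrite ler_pM2l ?divr_gt0//; lra.
by rewrite ler_pM2l.
Qed.

(** By linearity and [Lop_gker], the operator applied to the barrier minus [E] is the given
    combination of symbols. Two kernels are allowed because the short-time barrier is a difference;
    the barrier for later times takes [k2 = 0]. *)
Lemma C21_subsolution (L : coeffs R n) (E : 'rV[R]_n -> R -> R) (tau t1 : R)
    (k1 m1 al1 k2 m2 al2 : R) xi x t : C21 tau t1 E ->
    Lop L tau t1 E x t = 0 -> tau < t <= t1 ->
    0 <= k1 * gker m1 al1%:M (x - xi) (t - tau) * symbol m1 tau al1%:M xi L x t
      - k2 * gker m2 al2%:M (x - xi) (t - tau) * symbol m2 tau al2%:M xi L x t ->
  subsolution_at L (fun y s => k1 * gker m1 al1%:M (y - xi) (s - tau)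
      - k2 * gker m2 al2%:M (y - xi) (s - tau) - E y s) x t.
Proof.
move=> [Ed Ec Ec1 Ec2 _] LE tt sym; have /andP[taut tt1] := tt.
pose u k m al y s := k * gker m al%:M (y - xi) (s - tau) : R.
pose u1 k m al i y := k * (gker m al%:M (y - xi) (t - tau) *
   (- (2 * mv al%:M (y - xi) i / (t - tau)))) : R.
pose u2 k m al i j y := k * (gker m al%:M (y - xi) (t - tau) *
   (4 * mv al%:M (y - xi) i * mv al%:M (y - xi) j / (t - tau) ^+ 2
    - 2 * (al%:M : 'M[R]_n) i j / (t - tau))) : R.
pose ut k m al := k * (gker m al%:M (x - xi) (t - tau) *
   (- (m / (t - tau)) + quad al%:M (x - xi) / (t - tau) ^+ 2)) : R.
have Ms al : (al%:M : 'M[R]_n)^T = al%:M by exact: tr_scalar_mx.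
have D1 k m al i y : is_derive y (ebasis i) ((u k m al)^~ t) (u1 k m al i y).
  exact: (is_derive_scalef k (is_derive_gker m tau xi (Ms al) y t i)).
have D2 k m al i j y : is_derive y (ebasis i) (u1 k m al j) (u2 k m al i j y).
  exact: (is_derive_scalef k (is_derive2_gker m tau xi (Ms al) y t i j)).
have Dt k m al : is_derive t (1 : R) (u k m al x) (ut k m al).
  exact: (is_derive_scalef k (@is_derive_t_gker R n m tau al%:M xi x t taut)).
have LL k m al : \sum_i \sum_j ca L x t i j * u2 k m al i j x
   + \sum_i cb L x t 0 i * u1 k m al i x + cc L x t * u k m al x t - ut k m al =
   k * gker m al%:M (x - xi) (t - tau) * symbol m tau al%:M xi L x t.
  rewrite -(Lop_derive L tt (D1 k m al) (fun i j => D2 k m al i j x) (Dt k m al)).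
  exact: Lop_gker.
have cu k m al y : {for y, continuous (fun y => k * gker m al%:M (y - xi) (t - tau))}.
   apply: continuous_mulf; first exact: continuous_cstf.
  exact: (@continuous_slice R n (fun p => gker m al%:M (p.1 - xi) (p.2 - tau)) y t
     (@continuous_gker R n m al%:M xi tau (y, t) taut)).
have cmv al i y : {for y, continuous (fun y => mv al%:M (y - xi) i)}.
   exact: (@continuous_slice R n (fun p => mv al%:M (p.1 - xi) i) y t
     (@continuous_mvB R n al%:M xi (y, t) i)).
have c1 k m al i y : {for y, continuous (u1 k m al i)}.
  rewrite (_ : u1 k m al i = fun y => k * gker m al%:M (y - xi) (t - tau) *
      (- (2 * mv al%:M (y - xi) i / (t - tau)))).
    apply: continuous_mulf; first exact: cu.
    apply: continuous_oppf; apply: continuous_mulf; last exact: continuous_cstf.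
    by apply: continuous_mulf; [exact: continuous_cstf|exact: cmv].
  by apply/funext => q; rewrite /u1 mulrA.
have c2 k m al i j y : {for y, continuous (u2 k m al i j)}.
  rewrite (_ : u2 k m al i j = fun y => k * gker m al%:M (y - xi) (t - tau) *
      (4 * mv al%:M (y - xi) i * mv al%:M (y - xi) j / (t - tau) ^+ 2
       - 2 * (al%:M : 'M[R]_n) i j / (t - tau))).
    apply: continuous_mulf; first exact: cu.
    apply: continuous_subf; last exact: continuous_cstf.
    apply: continuous_mulf; last exact: continuous_cstf.
    apply: continuous_mulf; last exact: cmv.
    by apply: continuous_mulf; [exact: continuous_cstf|exact: cmv].
  by apply/funext => q; rewrite /u2 mulrA.
have Dslice (y : 'rV[R]_n) : [set p : 'rV[R]_n * R | tau < p.2 <= t1] (y, t) by [].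
exists (fun i y => u1 k1 m1 al1 i y - u1 k2 m2 al2 i y - d1 E i y t).
exists (fun i j y => u2 k1 m1 al1 i j y - u2 k2 m2 al2 i j y - d2 E i j y t).
exists (ut k1 m1 al1 - ut k2 m2 al2 - t_derive tau t1 (E x) t); split.
- split=> [i y|i y].
    have dE : is_derive y (ebasis i) (E^~ t) (d1 E i y t).
      by have [/(_ i) d _ _] := Ed y t tt; split.
    exact: (is_derive_subf (is_derive_subf (D1 k1 m1 al1 i y) (D1 k2 m2 al2 i y)) dE).
  apply: (@continuous_subf _ _ (fun y => u1 k1 m1 al1 i y - u1 k2 m2 al2 i y)
    (fun y => d1 E i y t) y); last exact: within_continuous_slice Dslice (Ec1 i) y.
  by apply: continuous_subf; exact: c1.
- split=> [i j y|i j y].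
    have dE : is_derive y (ebasis i) ((d1 E j)^~ t) (d2 E i j y t).
      by have [_ /(_ i j) d _] := Ed y t tt; split.
    exact: (is_derive_subf (is_derive_subf (D2 k1 m1 al1 i j y) (D2 k2 m2 al2 i j y)) dE).
  apply: (@continuous_subf _ _ (fun y => u2 k1 m1 al1 i j y - u2 k2 m2 al2 i j y)
    (fun y => d2 E i j y t) y); last exact: within_continuous_slice Dslice (Ec2 i j) y.
  by apply: continuous_subf; exact: c2.
- have cE : dt_quot (E x) t s @[s --> t^'-] --> t_derive tau t1 (E x) t.
    by apply: (dt_quot_left tt); have [_ _ d] := Ed x t tt.
  have cu' k m al : dt_quot (u k m al x) t s @[s --> t^'-] --> ut k m al.
    apply: (dt_quot_left tt); apply: cvg_trans (is_derive_dt_quot (Dt k m al)).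
    by apply: cvg_app; exact: cvg_within.
  have EQ : dt_quot (fun s => u k1 m1 al1 x s - u k2 m2 al2 x s - E x s) t =
      dt_quot (u k1 m1 al1 x) t - dt_quot (u k2 m2 al2 x) t - dt_quot (E x) t.
    by apply/funext => s; rewrite /dt_quot !fctE; ring.
  have H := cvgB (cvgB (cu' k1 m1 al1) (cu' k2 m2 al2)) cE.
  suff : dt_quot (fun s => u k1 m1 al1 x s - u k2 m2 al2 x s - E x s) t @ t^'- -->
    (ut k1 m1 al1 - ut k2 m2 al2 - t_derive tau t1 (E x) t : R) by [].
  by rewrite EQ; exact: H.
- rewrite /Lop in LE.
  have -> : \sum_i \sum_j ca L x t i j *
      (u2 k1 m1 al1 i j x - u2 k2 m2 al2 i j x - d2 E i j x t) =
    \sum_i \sum_j ca L x t i j * u2 k1 m1 al1 i j x -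
    \sum_i \sum_j ca L x t i j * u2 k2 m2 al2 i j x -
    \sum_i \sum_j ca L x t i j * d2 E i j x t.
    rewrite -!sumrB; apply: eq_bigr => i _; rewrite -!sumrB; apply: eq_bigr => j _.
    by rewrite !mulrBr.
  have -> : \sum_k cb L x t 0 k * (u1 k1 m1 al1 k x - u1 k2 m2 al2 k x - d1 E k x t) =
    \sum_k cb L x t 0 k * u1 k1 m1 al1 k x - \sum_k cb L x t 0 k * u1 k2 m2 al2 k x
    - \sum_k cb L x t 0 k * d1 E k x t.
    by rewrite -!sumrB; apply: eq_bigr => k _; rewrite !mulrBr.
  move: sym LE; rewrite -!LL /u; lra.
Qed.

End comparison.

(** * Lower bounds by comparison *)

Section two_sided_bounds.
Context {R : realType} {n : nat}.
Implicit Types (x y z xi : 'rV[R]_n) (m al t tau h : R).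

(** Starting at [tau + h] keeps away from the pole, where the barrier is singular. The differential
    inequality is only required where [E] lies below the barrier, so regions in which [E] is already
    known to be large can be ignored. *)
Lemma gaussian_comparison (lam Lam t0 t1 : R) (L : coeffs R n)
    (E : 'rV[R]_n -> R -> R) xi tau h t (k1 m1 a1 k2 m2 a2 A c : R) :
  0 < lam -> regular lam Lam t0 t1 L -> t0 < tau -> 0 < h -> tau + h <= t -> t < t1 ->
  C21 tau t1 E -> (forall x s, tau < s <= t1 -> Lop L tau t1 E x s = 0) ->
  0 < k1 -> 0 <= k2 -> 0 <= m1 -> 0 < a1 -> 0 < A -> 0 < c ->
  (forall x s, tau < s -> s < t1 -> `|E x s| <= A * hker c (x - xi) (s - tau)) ->
  (forall x, k1 * gker m1 a1%:M (x - xi) h - k2 * gker m2 a2%:M (x - xi) h <= E x (tau + h)) ->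
  (forall x s, tau + h < s -> s <= t ->
     E x s < k1 * gker m1 a1%:M (x - xi) (s - tau) - k2 * gker m2 a2%:M (x - xi) (s - tau) ->
     0 <= k1 * gker m1 a1%:M (x - xi) (s - tau) * symbol m1 tau a1%:M xi L x s
        - k2 * gker m2 a2%:M (x - xi) (s - tau) * symbol m2 tau a2%:M xi L x s) ->
  forall x s, tau + h <= s <= t ->
    k1 * gker m1 a1%:M (x - xi) (s - tau) - k2 * gker m2 a2%:M (x - xi) (s - tau) <= E x s.
Proof.
move=> lam0 Lreg t0tau h0 ht tt1 EC EL k10 k20 m10 a10 A0 c0 EA init pde.
suff H : forall x s, tau + h <= s <= t ->
    k1 * gker m1 a1%:M (x - xi) (s - tau) - k2 * gker m2 a2%:M (x - xi) (s - tau) - E x s <= 0.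
  by move=> x s hs; have := H x s hs; rewrite subr_le0.
apply: (@maximum_principle R n L (fun x s => k1 * gker m1 a1%:M (x - xi) (s - tau) -
  k2 * gker m2 a2%:M (x - xi) (s - tau) - E x s) Lam (tau + h) t).
- move=> x s /andP[hs st]; have s01 : t0 < s < t1 by apply/andP; split; lra.
  have [asym aell _ [_ cb] _] := Lreg x s s01; split => //.
  by move=> w; exact: (elliptic_quad_gt0 lam0 aell).
- have cg k m a : {within [set p : 'rV[R]_n * R | tau + h <= p.2 <= t],
      continuous (fun p : 'rV[R]_n * R => k * gker m a%:M (p.1 - xi) (p.2 - tau))}.
    apply: continuous_in_subspaceT => p /set_mem /= /andP[hp _].
    apply: (@continuous_mulf R ('rV[R]_n * R)%type (fun=> k)
      (fun p => gker m a%:M (p.1 - xi) (p.2 - tau)) p).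
      exact: continuous_cstf.
    by apply: continuous_gker; lra.
  have cE : {within [set p : 'rV[R]_n * R | tau + h <= p.2 <= t],
      continuous (fun p : 'rV[R]_n * R => E p.1 p.2)}.
    have [_ cE _ _ _] := EC; apply: continuous_subspaceW cE => p /= /andP[hp pt].
    by apply/andP; split; lra.
  move=> p; apply: (@continuous_subf R (subspace [set p : 'rV[R]_n * R | tau + h <= p.2 <= t])
    (fun p => k1 * gker m1 a1%:M (p.1 - xi) (p.2 - tau) - k2 * gker m2 a2%:M (p.1 - xi) (p.2 - tau))
    (fun p => E p.1 p.2)); last exact: cE.
  apply: (@continuous_subf R (subspace [set p : 'rV[R]_n * R | tau + h <= p.2 <= t])
    (fun p => k1 * gker m1 a1%:M (p.1 - xi) (p.2 - tau))
    (fun p => k2 * gker m2 a2%:M (p.1 - xi) (p.2 - tau))); exact: cg.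
- move=> e e0.
  have e1 : 0 < e / 2 / k1 by rewrite !divr_gt0.
  have e2 : 0 < e / 2 / A by rewrite !divr_gt0.
  have n0 : 0 <= n%:R / 2 :> R by rewrite divr_ge0.
  have [r1 Hr1] := gker_decay xi h0 a10 m10 ht e1.
  have [r2 Hr2] := gker_decay xi h0 c0 n0 ht e2.
  exists (Num.max r1 r2) => x s hst; rewrite gt_max => /andP[rx1 rx2].
  have /andP[hs st] := hst.
  have := Hr1 x s hst rx1; rewrite ler_pdivlMr// => H1.
  have := Hr2 x s hst rx2; rewrite ler_pdivlMr// => H2.
  have H3 : 0 <= k2 * gker m2 a2%:M (x - xi) (s - tau) by rewrite mulr_ge0// ltW// gker_gt0.
  have := EA x s; rewrite ler_norml => /(_ ltac:(lra) ltac:(lra)) /andP[H4 _].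
  by rewrite /hker in H4; lra.
- move=> x; rewrite subr_le0 (_ : tau + h - tau = h); first exact: init.
  by rewrite addrC addKr.
- move=> x s /andP[hs st] pos; apply: (@C21_subsolution R n L E tau t1) => //.
  + by apply: EL; apply/andP; split; lra.
  + by apply/andP; split; lra.
  + by apply: pde => //; move: pos; rewrite subr_gt0.
Qed.

(* Where [|x - xi|^2 <= kap (t - tau)] the parametrix estimate suffices; elsewhere
   a Gaussian minus a multiple of the error kernel is a subsolution. The
   comparison starts at time [tau + h], and then [h] tends to 0. *)
Lemma short_time_lower_bound (lam Lam T A a c B : R) :
  (0 < n)%N -> 0 < lam -> 0 < Lam -> 0 < T -> 0 < A -> 0 < a -> 0 < c -> 0 < B ->
  exists de al : R, [/\ 0 < de, de < T, 0 < al, lam^-1 <= al &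
  forall t0 t1 (L : coeffs R n) (E : 'rV[R]_n -> R -> R) xi tau, t1 - t0 = T ->
  regular lam Lam t0 t1 L -> t0 < tau ->
  C21 tau t1 E -> (forall x s, tau < s <= t1 -> Lop L tau t1 E x s = 0) ->
  (forall x s, tau < s -> s < t1 -> `|E x s| <= (A + A * root4 T) * hker c (x - xi) (s - tau)) ->
  (forall x s, tau < s -> s < t1 ->
     a * hker B (x - xi) (s - tau) - A * root4 (s - tau) * hker c (x - xi) (s - tau) <= E x s) ->
  forall x t, tau < t -> t <= tau + de -> t < t1 ->
  a / 2 * hker al (x - xi) (t - tau) <= E x t].
Proof.
move=> n0 lam0 Lam0 T0 A0 a0 c0 B0.
have nL0 : 0 < n%:R * Lam :> R by rewrite mulr_gt0// ltr0n.
(* Small enough for [symbol_scalar_le], and at most [c], so that the error kernel lies below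
   [H_c1]. *)
pose c1 : R := Num.min c (8 * (n%:R * Lam))^-1.
have c10 : 0 < c1 by rewrite lt_min c0 invr_gt0 mulr_gt0.
have c1c : c1 <= c by rewrite ge_min lexx.
have c18 : 8 * c1 * (n%:R * Lam) <= 1.
  have h8 : 0 < 8 * (n%:R * Lam) by rewrite mulr_gt0.
  have -> : 8 * c1 * (n%:R * Lam) = c1 * (8 * (n%:R * Lam)) by ring.
  by rewrite -[leRHS](mulVf (lt0r_neq0 h8)) ler_pM2r// ge_min lexx orbT.
pose D1 : R := n%:R * Lam ^+ 2 / lam + Lam.
pose D2 : R := 4 * c1 * (n%:R * Lam ^+ 2) + Lam.
have nLL0 : 0 <= n%:R * Lam ^+ 2 :> R by rewrite mulr_ge0// sqr_ge0.
have D10 : 0 < D1 by rewrite /D1 ltr_wpDl// divr_ge0// ltW.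
have D20 : 0 < D2 by rewrite /D2 ltr_wpDl// mulr_ge0// mulr_ge0// ltW.
(* Beyond [kap] the symbol of [H_al] is nonnegative, by the first two terms, and that of [H_c1] is
   nonpositive, by the last one; [T] bounds the time that multiplies [D1] and [D2]. *)
pose kap : R := n%:R * Lam + D1 * T + 4 / c1 * (2 * c1 * (n%:R * Lam) + n%:R / 2 + D2 * T).
have kap1 : n%:R * Lam + D1 * T <= kap.
  rewrite /kap lerDl mulr_ge0 ?divr_ge0 ?(ltW c10)//.
  by rewrite !addr_ge0 ?divr_ge0// ?mulr_ge0// ?mulr_ge0// ltW.
have kap2 : 2 * c1 * (n%:R * Lam) + n%:R / 2 + D2 * T <= c1 / 4 * kap.
  rewrite /kap mulrDr [c1 / 4 * (4 / c1 * _)]mulrA.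
  have -> : c1 / 4 * (4 / c1) = 1 by field; rewrite gt_eqF.
  by rewrite mul1r lerDr mulr_ge0 ?divr_ge0 ?addr_ge0// ?ltW// mulr_gt0.
have kap0 : 0 < kap by apply: lt_le_trans kap1; rewrite addr_gt0// mulr_gt0.
pose al : R := B + 1 + lam^-1.
have l0 : 0 < lam^-1 by rewrite invr_gt0.
have al0 : 0 < al by rewrite /al; lra.
have al1 : lam^-1 <= al by rewrite /al; lra.
have alB : B <= al by rewrite /al; lra.
(* Where [q <= kap], the factor [exp(- B q)] is at least [exp(- B kap)]. For [th <= g ^+ 4] the
   parametrix error is therefore at most half of the lower bound for [Z], and the other half is kept
   for [H_al]. *)
pose g : R := a / 2 * expR (- (B * kap)) / A.
have g0 : 0 < g by rewrite !mulr_gt0 ?expR_gt0 ?invr_gt0.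
pose de : R := Num.min (T / 2) (g ^+ 4).
have de0 : 0 < de by rewrite lt_min divr_gt0// exprn_gt0.
have root4X (u : R) : 0 <= u -> root4 (u ^+ 4) = u.
  move=> u0; rewrite /root4 -[4%N]/(2 * 2)%N exprM sqrtr_sqr ger0_norm ?sqr_ge0//.
  by rewrite sqrtr_sqr ger0_norm.
have deg (th : R) : th <= de -> A * root4 th <= a / 2 * expR (- (B * kap)).
  move=> thd; have : root4 th <= g.
    by rewrite -[leRHS]root4X ?(ltW g0)// ler_root4// (le_trans thd)// ge_min lexx orbT.
  by rewrite /g ler_pdivlMr// mulrC.
exists de, al; split=> //.
  by rewrite /de gt_min; apply/orP; left; rewrite ltr_pdivrMr// ltr_pMr// ltr1n.
move=> t0 t1 L E xi tau t01 Lreg t0tau EC EL EA Elow x t taut tde tt1.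
have th0 : 0 < t - tau by rewrite subr_gt0.
suff H : forall h, 0 < h -> h <= t - tau ->
    a / 2 * hker al (x - xi) (t - tau) - A * root4 h * hker c1 (x - xi) (t - tau) <= E x t.
  apply/ler_addgt0Pr => e e0; pose P := A * hker c1 (x - xi) (t - tau).
  have P0 : 0 < P by rewrite mulr_gt0// hker_gt0.
  pose h := Num.min (t - tau) ((e / P) ^+ 4).
  have eP : 0 < e / P by rewrite divr_gt0.
  have h0 : 0 < h by rewrite lt_min th0 exprn_gt0.
  have hth : h <= t - tau by rewrite ge_min lexx.
  have rh : root4 h <= e / P.
    by rewrite -[leRHS]root4X ?(ltW eP)// ler_root4// ge_min lexx orbT.
  have := H h h0 hth.
  rewrite (_ : A * root4 h * hker c1 (x - xi) (t - tau) = P * root4 h); last first.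
    by rewrite mulrAC.
  have : P * root4 h <= e by rewrite mulrC -ler_pdivlMr.
  by move: (P * root4 h) => w; lra.
move=> h h0 hth.
apply: (@gaussian_comparison lam Lam t0 t1 L E xi tau h t (a / 2) (n%:R / 2) al
   (A * root4 h) (n%:R / 2) c1 (A + A * root4 T) c) => //.
- lra.
- by rewrite divr_gt0.
- by rewrite mulr_ge0 ?root4_ge0// ltW.
- by rewrite ltr_wpDr// mulr_ge0 ?root4_ge0// ltW.
- move=> y; have := Elow y (tau + h); rewrite [tau + h - tau]addrC addKr.
  move=> /(_ ltac:(lra) ltac:(lra)); apply: le_trans.
  apply: lerB.
    apply: ler_pM; rewrite ?divr_ge0 ?(ltW a0) ?(ltW (hker_gt0 _ _ _))//; last exact: hker_le.
    by rewrite ler_pdivrMr// ler_peMr ?(ltW a0)// ler1n.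
  apply: ler_wpM2l; last exact: hker_le.
  by rewrite mulr_ge0 ?root4_ge0// ltW.
- move=> y s hs st Epos; rewrite -/(hker al (y - xi) (s - tau)) -/(hker c1 (y - xi) (s - tau)) in Epos *.
  have taus : tau < s by lra.
  have s01 : t0 < s < t1 by apply/andP; split; lra.
  have ths0 : 0 < s - tau by rewrite subr_gt0.
  have thsT : s - tau <= T by lra.
  set q := sqnorm (y - xi) / (s - tau).
  (* Inside the parabola the parametrix estimate puts [E] above the barrier, contrary to [Epos]. *)
  have qk : kap < q.
    rewrite ltNge; apply/negP => qk; move: Epos; apply/negP; rewrite -leNgt.
    apply: le_trans (Elow y s taus _); last lra.
    apply: (@le_trans _ _ (a / 2 * hker al (y - xi) (s - tau))).
      by rewrite gerBl mulr_ge0 ?(ltW (hker_gt0 _ _ _))// mulr_ge0 ?root4_ge0// ltW.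
    have dsg := deg (s - tau) ltac:(lra).
    have H1 : A * root4 (s - tau) * hker c (y - xi) (s - tau) <=
        a / 2 * hker B (y - xi) (s - tau).
      apply: (@le_trans _ _ (a / 2 * expR (- (B * kap)) * expR (- (n%:R / 2 * ln (s - tau))))).
        apply: ler_pM => //; rewrite ?mulr_ge0 ?root4_ge0 ?(ltW A0) ?(ltW (hker_gt0 _ _ _))//.
        rewrite hkerE ler_expR lerBlDr lerDl divr_ge0 ?(ltW ths0)// mulr_ge0 ?(ltW c0)//.
        exact: sqnorm_ge0.
      rewrite -mulrA ler_pM2l ?divr_gt0// hkerE -expRD ler_expR addrC lerD2l lerN2.
      by rewrite -mulrA ler_pM2l.
    have H2 : a / 2 * hker al (y - xi) (s - tau) <= a / 2 * hker B (y - xi) (s - tau).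
      by rewrite ler_pM2l ?divr_gt0// hker_le.
    lra.
  rewrite subr_ge0; apply: (@le_trans _ _ 0).
    apply: mulr_ge0_le0.
      by rewrite mulr_ge0 ?(ltW (hker_gt0 _ _ _))// mulr_ge0 ?root4_ge0// ltW.
    apply: le_trans (symbol_scalar_le Lreg (n%:R / 2) xi y s01 taus c10 c18) _.
    rewrite -/q -/D2 -lerBrDr sub0r ler_pdivrMr//.
    have : D2 * (s - tau) <= D2 * T by rewrite ler_pM2l.
    have : c1 / 4 * kap <= c1 / 4 * q by rewrite ler_pM2l ?divr_gt0// ltW.
    by move: kap2; lra.
  apply: mulr_ge0; first by rewrite mulr_ge0 ?(ltW (hker_gt0 _ _ _))// divr_ge0// ltW.
  apply: le_trans (symbol_scalar_ge lam0 Lreg (n%:R / 2) xi y s01 taus al1).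
  rewrite -/q -/D1 subr_ge0 ler_pdivlMr//.
  have h1 : D1 * (s - tau) <= D1 * T by rewrite ler_pM2l.
  have h2 : 1 <= al by rewrite /al; lra.
  have h3 : 0 <= n%:R / 2 :> R by rewrite divr_ge0.
  have h4 : 0 < D1 * T by rewrite mulr_gt0.
  apply: (@le_trans _ _ (2 * al * (q - n%:R * Lam))); last by rewrite mulrBr; lra.
  apply: (@le_trans _ _ (1 * (D1 * T))); first by rewrite mul1r.
  by apply: ler_pM => //; [exact: ltW|lra|lra].
- by rewrite lexx andbT; lra.
Qed.

End two_sided_bounds.

Section gauss_bounds.
Context {R : realType} {n : nat}.
Implicit Types (x y z xi : 'rV[R]_n) (m al t tau h : R).

(** Both the prefactor [C^-1] and the exponent [C / 4] make the kernel decrease in [C]; hence a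
    single large [C] serves below and a single small one above. *)
Lemma gauss_cE (C : R) z t : 0 < C -> 0 < t ->
  gauss_c C z t = C^-1 * (4 * pi) `^ (- (n%:R / 2)) * hker (C / 4) z t.
Proof.
move=> C0 t0; rewrite /gauss_c /gauss hkerE sqnormZ sqr_sqrtr ?(ltW C0)//.
rewrite powRM ?mulr_ge0 ?pi_ge0 ?(ltW t0)// [t `^ _]/powR (gt_eqF t0) expRD !mulrA.
congr (_ * expR _ * expR _); first by rewrite mulNr.
by field; rewrite gt_eqF.
Qed.

Lemma regular_two_sided (lam Lam T : R) :
  (0 < n)%N -> 0 < lam -> 0 < Lam -> 0 < T ->
  exists C Ct : R, [/\ 0 < C, 0 < Ct &
  forall t0 t1 (L : coeffs R n) (E : 'rV[R]_n -> R -> 'rV[R]_n -> R -> R),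
  t1 - t0 = T -> regular lam Lam t0 t1 L ->
  (forall xi tau, t0 < tau -> tau < t1 -> C21 tau t1 (fun x t => E x t xi tau) /\
     forall x t, tau < t <= t1 -> Lop L tau t1 (fun y s => E y s xi tau) x t = 0) ->
  (forall x t xi tau, t0 < tau -> tau < t -> t < t1 ->
     E x t xi tau = parametrix_solution L t1 x t xi tau) ->
  forall x xi t tau, t0 < tau -> tau < t -> t < t1 ->
  gauss_c C (x - xi) (t - tau) <= E x t xi tau /\
  E x t xi tau <= gauss_c Ct (x - xi) (t - tau)].
Proof.
move=> n0 lam0 Lam0 T0.
have [A [a [c [B [A0 a0 c0 B0 est]]]]] := parametrix_estimates n0 lam0 Lam0 T0.
have [de [al [de0 deT al0 al1 short]]] :=
  short_time_lower_bound n0 lam0 Lam0 T0 A0 a0 c0 B0.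
pose D1 : R := n%:R * Lam ^+ 2 / lam + Lam.
have nL0 : 0 < n%:R * Lam :> R by rewrite mulr_gt0// ltr0n.
have D10 : 0 < D1 by rewrite /D1 ltr_wpDl// divr_ge0 ?mulr_ge0 ?sqr_ge0// ltW.
(* The first two terms make the symbol of the barrier nonnegative at every point for times up to
   [T]; the last one gives [m >= n / 2], so that the extra power [th^(-(m - n/2))] is
   nonincreasing. *)
pose m : R := 2 * al * (n%:R * Lam) + D1 * T + n%:R / 2.
have n2 : 0 <= n%:R / 2 :> R by rewrite divr_ge0.
have DT0 : 0 < D1 * T by rewrite mulr_gt0.
have aL0 : 0 < 2 * al * (n%:R * Lam) by rewrite mulr_gt0// mulr_gt0.
have mn0 : 0 <= m - n%:R / 2 by rewrite /m; lra.
have m0 : 0 <= m by lra.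
(* [k1] matches the barrier with [a / 2 * hker al] at time [de], where the short-time bound ends;
   [k2] is what is left of the extra power at time [T]. *)
pose k1 : R := a / 2 * expR ((m - n%:R / 2) * ln de).
have k10 : 0 < k1 by rewrite mulr_gt0 ?divr_gt0 ?expR_gt0.
pose k2 : R := k1 * expR (- ((m - n%:R / 2) * ln T)).
have k20 : 0 < k2 by rewrite mulr_gt0 ?expR_gt0.
pose b : R := Num.min (a / 2) k2.
have b0 : 0 < b by rewrite lt_min k20 divr_gt0.
pose A' : R := A + A * root4 T.
have A'0 : 0 < A' by rewrite ltr_wpDr// mulr_ge0 ?root4_ge0// ltW.
pose P0 : R := (4 * pi) `^ (- (n%:R / 2)).
have P00 : 0 < P0 by rewrite powR_gt0// mulr_gt0// pi_gt0.
pose C : R := Num.max (4 * al) (P0 / b).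
pose Ct : R := Num.min (4 * c) (P0 / A').
have C0 : 0 < C by rewrite lt_max mulr_gt0.
have Ct0 : 0 < Ct by rewrite lt_min mulr_gt0// divr_gt0.
exists C, Ct; split=> // t0 t1 L E t01 Lreg EL Epar.
have EA x s xi tau : t0 < tau -> tau < s -> s < t1 ->
    `|E x s xi tau| <= A' * hker c (x - xi) (s - tau) /\
    a * hker B (x - xi) (s - tau) - A * root4 (s - tau) * hker c (x - xi) (s - tau)
    <= E x s xi tau.
  move=> h1 h2 h3; have [E1 E2 E3] := est t0 t1 L t01 Lreg x s xi tau h1 h2 h3.
  rewrite (Epar _ _ _ _ h1 h2 h3).
  have H0 := hker_gt0 c (x - xi) (s - tau); have HB := hker_gt0 B (x - xi) (s - tau).
  have Z0 : 0 <= parametrix L x s xi tau.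
    by apply: le_trans E1; rewrite mulr_ge0// ltW.
  have rT : A * root4 (s - tau) * hker c (x - xi) (s - tau) <=
      A * root4 T * hker c (x - xi) (s - tau).
    by rewrite ler_pM2r// ler_pM2l// ler_root4//; lra.
  move: E3; rewrite ler_norml => /andP[E3 E4]; split; last lra.
  by rewrite ler_norml /A' mulrDl; apply/andP; split; lra.
move=> x xi t tau t0tau taut tt1.
have th0 : 0 < t - tau by rewrite subr_gt0.
have [EC ELop] := EL xi tau t0tau (lt_trans taut tt1).
split; last first.
  rewrite gauss_cE// -/P0; apply: le_trans (ler_norm _) _.
  have [EU _] := EA x t xi tau t0tau taut tt1; apply: le_trans EU _.
  apply: ler_pM; rewrite ?(ltW A'0) ?(ltW (hker_gt0 _ _ _))//.
    by rewrite mulrC ler_pdivlMr// -ler_pdivlMl// mulrC /Ct ge_min lexx orbT.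
  apply: hker_le => //; rewrite ler_pdivrMr// mulrC /Ct ge_min lexx//.
have shortE y s : tau < s -> s <= tau + de -> s < t1 ->
    a / 2 * hker al (y - xi) (s - tau) <= E y s xi tau.
  move=> h1 h2 h3; apply: (short t0 t1 L (fun y s => E y s xi tau) xi tau) => //.
  - by move=> z r r1 r2; have [] := EA z r xi tau t0tau r1 r2.
  - by move=> z r r1 r2; have [] := EA z r xi tau t0tau r1 r2.
have low : b * hker al (x - xi) (t - tau) <= E x t xi tau.
  have [tde|tde] := leP t (tau + de).
    apply: le_trans (shortE x t taut tde tt1); rewrite ler_pM2r ?hker_gt0//.
    by rewrite /b ge_min lexx.
  have gk (z : 'rV[R]_n) th : gker m al%:M z th = expR (- ((m - n%:R / 2) * ln th)) * hker al z th.
    by rewrite hkerE /gker quad_scalar -expRD; congr expR; ring.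
  have H : k1 * gker m al%:M (x - xi) (t - tau) - 0 * gker 0 1%:M (x - xi) (t - tau)
      <= E x t xi tau.
    apply: (@gaussian_comparison R n lam Lam t0 t1 L (fun y s => E y s xi tau) xi tau de t
      k1 m al 0 0 1 A' c) => //.
    - exact: ltW.
    - by move=> y s h1 h2; have [] := EA y s xi tau t0tau h1 h2.
    - move=> y; rewrite mul0r subr0 gk.
      have := shortE y (tau + de) ltac:(lra) (lexx _) ltac:(lra).
      rewrite [tau + de - tau]addrC addKr; apply: le_trans.
      rewrite /k1 -mulrA [X in _ * X <= _]mulrA -expRD subrr expR0 mul1r//.
    - move=> y s h1 h2 _; rewrite !mul0r subr0 mulr_ge0//.
        by rewrite mulr_ge0 ?(ltW k10)// ltW// gker_gt0.
      have taus : tau < s by lra.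
      have s01 : t0 < s < t1 by apply/andP; split; lra.
      have ths0 : 0 < s - tau by rewrite subr_gt0.
      apply: le_trans (symbol_scalar_ge lam0 Lreg m xi y s01 taus al1).
      rewrite -/D1 subr_ge0 ler_pdivlMr//.
      have H1 : D1 * (s - tau) <= D1 * T by rewrite ler_pM2l//; lra.
      have H2 : 0 <= 2 * al * (sqnorm (y - xi) / (s - tau)).
        by rewrite !mulr_ge0 ?sqnorm_ge0 ?invr_ge0 ?(ltW al0) ?(ltW ths0).
      by rewrite /m; lra.
    - by rewrite lexx andbT ltW.
  apply: le_trans H; rewrite mul0r subr0 gk mulrA ler_pM2r ?hker_gt0//.
  apply: (@le_trans _ _ k2); first by rewrite /b ge_min lexx orbT.
  rewrite /k2 ler_pM2l// ler_expR lerN2 ler_wpM2l// ler_ln ?posrE//; lra.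
apply: le_trans low; rewrite gauss_cE// -/P0.
apply: ler_pM; rewrite ?(ltW (hker_gt0 _ _ _))//.
- by rewrite mulr_ge0 ?invr_ge0// ltW.
- by rewrite mulrC ler_pdivrMr// -ler_pdivrMl// mulrC /C le_max lexx orbT.
- by apply: hker_le => //; rewrite ler_pdivlMr// mulrC /C le_max lexx.
Qed.

End gauss_bounds.

(** * Smooth bumps *)

Section smooth_functions_of_one_variable.
Context {R : realType}.
Implicit Types (g h : R -> R).
Notation mu := (@lebesgue_measure R).

(** The whole sequence of derivatives is given as a witness, so that stability under scaling,
    subtraction and affine substitution is checked termwise. *)
Definition Cinf g := exists G : nat -> R -> R,
  G 0%N = g /\ forall k x, is_derive x (1 : R) (G k) (G k.+1 x).

Lemma Cinf_derivative g : Cinf g ->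
  exists2 g', Cinf g' & forall x, is_derive x (1 : R) g (g' x).
Proof.
move=> [G [<- GD]]; exists (G 1%N); last exact: GD.
by exists (fun k => G k.+1); split.
Qed.

Lemma Cinf_primitive g g' : Cinf g' -> (forall x, is_derive x (1 : R) g (g' x)) -> Cinf g.
Proof.
move=> [G [G0 GD]] gD; exists (fun k => if k is k'.+1 then G k' else g); split => //.
by case=> [|k] x; [rewrite G0|exact: GD].
Qed.

Lemma Cinf_scale c g : Cinf g -> Cinf (fun s => c * g s).
Proof.
move=> [G [G0 GD]]; exists (fun k s => c * G k s); split; first by rewrite G0.
by move=> k x; exact: is_derive_scalef.
Qed.

Lemma Cinf_sub g h : Cinf g -> Cinf h -> Cinf (fun s => g s - h s).
Proof.
move=> [G [G0 GD]] [H [H0 HD]]; exists (fun k s => G k s - H k s); split.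
  by rewrite G0 H0.
by move=> k x; exact: is_derive_subf.
Qed.

Lemma is_derive_affine g (a b x l : R) : is_derive (a * x + b) (1 : R) g l ->
  is_derive x (1 : R) (fun s => g (a * s + b)) (a * l).
Proof.
move=> gl; have H : is_derive x (1 : R) (fun s => a * s + b) a.
  apply: is_derive_eq (is_derive_addf (is_derive_scalef a (is_derive_idf x)) (is_derive_cstf b x (1 : R))) _.
  by rewrite mulr1 addr0.
by apply: is_derive_eq (is_derive_compf H gl) _; rewrite mulrC.
Qed.

Lemma Cinf_affine a b g : Cinf g -> Cinf (fun s => g (a * s + b)).
Proof.
move=> [G [G0 GD]]; exists (fun k s => a ^+ k * G k (a * s + b)); split.
  by apply/funext => s; rewrite expr0 mul1r G0.
move=> k x; rewrite exprSr -mulrA; apply: is_derive_scalef.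
exact: is_derive_affine.
Qed.

Lemma Cinf_continuous g : Cinf g -> continuous g.
Proof. by move=> [G [<- GD]] x; exact: is_derive_continuous (GD 0%N x). Qed.

Lemma is_derive_unique g (x a b : R) : is_derive x (1 : R) g a -> is_derive x (1 : R) g b -> a = b.
Proof. by move=> [_ <-] [_ <-]. Qed.

Lemma ge0_derive_homo g (g' : R -> R) : (forall x, is_derive x (1 : R) g (g' x)) ->
  (forall x, 0 <= g' x) -> {homo g : x y / x <= y}.
Proof.
move=> gD g0 x y; rewrite le_eqVlt => /predU1P[->//|xy].
have [|z _ E] := @MVT _ g g' x y xy (fun z _ => gD z).
  by apply: continuous_in_subspaceT => z _; exact: is_derive_continuous (gD z).
by rewrite -subr_ge0 E mulr_ge0// subr_ge0 ltW.
Qed.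

Lemma compact_support_primitive g (r : R) : 0 < r -> continuous g ->
  (forall x, r <= `|x| -> g x = 0) ->
  exists2 G, (forall x, is_derive x (1 : R) G (g x)) & forall x, x <= - r -> G x = 0.
Proof.
move=> r0 cg g0.
have ig : mu.-integrable setT (EFin \o g).
  have gE : EFin \o g = (EFin \o g) \_ `[- r, r].
    apply/funext => x; rewrite patchE; case: ifPn => // /negP xr; rewrite /= g0//.
    rewrite leNgt; apply/negP => H; apply: xr; apply/mem_set; rewrite /= in_itv/=.
    by rewrite -ler_norml ltW.
  rewrite gE -integrable_mkcond//; apply: continuous_compact_integrable.
    exact: segment_compact.
  exact: continuous_subspaceT.
exists (fun x => \int[mu]_(t in `]-oo, x]) g t)%R.
- move=> x; have x1 : x < x + 1 by rewrite ltrDl.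
  have ix : mu.-integrable `]-oo, x + 1] (EFin \o g) by exact: integrableS ig.
  have HH := @continuous_FTC1 R g -oo%O x (x + 1) x1 ix.
  move: HH => /= /(_ (ltNyr x) (cg x))[d e].
  by split; [exact: d|rewrite -derive1E].
- move=> x xr; rewrite /Rintegral integral0_eq// => t; rewrite /= in_itv/= => tx.
  by rewrite g0// ler0_norm; lra.
Qed.

(* A smooth step is the normalized primitive of a bump function. *)
Definition smooth_step (G b : R -> R) := [/\ Cinf G, Cinf b,
  forall x, is_derive x (1 : R) G (b x), forall x, 0 <= b x &
  forall x, [/\ (x <= -1 -> G x = 0), (1 <= x -> G x = 1) & (1 <= `|x| -> b x = 0)]].

Lemma exists_smooth_step (g : R -> R) (r : R) : 0 < r -> Cinf g ->
  (forall x, 0 <= g x) -> 0 < g 0 -> (forall x, r <= `|x| -> g x = 0) ->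
  exists G b, smooth_step G b.
Proof.
move=> r0 Cg g0 g00 gr.
have [G GD G0] := compact_support_primitive r0 (Cinf_continuous Cg) gr.
have Gmono := ge0_derive_homo GD g0.
have Gr x : r <= x -> G x = G r.
  rewrite le_eqVlt => /predU1P[->//|rx].
  have [|z] := @MVT _ G g r x rx (fun z _ => GD z).
    by apply: continuous_in_subspaceT => z _; exact: is_derive_continuous (GD z).
  rewrite in_itv/= => /andP[rz _]; rewrite gr ?mul0r; first by move/subr0_eq.
  by rewrite ler_normr ltW.
(* Otherwise the nondecreasing [G] vanishes on [[-r, r]], and so does its derivative at 0, which is
   [g 0 > 0]. *)
have m0 : 0 < G r.
  rewrite lt_def; apply/andP; split; last by rewrite -(G0 (- r))// Gmono//; lra.
  apply/eqP => Gr0; suff : g 0 = 0 by move=> E; rewrite E ltxx in g00.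
  have GE s : `|s| <= r -> G s = 0.
    rewrite ler_norml => /andP[s1 s2]; apply/eqP; rewrite eq_le; apply/andP; split.
      by rewrite -Gr0 Gmono.
    by rewrite -(G0 (- r))// Gmono.
  apply: (is_derive_unique (GD 0)); apply/is_derive_cvg.
  have G00 : G 0 = 0 by apply: GE; rewrite normr0 ltW.
  apply: cvg_near_cst; near=> h; rewrite addr0 /GRing.scale/= mulr1 G00 GE ?subr0 ?mulr0//.
  by near: h; exists r => //= h; rewrite /ball_/= sub0r normrN => /ltW.
pose m := G r; have mi : 0 < m^-1 by rewrite invr_gt0.
exists (fun s => m^-1 * G (r * s + 0)), (fun s => m^-1 * (r * g (r * s + 0))).
have CG := Cinf_primitive Cg GD.
split.
- exact/Cinf_scale/Cinf_affine.
- exact/Cinf_scale/Cinf_scale/Cinf_affine.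
- by move=> x; apply: is_derive_scalef; exact: is_derive_affine.
- by move=> x; rewrite !mulr_ge0// ltW.
- move=> x; rewrite addr0; split=> x1.
  + rewrite G0 ?mulr0//; nra.
  + by rewrite Gr ?mulVf ?gt_eqF//; nra.
  + by rewrite gr ?mulr0 ?mulr0// normrM gtr0_norm//; nra.
Unshelve. all: by end_near. Qed.

End smooth_functions_of_one_variable.

Section smooth_products.
Context {R : realType} {n : nat}.
Local Notation V := ('rV[R]_n * R)%type.

(* Space-time coordinates, the time coordinate being [None]. *)
Definition stc (o : option 'I_n) (z : V) : R := if o is Some j then z.1 0 j else z.2.

Definition stb (o : option 'I_n) : V := if o is Some j then (ebasis j, 0) else (0, 1).

Lemma stcE o o' (s : R) (z : V) : stc o' (s *: stb o + z) = s * (o == o')%:R + stc o' z.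
Proof.
case: o => [i|]; case: o' => [j|] //=.
- by rewrite !mxE /= (inj_eq (@Some_inj _)) eq_sym.
- by rewrite scaler0 add0r mulr0 add0r.
Qed.

Lemma differentiable_stc o (z : V) : differentiable (stc o) z.
Proof.
have lin : linear (stc o).
  by move=> a u v; case: o => [j|] /=; rewrite ?mxE.
pose f := GRing.isLinear.Build _ _ _ _ _ lin.
pose F : {linear V -> R} := HB.pack (stc o) f.
have co : continuous (stc o).
  case: o {lin f F} => [j|] p; last exact: cvg_snd.
  apply: (@continuous_comp _ _ _ fst (fun y : 'rV[R]_n => y 0 j) p); first exact: cvg_fst.
  exact: coord_continuous.
exact: (@linear_differentiable _ _ _ F z co).
Qed.

Lemma is_derive_stc o (z v : V) : is_derive z v (stc o) (stc o v).
Proof.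
apply/is_derive_lineP.
rewrite (_ : (fun _ => _) = fun s : R => s * stc o v + stc o z).
  apply: is_derive_eq (is_derive_addf (is_derive_mulf (is_derive_idf (0 : R))
    (is_derive_cstf (stc o v) (0 : R) (1 : R))) (is_derive_cstf _ _ _)) _.
  by rewrite mul1r mul0r !addr0.
by apply/funext => s; case: o => [j|] /=; rewrite ?mxE.
Qed.

(** [smooth] quantifies over all lists of directions. A class generated by sums and products of
    functions of one coordinate is stable under every directional derivative, so induction on the
    list applies. *)
Inductive st_smooth : (V -> R) -> Prop :=
| st_smooth_coord o g : Cinf g -> st_smooth (fun z => g (stc o z))
| st_smooth_cst c : st_smooth (fun=> c)
| st_smooth_add f g : st_smooth f -> st_smooth g -> st_smooth (fun z => f z + g z)
| st_smooth_mul f g : st_smooth f -> st_smooth g -> st_smooth (fun z => f z * g z).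

Lemma st_smooth_derive f : st_smooth f ->
  (forall z, differentiable f z) /\ forall v, st_smooth (fun z => 'D_v f z).
Proof.
elim=> {f} [ o g Cg|c|f g _ [df Df] _ [dg Dg]|f g sf [df Df] sg [dg Dg]].
- have [g' Cg' gD] := Cinf_derivative Cg; split=> [z|v].
    apply: (@differentiable_comp _ _ _ _ (stc o) g); first exact: differentiable_stc.
    by apply/derivable1_diffP; have [] := gD (stc o z).
  rewrite (_ : (fun _ => _) = fun z => g' (stc o z) * stc o v).
    exact: (st_smooth_mul (st_smooth_coord o Cg') (st_smooth_cst (stc o v))).
  apply/funext => z.
  by have [_ ->] := is_derive_compf (is_derive_stc o z v) (gD (stc o z)).
- split=> [z|v]; first exact: differentiable_cst.
  rewrite (_ : (fun z : V => _) = fun _ : V => 0 : R); first exact: (st_smooth_cst 0).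
  by apply/funext => z; have [_ ->] := is_derive_cstf c z v.
- split=> [z|v]; first exact: differentiableD.
  rewrite (_ : (fun _ => _) = fun z => 'D_v f z + 'D_v g z); first exact: st_smooth_add.
  apply/funext => z.
  have Hf : is_derive z v f ('D_v f z) by split => //; exact: diff_derivable.
  have Hg : is_derive z v g ('D_v g z) by split => //; exact: diff_derivable.
  by have [_ ->] := is_derive_addf Hf Hg.
- split=> [z|v]; first exact: differentiableM.
  rewrite (_ : (fun _ => _) = fun z => 'D_v f z * g z + f z * 'D_v g z).
    by apply: st_smooth_add; apply: st_smooth_mul.
  apply/funext => z.
  have Hf : is_derive z v f ('D_v f z) by split => //; exact: diff_derivable.
  have Hg : is_derive z v g ('D_v g z) by split => //; exact: diff_derivable.
  by have [_ ->] := is_derive_mulf Hf Hg.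
Qed.

Lemma st_smoothP f : st_smooth f -> smooth f.
Proof.
move=> sf s; suff H : st_smooth (foldr (fun v g => fun y => 'D_v g y) f s).
  by move=> x; have [d _] := st_smooth_derive H.
by elim: s => //= v s /st_smooth_derive[_]; exact.
Qed.

Lemma st_smooth_prod (s : seq (option 'I_n)) (g : option 'I_n -> R -> R) :
  (forall o, Cinf (g o)) -> st_smooth (fun z => \prod_(o <- s) g o (stc o z)).
Proof.
move=> Cg; elim: s => [|o s IH].
  rewrite (_ : (fun _ => _) = fun _ : V => 1 : R); first exact: (st_smooth_cst 1).
  by apply/funext => z; rewrite big_nil.
rewrite (_ : (fun _ => _) = fun z => g o (stc o z) * \prod_(o <- s) g o (stc o z)).
  by apply: st_smooth_mul => //; exact: st_smooth_coord.
by apply/funext => z; rewrite big_cons.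
Qed.

End smooth_products.

(** * Space-time Lebesgue measure *)

Section space_time_measure.
Context {R : realType} {n : nat}.
Local Notation RT := (measurableTypeR R).
Local Notation V := ('rV[R]_n * R)%type.
Local Notation VT := (n.-tuple RT * RT)%type.
Local Notation mu := (@lebesgue_measure R).
Local Notation M := (@leb_st R n).
Implicit Types (Q : set V) (F : V -> R) (p : V).

(** The norms on row vectors and on pairs are sup norms: balls are boxes, and the measures and
    mollifiers below factor over the coordinates. *)
Lemma st_ball p (r : R) q : 0 < r -> ball p r q <-> forall o, `|stc o p - stc o q| < r.
Proof.
move=> r0; split=> [[[_ p1] p2]|H]; first by case=> [j|]; [exact: p1|exact: p2].
by split; [split=> // i j; rewrite (ord1 i); exact: (H (Some j))|exact: (H None)].
Qed.

Lemma measurable_stc o : measurable_fun setT (fun z : VT => stc o (pt_of z)).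
Proof.
case: o => [j|]; last exact: measurable_snd.
rewrite (_ : (fun _ => _) = fun z : VT => tnth z.1 j).
  exact: (measurableT_comp (measurable_tnth j)).
by apply/funext => z; rewrite /= mxE.
Qed.

Lemma measurable_st_prod (g : option 'I_n -> R -> R) :
  (forall o, measurable_fun setT (g o)) ->
  measurable_fun setT (fun z : VT => \prod_o g o (stc o (pt_of z))).
Proof.
move=> mg; apply: measurable_prod => o _.
exact: (measurableT_comp (mg o) (measurable_stc o)).
Qed.

Lemma big_option_ord (G : option 'I_n -> R) :
  \prod_o G o = \prod_i G (Some i) * G None.
Proof.
rewrite (bigD1 None)//= mulrC; congr (_ * _).
rewrite (reindex_omap Some id); last by case.
by apply: eq_bigl => i; rewrite eqxx.
Qed.

Lemma integral_leb_st_prod (g : option 'I_n -> R -> R) (I : option 'I_n -> R) :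
    (forall o, measurable_fun setT (g o)) ->
    (forall o x, 0 <= g o x) ->
    (forall o, \int[mu]_x (g o x)%:E = (I o)%:E)%E ->
  (\int[M]_z (\prod_o g o (stc o (pt_of z)))%:E = (\prod_o I o)%:E)%E.
Proof.
move=> mg g0 gI; have mp := measurable_st_prod mg.
rewrite /leb_st fubini_tonelli2; last 2 first.
- by apply/measurable_EFinP.
- by move=> z; rewrite lee_fin prodr_ge0.
pose P := \prod_i I (Some i).
have FE y : fubini_G (leb n) (fun z : VT => (\prod_o g o (stc o (pt_of z)))%:E) y =
    ((g None y)%:E * P%:E)%E.
  rewrite -(@integral_leb_prod _ _ (fun i => g (Some i)) (fun i => I (Some i)))//= -ge0_integralZl//=; last 3 first.
  - apply/measurable_EFinP; apply: (@measurable_prod_tnth _ _ (fun i => g (Some i))) => i.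
    exact: mg.
  - by move=> z _; rewrite lee_fin prodr_ge0.
  - by rewrite lee_fin g0.
  apply: eq_integral => z _; rewrite -EFinM big_option_ord mulrC; congr (_ * _)%:E.
  by apply: eq_bigr => i _; rewrite /= mxE.
under eq_integral do rewrite FE.
rewrite ge0_integralZr//=; last 3 first.
- by apply/measurable_EFinP; exact: mg.
- by move=> x _; rewrite lee_fin.
- by rewrite lee_fin prodr_ge0// => i _; rewrite -lee_fin -gI integral_ge0// => x _; rewrite lee_fin.
by rewrite gI -EFinM big_option_ord mulrC.
Qed.

Lemma measurable_st_box (A : option 'I_n -> set R) : (forall o, measurable (A o)) ->
  measurable [set z : VT | forall o, A o (stc o (pt_of z))].
Proof.
move=> mA; rewrite (_ : [set _ | _] =
    \bigcap_(o in [set: option 'I_n]) ((fun z => stc o (pt_of z)) @^-1` A o)).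
  apply: fin_bigcap_measurable; first exact: finite_finset.
  by move=> o _; rewrite -[X in measurable X]setTI; exact: measurable_stc.
by apply/seteqP; split => z H o *; apply: H.
Qed.

Lemma measurable_st_ball p (r : R) : 0 < r -> measurable (pt_of @^-1` (ball p r)).
Proof.
move=> r0; rewrite (_ : _ @^-1` _ = [set z : VT | forall o, (ball (stc o p) r : set R) (stc o (pt_of z))]).
  by apply: (@measurable_st_box (fun o => ball (stc o p) r)) => o; exact: measurable_ball.
by apply/seteqP; split => z /(st_ball _ _ r0).
Qed.

(** An open set is the countable union of the rational boxes that it contains; an index whose box is
    not contained contributes the empty set. *)
Lemma measurable_st_open Q : open Q -> measurable (pt_of @^-1` Q : set VT).
Proof.
move=> oQ; pose B (c : {ffun option 'I_n -> rat * rat}) := [set p : V |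
  forall o, `](ratr (c o).1), (ratr (c o).2)[%classic (stc o p)].
have -> : pt_of @^-1` Q = \bigcup_(c in setT)
    [set z : VT | (B c `<=` Q) /\ B c (pt_of z)].
  apply/seteqP; split => [z Qz|z [c _ []]]; last exact.
  have [r /= r0 rQ] : nbhs_ball (pt_of z) Q by apply/nbhs_ballP/open_nbhs_nbhs.
  have H o : exists q : rat * rat, [/\ ratr q.1 \in `]stc o (pt_of z) - r, stc o (pt_of z)[
      & ratr q.2 \in `]stc o (pt_of z), stc o (pt_of z) + r[].
    have [q1 h1] : exists q : rat, ratr q \in `]stc o (pt_of z) - r, stc o (pt_of z)[.
      by apply: rat_in_itvoo; lra.
    have [q2 h2] : exists q : rat, ratr q \in `]stc o (pt_of z), stc o (pt_of z) + r[.
      by apply: rat_in_itvoo; lra.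
    by exists (q1, q2).
  have [c cH] := choice H.
  exists [ffun o => c o] => //; split=> [q Bq|o].
    apply: rQ; apply/(st_ball _ _ r0) => o; have := Bq o; rewrite ffunE.
    have [] := cH o; rewrite /= !in_itv/= => /andP[a1 a2] /andP[b1 b2] /andP[c1 c2].
    by rewrite ltr_norml; apply/andP; split; lra.
  by rewrite ffunE; have [] := cH o; rewrite /= !in_itv/= => /andP[_ ->] /andP[-> _].
apply: countable_bigcupT_measurable => [|c]; first exact: countableP.
have [cQ|cQ] := pselect (B c `<=` Q).
  rewrite (_ : [set _ | _] = [set z : VT | forall o,
    (`](ratr (c o).1), (ratr (c o).2)[%classic : set R) (stc o (pt_of z))]).
    by apply: (@measurable_st_box (fun o => `](ratr (c o).1), (ratr (c o).2)[%classic)) => o.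
  by apply/seteqP; split => [z []|z].
by rewrite (_ : [set _ | _] = set0)//; apply/seteqP; split => [z []|].
Qed.

Lemma st_ball_measure_gt0 p (r : R) : 0 < r -> (0 < M (pt_of @^-1` (ball p r)))%E.
Proof.
move=> r0; have mB := measurable_st_ball p r0.
rewrite -[X in M X]setIT -integral_indic//.
rewrite (_ : (\int[_]_(_ in _) _)%E = (\prod_(o : option 'I_n) (r + r))%:E).
  by rewrite lte_fin prodr_gt0// => o _; rewrite addr_gt0.
rewrite -(@integral_leb_st_prod (fun o => \1_(ball (stc o p) r)))//; first last.
- move=> o; have mb : measurable (ball (stc o p) r : set RT) by exact: measurable_ball.
  rewrite (integral_indic _ measurableT mb) setIT.
  have := lebesgue_measure_ball (stc o p) (ltW r0); rewrite mulr2n => <- //.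
- by move=> o; apply: measurable_indic; exact: measurable_ball.
apply: eq_integral => z _; congr _%:E; rewrite indicE.
have [pz|pz] := pselect (ball p r (pt_of z)).
  by rewrite mem_set// big1// => o _; rewrite indicE mem_set//; have /(st_ball _ _ r0) := pz; exact.
rewrite memNset//.
have [ o oz] : exists o, ~ `|stc o p - stc o (pt_of z)| < r.
  by apply: contrapT => H; apply: pz; apply/(st_ball _ _ r0) => o; apply: contrapT => oz; apply: H; exists o.
by rewrite (bigD1 o)//= indicE memNset ?mul0r.
Qed.

Lemma Linf_norm_ae Q F (N : R) : open Q -> Q !=set0 -> (Linf_norm Q F <= N%:E)%E ->
  {ae M, forall z, Q (pt_of z) -> `|F (pt_of z)| <= N}.
Proof.
move=> oQ [p Qp]; rewrite /Linf_norm unlock ifT => [/ess_supP|].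
  apply: filterS => z /= + Qz; rewrite patchE mem_set// lee_fin; exact.
(* The norm with exponent [+oo] is an essential supremum provided that the whole space has positive
   measure, which a ball ensures. *)
have [r /= r0 rQ] : nbhs_ball p Q by apply/nbhs_ballP/open_nbhs_nbhs.
apply: lt_le_trans (st_ball_measure_gt0 p r0) _; apply: le_measure; rewrite ?inE//.
exact: measurable_st_ball.
Qed.

(** Continuity turns an almost everywhere bound into a pointwise one: a violation would persist on a
    ball, which is not negligible. *)
Lemma Linf_norm_bound Q F (N : R) p : open Q -> Q p -> {for p, continuous F} ->
  (Linf_norm Q F <= N%:E)%E -> `|F p| <= N.
Proof.
move=> oQ Qp cF HF; rewrite leNgt; apply/negP => NF.
have : \forall q \near p, Q q /\ N < `|F q|.
  near=> q; split; first by near: q; exact: open_nbhs_nbhs.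
  near: q; apply: (cvgr_gt `|F p|) => //; exact: cvg_norm cF.
move=> /nbhs_ballP[r /= r0 rH].
have [A [mA A0 AH]] : {ae M, forall z, Q (pt_of z) -> `|F (pt_of z)| <= N}.
  by apply: Linf_norm_ae => //; exists p.
suff : (M (pt_of @^-1` (ball p r)) <= M A)%E by rewrite A0 leNgt st_ball_measure_gt0.
apply: le_measure; rewrite ?inE//; first exact: measurable_st_ball.
move=> z /= /rH[Qz Nz]; apply: AH => /= /(_ Qz).
by rewrite leNgt Nz.
Unshelve. all: by end_near. Qed.

Lemma Linf_norm_ge0 Q F : (0 <= Linf_norm Q F)%E.
Proof. exact: Lnorm_ge0. Qed.

(* The bound is strict because the infimum need not be attained. *)
Lemma W1inf_normP Q F (N : R) : (W1inf_norm Q F < N%:E)%E ->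
  measurable_on Q F /\ (Linf_norm Q F <= N%:E)%E /\
  forall o, exists2 g, weak_deriv Q (stb o) F g & (Linf_norm Q g <= N%:E)%E.
Proof.
move=> /ereal_inf_lt[_ [df [dtf [mF wdf wdt ->]]] /ltW FN].
have F0 := Linf_norm_ge0 Q F; have dt0 := Linf_norm_ge0 Q dtf.
have S0 : (0 <= \sum_i Linf_norm Q (df i))%E by apply: sume_ge0 => i _; exact: Linf_norm_ge0.
split=> //; split.
  by apply: le_trans FN; rewrite -addeA leeDl// adde_ge0.
case=> [i|]; last first.
  exists dtf; first exact: wdt.
  by apply: le_trans FN; rewrite leeDr// adde_ge0.
exists (df i); first exact: wdf.
apply: le_trans FN; rewrite -addeA addeCA.
apply: (@le_trans _ _ (\sum_i Linf_norm Q (df i))%E).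
  rewrite (bigD1 i)//= leeDl// sume_ge0// => j _; exact: Linf_norm_ge0.
by rewrite leeDl// adde_ge0.
Qed.

End space_time_measure.

(** * Bounded weak derivatives *)

Section mollifiers.
Context {R : realType}.
Variables (G b : R -> R) (Gb : smooth_step G b) (d : R) (d0 : 0 < d).
Notation mu := (@lebesgue_measure R).

(** The argument is [(s - c) / d], written in affine form so that [Cinf_affine] and
    [is_derive_affine] apply as they stand. *)
Definition ramp (c s : R) : R := G (d^-1 * s + - (d^-1 * c)).
Definition mollifier (c s : R) : R := d^-1 * b (d^-1 * s + - (d^-1 * c)).

Let di0 : 0 < d^-1. Proof. by rewrite invr_gt0. Qed.

Let argE c s : d^-1 * s + - (d^-1 * c) = d^-1 * (s - c).
Proof. by rewrite -mulrBr. Qed.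

Lemma Cinf_ramp c : Cinf (ramp c).
Proof. by have [CG _ _ _ _] := Gb; exact: Cinf_affine. Qed.

Lemma Cinf_mollifier c : Cinf (mollifier c).
Proof. by have [_ Cb _ _ _] := Gb; exact/Cinf_scale/Cinf_affine. Qed.

Lemma is_derive_ramp c s : is_derive s (1 : R) (ramp c) (mollifier c s).
Proof. by have [_ _ GD _ _] := Gb; exact: is_derive_affine. Qed.

Lemma mollifier_ge0 c s : 0 <= mollifier c s.
Proof. by have [_ _ _ b0 _] := Gb; rewrite mulr_ge0// ltW. Qed.

Lemma mollifier_eq0 c s : d <= `|s - c| -> mollifier c s = 0.
Proof.
have [_ _ _ _ H] := Gb; move=> ds; rewrite /mollifier argE.
have [_ _ ->] := H (d^-1 * (s - c)); first by rewrite mulr0.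
by rewrite normrM gtr0_norm// -ler_pdivrMl// invrK mulr1.
Qed.

Lemma ramp_eq0 c s : s <= c - d -> ramp c s = 0.
Proof.
have [_ _ _ _ H] := Gb; move=> sc; rewrite /ramp argE.
have [-> //] := H (d^-1 * (s - c)).
by rewrite -ler_pdivlMl// invrK mulrN1; lra.
Qed.

Lemma ramp_eq1 c s : c + d <= s -> ramp c s = 1.
Proof.
have [_ _ _ _ H] := Gb; move=> sc; rewrite /ramp argE.
have [_ -> //] := H (d^-1 * (s - c)).
by rewrite -ler_pdivrMl// invrK mulr1; lra.
Qed.

Lemma ramp_homo c : {homo ramp c : x y / x <= y}.
Proof. exact: ge0_derive_homo (is_derive_ramp c) (mollifier_ge0 c). Qed.

Lemma ramp_itv c s : 0 <= ramp c s <= 1.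
Proof.
apply/andP; split.
  rewrite -(@ramp_eq0 c (Num.min s (c - d))) ?ge_min ?lexx ?orbT//.
  by apply: ramp_homo; rewrite ge_min lexx.
rewrite -(@ramp_eq1 c (Num.max s (c + d))) ?le_max ?lexx ?orbT//.
by apply: ramp_homo; rewrite le_max lexx.
Qed.

(** The difference of two ramps is a smooth substitute for the indicator of [[c, c + h]], and its
    derivative is the difference of the mollifiers at the two end points. *)
Lemma ramp_sub_itv c h s : 0 <= h -> 0 <= ramp c s - ramp (c + h) s <= 1.
Proof.
move=> h0; have /andP[r0 r1] := ramp_itv c s; have /andP[q0 q1] := ramp_itv (c + h) s.
have : ramp (c + h) s <= ramp c s.
  have -> : ramp (c + h) s = ramp c (s - h) by rewrite /ramp; congr G; ring.
  by apply: ramp_homo; rewrite gerBl.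
by move=> ?; apply/andP; split; lra.
Qed.

Lemma ramp_sub_eq0 c h s : 0 <= h -> ~ c - d <= s <= c + h + d ->
  ramp c s - ramp (c + h) s = 0.
Proof.
move=> h0 H; have [s1|s1] := leP s (c - d).
  by rewrite !ramp_eq0 ?subrr//; lra.
have [s2|s2] := leP (c + h + d) s; first by rewrite !ramp_eq1 ?subrr//; lra.
by exfalso; apply: H; rewrite !ltW.
Qed.

Lemma measurable_Cinf (g : R -> R) : Cinf g -> measurable_fun setT g.
Proof. by move=> /Cinf_continuous; exact: continuous_measurable_fun. Qed.

Lemma integral_supported (g : R -> R) (x y : R) : (forall s, ~ x <= s <= y -> g s = 0) ->
  (\int[mu]_s (g s)%:E = \int[mu]_(s in `[x, y]) (g s)%:E)%E.
Proof.
move=> g0; rewrite [RHS]integral_mkcond; apply: eq_integral => s _; rewrite patchE.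
case: ifPn => //; rewrite notin_setE /= in_itv/= => /negP sxy.
by rewrite g0//; exact/negP.
Qed.

Lemma integral_mollifier c : (\int[mu]_s (mollifier c s)%:E = 1%:E)%E.
Proof.
rewrite (@integral_supported _ (c - d) (c + d)); last first.
  move=> s sc; apply: mollifier_eq0; rewrite leNgt ltr_norml; apply/negP => /andP[? ?].
  by apply: sc; apply/andP; split; lra.
rewrite (@continuous_FTC2 _ (mollifier c) (ramp c)).
- by rewrite ramp_eq1// ramp_eq0// sube0.
- by rewrite ltrBlDr -addrA ltrDl addr_gt0.
- by apply: continuous_subspaceT; exact/Cinf_continuous/Cinf_mollifier.
- split=> [s _||].
  + by have [] := is_derive_ramp c s.
  + by apply: cvg_at_right_filter; exact/Cinf_continuous/Cinf_ramp.
  + by apply: cvg_at_left_filter; exact/Cinf_continuous/Cinf_ramp.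
- by move=> s _; rewrite derive1E; have [_] := is_derive_ramp c s.
Qed.

Lemma integral_ramp_sub c h : 0 <= h ->
  (\int[mu]_s (ramp c s - ramp (c + h) s)%:E <= (h + 2 * d)%:E)%E.
Proof.
move=> h0; rewrite (@integral_supported _ (c - d) (c + h + d)); last first.
  by move=> s; exact: ramp_sub_eq0.
apply: (@le_trans _ _ (\int[mu]_(s in `[(c - d)%R, (c + h + d)%R]) (1 : R)%:E)%E).
  apply: ge0_le_integral_nomeas => s _; rewrite lee_fin;
    by have /andP[] := ramp_sub_itv c s h0.
rewrite integral_cst//= mul1e lebesgue_measure_itv/= lte_fin ifT; last first.
  have cd : c - d < c + h + d by move: d0 => ?; lra.
  exact: cd.
have E : c + h + d - (c - d) <= h + 2 * d by lra.
by rewrite -EFinB lee_fin; exact: E.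
Qed.

End mollifiers.

Section weak_derivative_bound.
Context {R : realType} {n : nat}.
Local Notation RT := (measurableTypeR R).
Local Notation V := ('rV[R]_n * R)%type.
Local Notation VT := (n.-tuple RT * RT)%type.
Local Notation mu := (@lebesgue_measure R).
Local Notation M := (@leb_st R n).

Lemma st_compact_box (a c : option 'I_n -> R) :
  compact [set z : V | forall o, a o <= stc o z <= c o].
Proof.
pose A (i : 'I_n) := `[a (Some i), c (Some i)]%classic.
have -> : [set z : V | forall o, a o <= stc o z <= c o] =
    [set v : 'rV[R]_n | forall i, A i (v ord0 i)] `*` `[a None, c None]%classic.
  apply/seteqP; split=> [z H|z [H1 H2] [i|]].
  - split=> [i|]; last by have := H None; rewrite /= in_itv.
    by have := H (Some i); rewrite /A /= in_itv.
  - by have := H1 i; rewrite /A /= in_itv.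
  - by move: H2; rewrite /= in_itv.
apply: compact_setX; last exact: segment_compact.
by apply: rV_compact => i; exact: segment_compact.
Qed.

Lemma st_smooth_test_fun (k : option 'I_n -> R -> R) (a c : option 'I_n -> R) (Q : set V) :
    (forall o, Cinf (k o)) -> (forall o s, ~ a o <= s <= c o -> k o s = 0) ->
    (forall z : V, (forall o, a o <= stc o z <= c o) -> Q z) ->
  test_fun Q (fun z : V => \prod_o k o (stc o z)).
Proof.
move=> Ck k0 BQ; have cB := @st_compact_box a c.
have sB : supp (fun z : V => \prod_o k o (stc o z)) `<=`
    [set z : V | forall o, a o <= stc o z <= c o].
  have /closure_id -> := compact_closed (@norm_hausdorff _ V) cB.
  apply: closure_subset => z /= nz o; apply/negPn/negP => H; move: nz; rewrite (bigD1 o)//= k0 ?mul0r ?eqxx//.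
  exact/negP.
split; first exact/st_smoothP/st_smooth_prod.
  exact: (subclosed_compact (@closed_closure _ _) cB sB).
by move=> z /sB /BQ.
Qed.

Section point_mass.
Variables (G b : R -> R) (Gb : smooth_step G b).

Definition st_mollifier (d : R) (p z : V) := \prod_o mollifier b d (stc o p) (stc o z).

Lemma st_mollifier_ge0 d p z : 0 < d -> 0 <= st_mollifier d p z.
Proof. by move=> d0; apply: prodr_ge0 => o _; exact: mollifier_ge0 Gb _ d0 _ _. Qed.

Lemma st_mollifier_eq0 d p z : 0 < d -> ~ ball p d z -> st_mollifier d p z = 0.
Proof.
move=> d0 pz; have [ o oz] : exists o, ~ `|stc o p - stc o z| < d.
  apply: contrapT => H; apply: pz; apply/(st_ball _ _ d0) => o.
  by apply: contrapT => oz; apply: H; exists o.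
rewrite /st_mollifier (bigD1 o)//= (mollifier_eq0 Gb) ?mul0r//.
by rewrite distrC leNgt; exact/negP.
Qed.

Lemma measurable_st_mollifier d p : 0 < d ->
  measurable_fun setT (fun z : VT => st_mollifier d p (pt_of z)).
Proof.
move=> d0; apply: (@measurable_st_prod _ _ (fun o => mollifier b d (stc o p))) => o.
by apply: measurable_Cinf; exact: Cinf_mollifier Gb _ _.
Qed.

Lemma integral_st_mollifier (Q : set V) d p : open Q -> 0 < d -> ball p d `<=` Q ->
  (\int[M]_(z in pt_of @^-1` Q) (st_mollifier d p (pt_of z))%:E = 1%:E)%E.
Proof.
move=> oQ d0 pQ; rewrite integral_mkcond.
rewrite -[RHS](_ : (\prod_(o : option 'I_n) (1 : R))%:E = _); last by rewrite big1.
rewrite -(@integral_leb_st_prod _ _ (fun o => mollifier b d (stc o p)) (fun=> 1)).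
- apply: eq_integral => z _; rewrite patchE; case: ifPn => //; rewrite notin_setE => Qz.
  by rewrite -/(st_mollifier d p (pt_of z)) st_mollifier_eq0// => /pQ.
- by move=> o; apply: measurable_Cinf; exact: Cinf_mollifier Gb _ _.
- by move=> o x; exact: mollifier_ge0 Gb _ d0 _ _.
- by move=> o; exact: integral_mollifier Gb _ d0 _.
Qed.

Lemma integrable_st_mollifier (Q : set V) d p : open Q -> 0 < d -> ball p d `<=` Q ->
  M.-integrable (pt_of @^-1` Q) (fun z => (st_mollifier d p (pt_of z))%:E).
Proof.
move=> oQ d0 pQ; apply/integrableP; split.
  apply/measurable_EFinP; apply: measurable_funTS; exact: measurable_st_mollifier.
under eq_integral => z _ do rewrite gee0_abs ?lee_fin ?st_mollifier_ge0//.
by rewrite integral_st_mollifier// ltry.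
Qed.

(** The test function [phi] is a difference of ramps in the direction [o] and a mollifier in every
    other one, so its derivative along [o] is the mollifier at [p] minus the mollifier at [q].
    Against [F] this gives [F p - F q] up to [2 e], while against [g] it gives at most [N] times the
    integral of [phi], which is at most [h + 2 d]. *)
Lemma weak_increment_le (Q : set V) (F g : V -> R) (N d e h : R) o (p : V) :
    let q := h *: stb o + p in
    open Q -> 0 < d -> 0 <= h ->
    (forall z, (forall o', stc o' p - d <= stc o' z <= stc o' q + d) -> Q z) ->
    measurable_on Q F -> weak_deriv Q (stb o) F g -> (Linf_norm Q g <= N%:E)%E ->
    (forall z, ball p d z -> `|F z - F p| <= e) ->
    (forall z, ball q d z -> `|F z - F q| <= e) ->
  `|F q - F p| <= N * (h + 2 * d) + 2 * e.
Proof.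
move=> q oQ d0 h0 BQ mF [mg wg] gN Fp Fq.
have stq o' : stc o' q = h * (o == o')%:R + stc o' p by exact: stcE.
have stpq o' : stc o' p <= stc o' q by rewrite stq lerDr mulr_ge0// ler0n.
have dB : stc o p - d <= stc o p + h + d by move: d0 h0 => ? ?; lra.
have pQ : ball p d `<=` Q.
  move=> z /(st_ball _ _ d0) H; apply: BQ => o'.
  have := H o'; have := stpq o'; rewrite ltr_norml => ? /andP[? ?].
  by apply/andP; split; lra.
have qQ : ball q d `<=` Q.
  move=> z /(st_ball _ _ d0) H; apply: BQ => o'.
  have := H o'; have := stpq o'; rewrite ltr_norml => ? /andP[? ?].
  by apply/andP; split; lra.
have N0 : 0 <= N by rewrite -lee_fin; exact: le_trans (Linf_norm_ge0 _ _) gN.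
have e0 : 0 <= e by apply: le_trans (Fp p _); [exact: normr_ge0|exact: ballxx].
pose D := (pt_of @^-1` Q : set VT).
have mD : measurable D by exact: measurable_st_open.
pose bp := st_mollifier d p; pose bq := st_mollifier d q.
pose k o' := if o' == o then fun s => ramp G d (stc o p) s - ramp G d (stc o p + h) s
  else mollifier b d (stc o' p).
pose phi (z : V) := \prod_o' k o' (stc o' z).
have Ck o' : Cinf (k o').
  rewrite /k; case: ifP => _; last exact: Cinf_mollifier Gb _ _.
  by apply: Cinf_sub; exact: Cinf_ramp Gb _ _.
have k0 o' s : 0 <= k o' s.
  rewrite /k; case: ifP => _; last exact: mollifier_ge0 Gb _ d0 _ _.
  by have /andP[] := ramp_sub_itv Gb d0 (stc o p) s h0.
have phi0 z : 0 <= phi z by apply: prodr_ge0.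
have tphi : test_fun Q phi.
  apply: (st_smooth_test_fun Ck _ BQ) => o' s; rewrite /k stq.
  case: eqVneq => [->|oo].
    rewrite mulr1 => H; apply: (ramp_sub_eq0 Gb d0 h0) => H'; apply: H.
    by rewrite (addrC h).
  rewrite mulr0 add0r => H; apply: (mollifier_eq0 Gb d0).
  rewrite leNgt ltr_norml; apply/negP => /andP[? ?]; apply: H.
  by apply/andP; split; lra.
have Dphi z : 'D_(stb o) phi z = bp z - bq z.
  pose P := \prod_(o' | o' != o) mollifier b d (stc o' p) (stc o' z).
  have -> : bp z = mollifier b d (stc o p) (stc o z) * P by rewrite /bp /st_mollifier (bigD1 o).
  have -> : bq z = mollifier b d (stc o p + h) (stc o z) * P.
    rewrite /bq /st_mollifier (bigD1 o)//= stq eqxx mulr1 (addrC h); congr (_ * _).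
    by apply: eq_bigr => o' oo; rewrite stq eq_sym (negbTE oo) mulr0 add0r.
  suff [_ //] : is_derive z (stb o) phi (mollifier b d (stc o p) (stc o z) * P -
      mollifier b d (stc o p + h) (stc o z) * P).
  apply/is_derive_lineP.
  rewrite (_ : (fun _ => _) = fun s => P * (ramp G d (stc o p) (1 * s + stc o z) -
      ramp G d (stc o p + h) (1 * s + stc o z))); last first.
    apply/funext => s; rewrite /phi (bigD1 o)//= /k eqxx stcE eqxx mulr1 mul1r mulrC.
    congr (_ * _); apply: eq_bigr => o' oo.
    by rewrite (negbTE oo) stcE eq_sym (negbTE oo) mulr0 add0r.
  rewrite -mulrBl mulrC; apply: is_derive_scalef; apply: is_derive_subf.
    rewrite -[X in is_derive _ _ _ X]mul1r; apply: is_derive_affine; rewrite mulr0 add0r.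
    exact: is_derive_ramp Gb _ _ _.
  rewrite -[X in is_derive _ _ _ X]mul1r; apply: is_derive_affine; rewrite mulr0 add0r.
  exact: is_derive_ramp Gb _ _ _.
have mphi : measurable_fun setT (fun z : VT => phi (pt_of z)).
  by apply: measurable_st_prod => o'; exact: measurable_Cinf.
have iphi : (\int[M]_z (phi (pt_of z))%:E <= (h + 2 * d)%:E)%E.
  have H := integral_ramp_sub Gb d0 (stc o p) h0.
  set J := integral _ _ _ in H.
  have J0 : (0 <= J)%E.
    by apply: integral_ge0 => s _; rewrite lee_fin; have /andP[] := ramp_sub_itv Gb d0 (stc o p) s h0.
  have JE : (fine J)%:E = J.
    by rewrite fineK// ge0_fin_numE//; exact: le_lt_trans H (ltry _).
  rewrite (@integral_leb_st_prod _ _ k (fun o' => if o' == o then fine J else 1))//.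
  - rewrite (bigD1 o)//= eqxx big1 ?mulr1; first by rewrite JE.
    by move=> o' /negbTE ->.
  - by move=> o'; exact: measurable_Cinf.
  - move=> o'; rewrite /k; case: ifP => _; first by rewrite JE.
    exact: integral_mollifier Gb _ d0 _.
have B1 : `|int_st Q (fun z => g z * phi z)| <= N * (h + 2 * d).
  apply: (@Rintegral_le _ _ _ _ _ _ (fun z => `|g (pt_of z) * phi (pt_of z)|)) => //.
  have mphiD : measurable_fun D (fun z : VT => phi (pt_of z)) by exact: measurable_funTS.
  apply: (@le_trans _ _ (\int[M]_(z in D) (N * phi (pt_of z))%:E)%E).
    apply: ae_ge0_le_integral => //.
    - apply/measurable_EFinP; apply: measurableT_comp => //.
      exact: measurable_funM.
    - by move=> z _; rewrite lee_fin mulr_ge0.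
    - by apply/measurable_EFinP; exact: measurable_funM.
    - have [A [mA A0 AH]] : {ae M, forall z, Q (pt_of z) -> `|g (pt_of z)| <= N}.
        by apply: Linf_norm_ae => //; exists p; exact/pQ/ballxx.
      exists A; split=> // z /= Hz; apply: AH => /= Hg; apply: Hz => Dz.
      by rewrite lee_fin normrM (ger0_norm (phi0 _)) ler_wpM2r// Hg.
  under eq_integral do rewrite EFinM.
  have mphiE : measurable_fun D (fun z : VT => (phi (pt_of z))%:E) by apply/measurable_EFinP.
  rewrite (ge0_integralZl _ mD mphiE); last 2 first.
  - by move=> z _; rewrite lee_fin.
  - by rewrite lee_fin.
  rewrite EFinM lee_wpmul2l// ?lee_fin//; apply: le_trans iphi.
  apply: ge0_subset_integral => //.
    exact/measurable_EFinP.
  by move=> z _; rewrite lee_fin.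
(* [W] is the integrand of the weak formulation; [U] freezes [F] at the two centres, and its
   integral is exactly [F p - F q]. *)
pose W z := F z * (bp z - bq z); pose U z := F p * bp z - F q * bq z.
have ibp := integrable_st_mollifier oQ d0 pQ; have ibq := integrable_st_mollifier oQ d0 qQ.
rewrite -/bp in ibp; rewrite -/bq in ibq.
have Ibp := integral_st_mollifier oQ d0 pQ; have Ibq := integral_st_mollifier oQ d0 qQ.
rewrite -/bp in Ibp; rewrite -/bq in Ibq.
have bp0 z : 0 <= bp z by exact: st_mollifier_ge0.
have bq0 z : 0 <= bq z by exact: st_mollifier_ge0.
have cZ (f : V -> R) c : M.-integrable D (fun z => (f (pt_of z))%:E) ->
    M.-integrable D (fun z => (c * f (pt_of z))%:E).
  by move=> fi; have := integrableZl mD c fi; exact.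
have cD (f f' : V -> R) : M.-integrable D (fun z => (f (pt_of z))%:E) ->
    M.-integrable D (fun z => (f' (pt_of z))%:E) ->
    M.-integrable D (fun z => (f (pt_of z) + f' (pt_of z))%:E).
  by move=> fi fi'; have := integrableD mD fi fi'; exact.
have iU : M.-integrable D (fun z => (U (pt_of z))%:E).
  rewrite (_ : (fun _ => _) = fun z => (F p * bp (pt_of z) + - F q * bq (pt_of z))%:E).
    by apply: (cD (fun z => F p * bp z) (fun z => - F q * bq z)); exact: cZ.
  by apply/funext => z; rewrite mulNr.
have WU z : `|W z - U z| <= e * bp z + e * bq z.
  rewrite (_ : W z - U z = (F z - F p) * bp z - (F z - F q) * bq z); last by rewrite /W /U; ring.
  apply: le_trans (ler_normB _ _) _; rewrite !normrM (ger0_norm (bp0 z)) (ger0_norm (bq0 z)).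
  apply: lerD.
    have [/Fp H|H] := pselect (ball p d z); first by rewrite ler_wpM2r.
    by rewrite /bp st_mollifier_eq0// !mulr0.
  have [/Fq H|H] := pselect (ball q d z); first by rewrite ler_wpM2r.
  by rewrite /bq st_mollifier_eq0// !mulr0.
have iWB : M.-integrable D (fun z => ((`|F p| + e) * bp (pt_of z) + (`|F q| + e) * bq (pt_of z))%:E).
  by apply: (cD (fun z => (`|F p| + e) * bp z) (fun z => (`|F q| + e) * bq z)); exact: cZ.
have mb f : (exists x, f = st_mollifier d x) -> measurable_fun D (fun z => f (pt_of z)).
  by move=> [x ->]; apply: measurable_funTS; exact: measurable_st_mollifier.
have iW : M.-integrable D (fun z => (W (pt_of z))%:E).
  apply: (le_integrable mD _ _ iWB).
    apply/measurable_EFinP; apply: measurable_funM => //.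
    by apply: measurable_funB; apply: mb; [exists p|exists q].
  move=> z Dz; rewrite !abse_EFin lee_fin.
  apply: le_trans (ler_norm _); set y := pt_of z.
  have H := WU y.
  have T : `|W y| <= `|W y - U y| + `|U y| by rewrite -{1}(subrK (U y) (W y)) ler_normD.
  have HU : `|U y| <= `|F p| * bp y + `|F q| * bq y.
    apply: le_trans (ler_normB _ _) _; rewrite !normrM (ger0_norm (bp0 y)) (ger0_norm (bq0 y))//.
  by rewrite !mulrDl; lra.
have IU : int_st Q U = F p - F q.
  rewrite /int_st RintegralB//; [|exact: cZ|exact: cZ].
  rewrite !RintegralZl//; rewrite /Rintegral Ibp Ibq/=.
  by rewrite !mulr1.
have B2 : `|int_st Q W - (F p - F q)| <= 2 * e.
  rewrite -IU /int_st -RintegralB//.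
  apply: (@Rintegral_le _ _ _ _ _ _ (fun z => e * bp (pt_of z) + e * bq (pt_of z))) => //.
  rewrite (_ : (\int[_]_(_ in _) _)%E = (e * 1 + e * 1)%:E); first by rewrite lee_fin; lra.
  under eq_integral do rewrite EFinD !EFinM.
  rewrite integralD//; [|exact: cZ|exact: cZ].
  by rewrite !integralZl// Ibp Ibq.
have WE : int_st Q W = - int_st Q (fun z => g z * phi z).
  rewrite -wg//; congr (int_st Q _); apply/funext => z; by rewrite Dphi.
move: B1 B2; rewrite WE !ler_norml => /andP[? ?] /andP[? ?].
by apply/andP; split; lra.
Qed.

Lemma weak_lipschitz_pos (Q : set V) (F g : V -> R) (N h r : R) o (p : V) :
    let q := h *: stb o + p in
    open Q -> 0 < r -> 0 <= h ->
    (forall z, (forall o', stc o' p - r <= stc o' z <= stc o' q + r) -> Q z) ->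
    measurable_on Q F -> weak_deriv Q (stb o) F g -> (Linf_norm Q g <= N%:E)%E ->
    {for p, continuous F} -> {for q, continuous F} ->
  `|F q - F p| <= N * h.
Proof.
move=> q oQ r0 h0 BQ mF wg gN cp cq.
have N0 : 0 <= N by rewrite -lee_fin; exact: le_trans (Linf_norm_ge0 _ _) gN.
apply/ler_addgt0Pr => e e0; have e4 : 0 < e / 4 by rewrite divr_gt0.
have [dp /= dp0 Hp] : nbhs_ball p [set z | `|F z - F p| <= e / 4].
  apply/nbhs_ballP; near=> z; rewrite /= distrC; near: z.
  by apply: (@cvgr_dist_le _ _ _ _ (nbhs_filter p) _ _ cp).
have [dq /= dq0 Hq] : nbhs_ball q [set z | `|F z - F q| <= e / 4].
  apply/nbhs_ballP; near=> z; rewrite /= distrC; near: z.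
  by apply: (@cvgr_dist_le _ _ _ _ (nbhs_filter q) _ _ cq).
(* The last bound makes the term [2 N d] at most [e / 2]; the oscillation of [F] near [p] and [q]
   costs the other [e / 2]. *)
pose d := Num.min (Num.min dp dq) (Num.min r (e / (4 * (N + 1)))).
have N1 : 0 < 4 * (N + 1) by rewrite mulr_gt0// ltr_wpDl.
have d0 : 0 < d by rewrite !lt_min dp0 dq0 r0 divr_gt0.
have ddp : d <= dp by rewrite !ge_min lexx.
have ddq : d <= dq by rewrite !ge_min lexx orbT.
have dr : d <= r by rewrite !ge_min lexx !orbT.
have de : d <= e / (4 * (N + 1)) by rewrite !ge_min lexx !orbT.
have H := @weak_increment_le Q F g N d (e / 4) h o p oQ d0 h0.
apply: le_trans (H _ mF wg gN _ _) _.
- move=> z Hz; apply: BQ => o'; have := Hz o'; rewrite -/q => /andP[? ?].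
  by apply/andP; split; lra.
- by move=> z pz; apply: Hp; exact: le_ball pz.
- by move=> z qz; apply: Hq; exact: le_ball qz.
have : N * d <= e / 4.
  apply: le_trans (ler_wpM2l N0 de) _.
  rewrite mulrA ler_pdivrMr//; nra.
by move=> ?; lra.
Unshelve. all: by end_near. Qed.

Lemma weak_lipschitz (Q : set V) (F g : V -> R) (N h r : R) o (p q : V) :
    q = h *: stb o + p -> open Q -> 0 < r ->
    (forall z, (forall o', Num.min (stc o' p) (stc o' q) - r <= stc o' z
       <= Num.max (stc o' p) (stc o' q) + r) -> Q z) ->
    measurable_on Q F -> weak_deriv Q (stb o) F g -> (Linf_norm Q g <= N%:E)%E ->
    {for p, continuous F} -> {for q, continuous F} ->
  `|F q - F p| <= N * `|h|.
Proof.
move=> qE oQ r0 BQ mF wg gN cp cq.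
have [h0|h0] := leP 0 h.
  rewrite (ger0_norm h0) qE; apply: (@weak_lipschitz_pos Q F g N h r) => //; rewrite -?qE//.
  move=> z Hz; apply: BQ => o'; have /andP[z1 z2] := Hz o'; apply/andP; split.
    by apply: le_trans z1; rewrite lerD2r ge_min lexx.
  by apply: le_trans z2 _; rewrite lerD2r le_max lexx orbT.
have pE : p = (- h) *: stb o + q by rewrite qE scaleNr addKr.
rewrite (ltr0_norm h0) distrC {1}pE; apply: (@weak_lipschitz_pos Q F g N (- h) r) => //.
- by rewrite oppr_ge0 ltW.
- rewrite -pE => z Hz; apply: BQ => o'; have /andP[z1 z2] := Hz o'; apply/andP; split.
    by apply: le_trans z1; rewrite lerD2r ge_min lexx orbT.
  by apply: le_trans z2 _; rewrite lerD2r le_max lexx.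
- by rewrite -pE.
Qed.

End point_mass.
End weak_derivative_bound.

(** * The operator on the whole space *)

Section cutoff_functions.
Context {R : realType} {n : nat}.
Implicit Types (psi : 'rV[R]_n -> R) (V : set 'rV[R]_n) (x y v : 'rV[R]_n).

Lemma coord_le_norm x i : `|x 0 i| <= `|x|.
Proof. by rewrite [X in _ <= X]mx_normrE (le_bigmax _ _ (0, i)). Qed.

Lemma norm_le_sqrt_sqnorm x : `|x| <= Num.sqrt (sqnorm x).
Proof.
by rewrite -(ler_pXn2r (ltn0Sn 1)) ?nnegrE ?sqrtr_ge0// sqr_sqrtr ?sqnorm_ge0// norm_le_sqnorm.
Qed.

Lemma compact_norm_le {W : normedModType R} (A : set W) : compact A ->
  exists2 M : R, 0 < M & forall z, A z -> `|z| <= M.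
Proof.
move=> /compact_bounded bA.
by have [M M0 H] := pinfty_ex_gt (@real0 R) bA; exists M.
Qed.

Lemma supp_eq0 psi x : ~ supp psi x -> psi x = 0.
Proof.
move=> H; apply/eqP/negPn/negP => p0; apply: H; exact: subset_closure.
Qed.

Lemma test_fun_smooth_step V psi x0 : (0 < n)%N -> test_fun V psi ->
  (forall x, 0 <= psi x) -> 0 < psi x0 -> exists G b, @smooth_step R G b.
Proof.
move=> n0 [sp cp _] p0 px0; pose i := Ordinal n0; pose e : 'rV[R]_n := ebasis i.
have [M M0 HM] := compact_norm_le cp.
apply: (@exists_smooth_step _ (fun s => psi (s *: e + x0)) (M + `|x0 0 i| + 1)) => //.
- by rewrite ltr_pwDr// addr_ge0// ltW.
- exists (fun k s => foldr (fun v g => fun y => 'D_v g y) psi (nseq k e) (s *: e + x0)).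
  split=> // k s; apply: is_derive_line; split => //.
  by apply: diff_derivable; exact: sp.
- by rewrite scale0r add0r.
- move=> s Hs; apply: supp_eq0 => /HM Hn.
  have := le_trans (coord_le_norm _ i) Hn; rewrite !mxE !eqxx mulr1 => H.
  have : `|s| <= `|s + x0 0 i| + `|x0 0 i| by rewrite -{1}(addrK (x0 0 i) s) ler_normB.
  by move=> ?; lra.
Qed.

(** The derivative is bounded on the compact support by continuity, and vanishes off it because the
    function is locally zero there. *)
Lemma test_fun_derive V psi k : test_fun V psi ->
  [/\ continuous (fun x => 'D_(ebasis k) psi x),
      forall x, is_derive x (ebasis k) psi ('D_(ebasis k) psi x) &
      exists2 M : R, 0 <= M & forall x, `|'D_(ebasis k) psi x| <= M].
Proof.
move=> [sp cp _].
have cD : continuous (fun x => 'D_(ebasis k) psi x).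
  by move=> x; apply: differentiable_continuous; exact: (sp [:: ebasis k]).
split=> //; first by move=> x; split => //; apply: diff_derivable; exact: (sp [::]).
have : compact [set 'D_(ebasis k) psi x | x in supp psi].
  by apply: continuous_compact => //; exact: continuous_subspaceT.
move=> /compact_norm_le[M M0 HM]; exists M; first exact: ltW.
move=> x; have [sx|sx] := pselect (supp psi x); first by apply: HM; exists x.
suff [_ ->] : is_derive x (ebasis k) psi 0 by rewrite normr0 ltW.
have nsx : \forall y \near x, ~ supp psi y.
  by apply: open_nbhs_nbhs; split => //; apply: closed_openC; exact: closed_closure.
apply/is_derive_cvg; apply: cvg_near_cst.
have nh : \forall h \near (0 : R)^', ~ supp psi (h *: ebasis k + x).
  apply: nbhs_dnbhs; have cf : {for (0 : R), continuous (fun h : R => h *: (ebasis k : 'rV[R]_n) + x)}.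
    by move=> ?; apply: cvgD; [exact: scalel_continuous|exact: cvg_cst].
  have : nbhs ((0 : R) *: (ebasis k : 'rV[R]_n) + x) (fun y => ~ supp psi y) by rewrite scale0r add0r.
  by move=> /cf.
by apply: filterS nh => h nh; rewrite !supp_eq0// subrr mulr0.
Qed.

Lemma test_fun_lipschitz V psi : test_fun V psi ->
  exists2 M : R, 0 <= M & forall x y, `|psi x - psi y| <= M * Num.sqrt (sqnorm (x - y)).
Proof.
move=> tp; have /choice[M HM] k : exists M : R, 0 <= M /\ forall x, `|'D_(ebasis k) psi x| <= M.
  by have [_ _ [M M0 H]] := test_fun_derive k tp; exists M.
exists (\sum_k M k); first by apply: sumr_ge0 => k _; have [] := HM k.
move=> x y; pose f s := psi (s *: (x - y) + y).
pose df s := \sum_k (x - y) 0 k * 'D_(ebasis k) psi (s *: (x - y) + y).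
have fD s : is_derive s (1 : R) f (df s).
  apply: is_derive_line; apply: (@is_derive_partials _ _ _ (fun k x => 'D_(ebasis k) psi x)) => k.
    by move=> z; have [_ + _] := test_fun_derive k tp; exact.
  by have [+ _ _] := test_fun_derive k tp; exact.
have := @MVT_bound _ f df 1 0 ((\sum_k M k) * Num.sqrt (sqnorm (x - y))) (fun s _ => fD s).
rewrite /f scale1r subrK scale0r add0r mul0r subr0 normr1 mulr1; apply => s _.
rewrite subr0 mulr_suml; apply: le_trans (ler_norm_sum _ _ _) _; apply: ler_sum => k _.
by rewrite normrM mulrC ler_pM//; [have [] := HM k|exact: ler_absn].
Qed.

Lemma compact_neighborhood V (K : set 'rV[R]_n) : open V -> compact K -> K `<=` V ->
  exists2 rho : R, 0 < rho & forall x y, K x -> `|x - y| < rho -> V y.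
Proof.
move=> oV /compact_near_coveringP cK KV.
have : \forall r \near (0 : R)^'+, K `<=` (fun x => ball x r `<=` V).
  apply: cK => x Kx.
  have [r /= r0 rV] : nbhs_ball x V by apply/nbhs_ballP/open_nbhs_nbhs; split => //; exact: KV.
  have r2 : 0 < r / 2 by rewrite divr_gt0.
  exists (ball x (r / 2), [set s | s < r / 2]) => /=.
    by split; [exact: nbhsx_ballx|exact: nbhs_right_lt].
  move=> [y s] [/= xy sr] z yz; apply: rV; rewrite [r]splitr.
  by apply: ball_triangle xy _; apply: le_ball yz; exact: ltW.
move=> H; near (0 : R)^'+ => r; exists r => // x y Kx xy.
have : K `<=` (fun x => ball x r `<=` V) by near: r.
by move=> /(_ x Kx) /(_ y); apply; rewrite -ball_normE.
Unshelve. all: by end_near. Qed.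

End cutoff_functions.

(** * Lipschitz bounds in a cylinder *)

Section cylinder_lipschitz.
Context {R : realType} {n : nat}.
Local Notation V := ('rV[R]_n * R)%type.
Variables (G b : R -> R) (Gb : smooth_step G b).
Variables (U : set 'rV[R]_n) (t0 t1 : R) (oU : open U).
Let Q : set V := U `*` `]t0, t1[.

Lemma open_cylinder : open Q.
Proof.
rewrite (_ : Q = fst @^-1` U `&` snd @^-1` `]t0, t1[%classic)//.
apply: openI; first by apply: open_comp => // z _; exact: cvg_fst.
by apply: open_comp => [z _|]; [exact: cvg_snd|exact: itv_open].
Qed.

Variables (F : V -> R) (N : R).
Hypothesis mF : measurable_on Q F.
Hypothesis wF : forall o, exists2 g, weak_deriv Q (stb o) F g & (Linf_norm Q g <= N%:E)%E.
Hypothesis cF : forall x t, U x -> t0 < t < t1 -> {for (x, t), continuous F}.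

Lemma spatial_lipschitz (x y : 'rV[R]_n) t (rho : R) : t0 < t < t1 ->
    (forall z, `|x - z| < rho -> U z) -> `|x - y| < rho ->
  `|F (y, t) - F (x, t)| <= N * \sum_j `|y 0 j - x 0 j|.
Proof.
move=> /andP[tt0 tt1] xU xy.
(* The path from [x] to [y] changes one coordinate at a time. In the sup norm it never leaves the
   ball of radius [|x - y|] about [x], hence stays in [U]; [r] is half of the remaining margin in
   space and time. *)
pose z k : 'rV[R]_n := \row_(j < n) (if (j < k)%N then y 0 j else x 0 j).
have z0 : z 0%N = x by apply/rowP => j; rewrite mxE.
have zn : z n = y by apply/rowP => j; rewrite mxE ltn_ord.
pose r := Num.min (rho - `|x - y|) (Num.min (t - t0) (t1 - t)) / 2.
have r0 : 0 < r by rewrite divr_gt0// !lt_min !subr_gt0 xy tt0 tt1.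
have /and3P[q1 q2 q3] : [&& r * 2 <= rho - `|x - y|, r * 2 <= t - t0 & r * 2 <= t1 - t].
  by rewrite -!le_min /r divfK.
have zx k j : `|x 0 j - z k 0 j| <= `|x - y|.
  rewrite mxE; case: ifP => _; last by rewrite subrr normr0.
  by have := coord_le_norm (x - y) j; rewrite !mxE.
have inU (w : 'rV[R]_n) : (forall j, `|x 0 j - w 0 j| <= `|x - y| + r) -> U w.
  move=> H; apply: xU; apply: (@le_lt_trans _ _ (`|x - y| + r)); last by lra.
  rewrite [X in X <= _]mx_normrE; apply: bigmax_le => [|[a j] _].
    by rewrite addr_ge0// ltW.
  by rewrite /= (ord1 a) !mxE; exact: H.
have Uz k : U (z k).
  by apply: inU => j; apply: le_trans (zx k j) _; rewrite lerDl ltW.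
rewrite -{1}zn -{1}z0 -(telescope_sumr (fun k => F (z k, t)))// big_mkord mulr_sumr.
apply: le_trans (ler_norm_sum _ _ _) _; apply: ler_sum => i _.
have [g wg gN] := wF (Some i).
apply: (@weak_lipschitz _ _ _ _ Gb Q F g N _ r (Some i) (z i, t) (z i.+1, t)) => //.
- congr pair; last by rewrite /= scaler0 add0r.
  apply/rowP => j; rewrite !mxE /= ltnS leq_eqVlt.
  have [->|ij] := eqVneq j i; first by rewrite ltnn orbF eqxx mulr1 subrK.
  by rewrite (negbTE (ij : (j != i :> nat))) mulr0 add0r.
- exact: open_cylinder.
- move=> w Hw; split.
    apply: inU => j; have := Hw (Some j) => /= /andP[w1 w2].
    have h1 := zx i j; have h2 := zx i.+1 j.
    move: w1 w2 h1 h2; move: (z i 0 j) (z i.+1 0 j) => p q.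
    rewrite !ler_norml lerBlDr => w1 w2 /andP[? ?] /andP[? ?].
    by move: w1 w2; rewrite minElt maxElt; case: ifP => _ ? ?; apply/andP; split; lra.
  have := Hw None; rewrite /= minxx maxxx in_itv/= => /andP[? ?].
  by apply/andP; split; lra.
- by apply: cF => //; rewrite tt0 tt1.
- by apply: cF => //; rewrite tt0 tt1.
Qed.

Lemma time_lipschitz x t s : U x -> t0 < t < t1 -> t0 < s < t1 ->
  `|F (x, t) - F (x, s)| <= N * `|t - s|.
Proof.
move=> Ux /andP[tt0 tt1] /andP[ss0 ss1].
have [rho /= rho0 rhoU] : nbhs_ball x U by apply/nbhs_ballP/open_nbhs_nbhs.
pose r := Num.min rho (Num.min (Num.min (t - t0) (t1 - t)) (Num.min (s - t0) (t1 - s))) / 2.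
have r0 : 0 < r by rewrite divr_gt0// !lt_min !subr_gt0 rho0 tt0 tt1 ss0 ss1.
have /and5P[q1 q2 q3 q4 q5] : [&& r * 2 <= rho, r * 2 <= t - t0, r * 2 <= t1 - t,
    r * 2 <= s - t0 & r * 2 <= t1 - s].
  by have := lexx (r * 2); rewrite {2}/r divfK// !le_min -!andbA.
have [g wg gN] := wF None.
apply: (@weak_lipschitz _ _ _ _ Gb Q F g N _ r None (x, s) (x, t)) => //.
- congr pair; first by rewrite /= scaler0 add0r.
  by rewrite /= /GRing.scale/= mulr1 subrK.
- exact: open_cylinder.
- move=> w Hw; split.
    apply: rhoU; rewrite -ball_normE /=; apply: (@le_lt_trans _ _ r); last by lra.
    rewrite [X in X <= _]mx_normrE; apply: bigmax_le => [|[a j] _]; first exact: ltW.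
    rewrite /= (ord1 a) !mxE; have := Hw (Some j); rewrite /= minxx maxxx => /andP[? ?].
    by rewrite ler_norml; apply/andP; split; lra.
  have := Hw None; rewrite /= in_itv/= minElt maxElt; case: ifP => _ /andP[? ?];
    by apply/andP; split; lra.
- by apply: cF => //; rewrite ss0 ss1.
- by apply: cF => //; rewrite tt0 tt1.
Qed.

End cylinder_lipschitz.

Section cylinder_continuity.
Context {R : realType} {n : nat}.
Implicit Types (U : set 'rV[R]_n) (x : 'rV[R]_n).

(** Joint continuity, from continuity in space at the fixed time [t] and continuity in time that is
    uniform over [U]. It allows [Linf_norm_bound] to be applied to the lower-order coefficients. *)
Lemma CtC1_continuous U (t0 t1 : R) (f : 'rV[R]_n -> R -> R) x t :
  open U -> CtC1 t0 t1 U f -> U x -> t0 < t < t1 ->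
  {for (x, t), continuous (fun p : 'rV[R]_n * R => f p.1 p.2)}.
Proof.
move=> oU [fc fu] Ux /andP[tt0 tt1]; have t01 : t0 <= t <= t1 by rewrite !ltW.
have [fct _] := fc t t01.
have cx : {for x, continuous (f^~ t)}.
  have := continuous_subspaceW (@subset_closure _ U) fct.
  by rewrite continuous_open_subspace// => /(_ x); apply; exact/mem_set.
apply/cvgrPdist_le => e e0 /=; have e2 : 0 < e / 2 by rewrite divr_gt0.
have : \forall s \near t, t0 <= s <= t1 ->
    forall y, U y -> `|f y s - f y t| <= e / 2.
  have := fu t t01 (e / 2) e2; rewrite near_withinE; apply: filterS => s H ts y Uy.
  by have [] := H _ y Uy; first by rewrite /= in_itv.
have n1 (P : set 'rV[R]_n) : nbhs x P -> \forall p \near (x, t), P p.1.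
  by move=> xP; apply: (@cvg_fst _ _ (nbhs x) (nbhs t) _ P).
have n2 (P : set R) : nbhs t P -> \forall p \near (x, t), P p.2.
  by move=> tP; apply: (@cvg_snd _ _ (nbhs x) (nbhs t) _ P).
move=> Hs.
have A1 : \forall p \near (x, t), `|f x t - f p.1 t| <= e / 2.
  apply: (n1 (fun y => `|f x t - f y t| <= e / 2)).
  exact: (@cvgr_dist_le _ _ _ _ (nbhs_filter x) _ _ cx).
have A2 : \forall p \near (x, t), U p.1 by apply: (n1 U); exact: open_nbhs_nbhs.
have A3 : \forall p \near (x, t), p.2 \in `]t0, t1[.
  apply: (n2 (fun s => s \in `]t0, t1[)).
  by apply: open_nbhs_nbhs; split; [exact: itv_open|rewrite /= in_itv/= tt0 tt1].
apply: filterS (filterI (filterI A1 A2) (filterI A3 (n2 _ Hs))) => p [[H1 Up] [H2 H3]].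
have -> : f x t - f p.1 p.2 = (f x t - f p.1 t) - (f p.1 p.2 - f p.1 t) by ring.
apply: le_trans (ler_normB _ _) _; rewrite [e]splitr; apply: lerD => //; apply: H3 => //.
by move: H2; rewrite in_itv/= => /andP[? ?]; rewrite !ltW.
Qed.

End cylinder_continuity.

(** * Regularity of the extended operator *)

Section whole_space_regularity.
Context {R : realType} {n : nat}.
Implicit Types (U : set 'rV[R]_n) (psi : 'rV[R]_n -> R) (L : coeffs R n).

Lemma W1inf_norm_ge0 (Q : set ('rV[R]_n * R)) F : (0 <= W1inf_norm Q F)%E.
Proof.
apply: le_ereal_inf_tmp => _ [df [dtf [_ _ _ ->]]].
by rewrite !adde_ge0// ?Linf_norm_ge0// sume_ge0// => i _; exact: Linf_norm_ge0.
Qed.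

Lemma admissible_norms U (t0 t1 lam K : R) L i j k : admissible U t0 t1 lam K L ->
  let Q := (U `*` `]t0, t1[) in
  [/\ (W1inf_norm Q (fun p => ca L p.1 p.2 i j) <= K%:E)%E,
      (Linf_norm Q (fun p => cb L p.1 p.2 0%R k) <= K%:E)%E &
      (Linf_norm Q (fun p => cc L p.1 p.2) <= K%:E)%E].
Proof.
move=> [_ _ _ /(_ i j k) HK] Q.
have W0 := W1inf_norm_ge0 Q (fun p => ca L p.1 p.2 i j).
have B0 := Linf_norm_ge0 Q (fun p => cb L p.1 p.2 0 k).
have C0 := Linf_norm_ge0 Q (fun p => cc L p.1 p.2).
split; apply: le_trans HK.
- by rewrite -addeA leeDl// adde_ge0.
- by rewrite addeAC leeDr// adde_ge0.
- by rewrite leeDr// adde_ge0.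
Qed.

Lemma quad_whole_space (lam p : R) (M : 'M[R]_n) v :
  quad (p *: M + (lam * (1 - p))%:M) v = p * quad M v + (1 - p) * (lam * sqnorm v).
Proof.
rewrite !quadE sqnormE mulmxDr mul_mx_scalar -scalemxAr mulmxDl -!scalemxAl.
have mxDZ (c e : R) (A B : 'M[R]_1) : (c *: A + e *: B) 0 0 = c * A 0 0 + e * B 0 0 by rewrite !mxE.
by rewrite mxDZ; ring.
Qed.

(* Where [psi] vanishes the products vanish although [a] is not controlled;
   two points at distance at least [rho] need no regularity of [a] at all. *)
Lemma cutoff_product_lipschitz (psi : 'rV[R]_n -> R) U (a : 'rV[R]_n -> R -> R)
    (Mp N rho t0 t1 : R) :
    0 < rho -> 0 <= Mp -> 0 <= N ->
    (forall x, 0 <= psi x <= 1) -> supp psi `<=` U ->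
    (forall x y, `|psi x - psi y| <= Mp * Num.sqrt (sqnorm (x - y))) ->
    (forall x y, supp psi x -> `|x - y| < rho -> U y) ->
    (forall x t, U x -> t0 < t < t1 -> `|a x t| <= N) ->
    (forall x y t, supp psi x -> `|x - y| < rho -> t0 < t < t1 ->
       `|a y t - a x t| <= N * \sum_j `|y 0 j - x 0 j|) ->
    (forall x t s, U x -> t0 < t < t1 -> t0 < s < t1 -> `|a x t - a x s| <= N * `|t - s|) ->
  forall x y t s, t0 < t < t1 -> t0 < s < t1 ->
    `|psi x * a x t - psi y * a y s| <=
    (Mp * N + N * n%:R + N + 2 * N / rho) * (Num.sqrt (sqnorm (x - y)) + `|t - s|).
Proof.
move=> r0 Mp0 N0 p01 sU pL rU aN aS aT.
(* The claim is symmetric in the two points and trivial when both are off the support, so one of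
   them may be taken in it. *)
have half x y t s : supp psi x -> t0 < t < t1 -> t0 < s < t1 ->
    `|psi x * a x t - psi y * a y s| <=
    (Mp * N + N * n%:R + N + 2 * N / rho) * (Num.sqrt (sqnorm (x - y)) + `|t - s|).
  move=> sx tt ss; have Ux := sU _ sx.
  have D0 : 0 <= Num.sqrt (sqnorm (x - y)) by exact: sqrtr_ge0.
  have T0 : 0 <= `|t - s| by exact: normr_ge0.
  have DD := norm_le_sqrt_sqnorm (x - y); have pD := pL x y.
  have SD : \sum_j `|y 0 j - x 0 j| <= n%:R * Num.sqrt (sqnorm (x - y)).
    rewrite mulr_natl -[n in _ *+ n]card_ord -sumr_const; apply: ler_sum => j _.
    by have := ler_absn (x - y) j; rewrite !mxE distrC.
  have /andP[px0 px1] := p01 x; have /andP[py0 py1] := p01 y.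
  have c1 : 0 <= Mp * N by exact: mulr_ge0.
  have c2 : 0 <= N * n%:R by rewrite mulr_ge0.
  have c4 : 0 <= 2 * N / rho by rewrite divr_ge0 ?mulr_ge0// ltW.
  have [xy|xy] := ltP `|x - y| rho.
    have Uy := rU _ _ sx xy.
    (* Every value of [a] is taken at [x] or [y], both in [U], and the spatial increment is taken at
       the single time [t]. *)
    have -> : psi x * a x t - psi y * a y s =
        (psi x - psi y) * a y s + psi x * (- (a y t - a x t) + (a y t - a y s)) by ring.
    apply: (@le_trans _ _ (Mp * N * Num.sqrt (sqnorm (x - y)) +
        (N * n%:R * Num.sqrt (sqnorm (x - y)) + N * `|t - s|))).
      apply: le_trans (ler_normD _ _) _; rewrite !normrM; apply: lerD.
        rewrite mulrAC; exact: ler_pM (pL x y) (aN y s Uy ss).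
      rewrite (ger0_norm px0) -[leRHS]mul1r; apply: ler_pM => //.
      apply: le_trans (ler_normD _ _) _; rewrite normrN; apply: lerD; last exact: aT.
      apply: le_trans (aS x y t sx xy tt) _; rewrite -mulrA; exact: ler_wpM2l.
    move: (Mp * N) (N * n%:R) (2 * N / rho) (Num.sqrt _) `|t - s| c1 c2 c4 D0 T0 {DD pD SD} =>
      e1 e2 e4 D S h1 h2 h4 hD hS.
    have := mulr_ge0 h1 hS; have := mulr_ge0 h2 hS; have := mulr_ge0 N0 hD.
    have := mulr_ge0 h4 (addr_ge0 hD hS); nra.
  apply: (@le_trans _ _ (N + N)).
    apply: le_trans (ler_normB _ _) _; rewrite !normrM; apply: lerD.
      by rewrite (ger0_norm px0) -[leRHS]mul1r; apply: ler_pM => //; exact: aN.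
    have [sy|/supp_eq0 ->] := pselect (supp psi y); last by rewrite normr0 mul0r.
    by rewrite (ger0_norm py0) -[leRHS]mul1r; apply: ler_pM => //; apply: aN => //; exact: sU.
  have H : N + N <= 2 * N / rho * Num.sqrt (sqnorm (x - y)).
    rewrite -mulrA mulrC mulrA -mulrA -[leLHS](_ : 1 * (2 * N) = _); last by ring.
    rewrite [leRHS](_ : _ = (rho^-1 * Num.sqrt (sqnorm (x - y))) * (2 * N)); last by ring.
    apply: ler_wpM2r; first by rewrite mulr_ge0.
    by rewrite mulrC ler_pdivlMr// mul1r; exact: le_trans xy DD.
  apply: le_trans H _; apply: ler_pM => //; last by rewrite lerDl.
  by rewrite lerDr !addr_ge0.
move=> x y t s tt ss.
have [sx|sx] := pselect (supp psi x); first exact: half.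
have [sy|sy] := pselect (supp psi y).
  by rewrite distrC -sqnormN opprB (distrC t); exact: half.
rewrite (supp_eq0 sx) (supp_eq0 sy) !mul0r subrr normr0 mulr_ge0//.
  by rewrite !addr_ge0 ?mulr_ge0 ?invr_ge0 ?ler0n// ltW.
Qed.

Lemma regular_whole_space U psi (lam K : R) :
    (0 < n)%N -> open U -> test_fun U psi -> (forall x, 0 <= psi x <= 1) ->
    (exists x, 0 < psi x) -> 0 < lam ->
  exists2 Lam : R, 0 < Lam & forall t0 t1 L, admissible U t0 t1 lam K L ->
    regular lam Lam t0 t1 (whole_space lam psi L).
Proof.
move=> n0 oU tp p01 [x0 px0] lam0.
have p0 x : 0 <= psi x by have /andP[] := p01 x.
have [G [b Gb]] := test_fun_smooth_step n0 tp p0 px0.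
have [Mp Mp0 pL] := test_fun_lipschitz tp.
have [_ cp sU] := tp.
have [rho rho0 rU] := compact_neighborhood oU cp sU.
(* [W1inf_normP] needs a strict bound, hence the additional 1; the absolute value keeps [N] positive
   whatever the sign of [K]. *)
pose N := `|K| + 1; have N0 : 0 < N by rewrite ltr_wpDl.
pose C := Mp * N + N * n%:R + N + 2 * N / rho.
have CN : N <= C.
  by rewrite /C -addrA addrCA lerDl !addr_ge0 ?mulr_ge0 ?invr_ge0 ?ler0n// ltW.
have C0 : 0 < C by exact: lt_le_trans N0 CN.
have l0 : 0 <= lam * (1 + Mp) by apply: mulr_ge0; [exact: ltW|exact: addr_ge0].
exists (C + lam * (1 + Mp)) => [|t0 t1 L adm x t tt]; first by rewrite ltr_wpDr.
have KN : (K%:E < N%:E)%E by rewrite lte_fin; apply: le_lt_trans (ler_norm K) _; rewrite ltrDl.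
have [sym [reg [cb1 cc1]] ell _] := adm.
have oQ : open (U `*` `]t0, t1[) by exact: open_cylinder.
have inQ z s : U z -> t0 < s < t1 -> (U `*` `]t0, t1[) (z, s).
  by move=> Uz ss; split => //=; rewrite in_itv.
have ca_cont i j z s : U z -> t0 < s < t1 ->
    {for (z, s), continuous (fun p => ca L p.1 p.2 i j)}.
  move=> Uz ss; have [cont _] := reg i j.
  have : {within U `*` `]t0, t1[, continuous (fun p => ca L p.1 p.2 i j)}.
    apply: continuous_subspaceW cont => -[y r] [/= Uy rr]; split => /=.
      exact: subset_closure.
    by move: rr; rewrite !in_itv/= => /andP[? ?]; rewrite !ltW.
  by rewrite continuous_open_subspace// => /(_ (z, s)); apply; apply/mem_set; exact: inQ.
have ca_bound i j z s : U z -> t0 < s < t1 -> `|ca L z s i j| <= N.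
  move=> Uz ss; have [H _ _] := admissible_norms i j i adm.
  have [_ [H' _]] := W1inf_normP (le_lt_trans H KN).
  exact: (Linf_norm_bound oQ (inQ _ _ Uz ss) (ca_cont i j _ _ Uz ss) H').
have i0 := Ordinal n0.
have cb_bound k z s : U z -> t0 < s < t1 -> `|cb L z s 0 k| <= N.
  move=> Uz ss; have [_ H _] := admissible_norms i0 i0 k adm.
  exact: (Linf_norm_bound oQ (inQ _ _ Uz ss) (CtC1_continuous oU (cb1 k) Uz ss)
    (ltW (le_lt_trans H KN))).
have cc_bound z s : U z -> t0 < s < t1 -> `|cc L z s| <= N.
  move=> Uz ss; have [_ _ H] := admissible_norms i0 i0 i0 adm.
  exact: (Linf_norm_bound oQ (inQ _ _ Uz ss) (CtC1_continuous oU cc1 Uz ss)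
    (ltW (le_lt_trans H KN))).
have cut (c : R) z : (U z -> `|c| <= N) -> `|psi z * c| <= N.
  move=> H; have [sz|/supp_eq0 ->] := pselect (supp psi z); last by rewrite mul0r normr0 ltW.
  by rewrite normrM (ger0_norm (p0 z)) -[leRHS]mul1r ler_pM//; [have /andP[] := p01 z|exact/H/sU].
have NL : N <= C + lam * (1 + Mp) by rewrite -[leLHS]addr0 lerD.
split.
- have [sx|/supp_eq0 px] := pselect (supp psi x).
    rewrite /= linearD/= linearZ/= tr_scalar_mx sym//; first exact/subset_closure/sU.
    by move/andP: tt => [? ?]; rewrite !ltW.
  by rewrite /= px scale0r add0r tr_scalar_mx.
- move=> v; rewrite /= quad_whole_space.
  have [sx|/supp_eq0 px] := pselect (supp psi x); last by rewrite px mul0r add0r subr0 mul1r.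
  have H : lam * sqnorm v <= quad (ca L x t) v.
    apply: ell; first exact/subset_closure/sU.
    by move/andP: tt => [? ?]; rewrite !ltW.
  (* The form is a convex combination of two forms that are both at least [lam * sqnorm v]. *)
  rewrite -{1}[lam * _]mul1r -{1}(subrK (psi x) 1) mulrDl addrC lerD2r.
  exact: ler_wpM2l.
- move=> i j; rewrite /= !mxE; apply: le_trans (ler_normD _ _) _; apply: lerD.
    by apply: le_trans CN; apply: cut => Ux; exact: ca_bound.
  have /andP[a1 a2] := p01 x.
  have H : `|lam * (1 - psi x)| <= lam * (1 + Mp).
    by rewrite normrM (gtr0_norm lam0) ler_pM2l// ger0_norm; lra.
  apply: le_trans H; case: (i == j); rewrite ?mulr1n ?mulr0n ?normr0//.
- split=> [k|]; last by apply: le_trans NL; apply: cut => Ux; exact: cc_bound.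
  by rewrite /= mxE; apply: le_trans NL; apply: cut => Ux; exact: cb_bound.
- move=> y s ss i j; rewrite /= !mxE.
  have W k : exists2 g, weak_deriv (U `*` `]t0, t1[) (stb k) (fun p => ca L p.1 p.2 i j) g
      & (Linf_norm (U `*` `]t0, t1[) g <= N%:E)%E.
    have [H _ _] := admissible_norms i j i adm.
    by have [_ [_ H']] := W1inf_normP (le_lt_trans H KN).
  have mF : measurable_on (U `*` `]t0, t1[) (fun p => ca L p.1 p.2 i j).
    have [H _ _] := admissible_norms i j i adm.
    by have [] := W1inf_normP (le_lt_trans H KN).
  have P := @cutoff_product_lipschitz psi U (fun x t => ca L x t i j) Mp N rho t0 t1
    rho0 Mp0 (ltW N0) p01 sU pL rU (ca_bound i j).
  have {P} := P _ _ x y t s tt ss; rewrite -/C => P.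
  rewrite [X in `|X|](_ : _ = (psi x * ca L x t i j - psi y * ca L y s i j)
      + (lam * (psi y - psi x)) *+ (i == j)); last by case: (i == j); rewrite ?mulr1n ?mulr0n; ring.
  apply: le_trans (ler_normD _ _) _; rewrite mulrDl; apply: lerD.
    apply: P.
    + move=> x' y' t' sx xy tt'.
      apply: (@spatial_lipschitz _ _ _ _ Gb U t0 t1 oU (fun p => ca L p.1 p.2 i j) N mF W
        (ca_cont i j) x' y' t' rho tt' _ xy).
      by move=> z; exact: rU.
    + move=> x' t' s' Ux tt' ss'.
      exact: (@time_lipschitz _ _ _ _ Gb U t0 t1 oU (fun p => ca L p.1 p.2 i j) N mF W
        (ca_cont i j) x' t' s' Ux tt' ss').
  have H : `|lam * (psi y - psi x)| <= lam * (1 + Mp) * (Num.sqrt (sqnorm (x - y)) + `|t - s|).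
    rewrite normrM (gtr0_norm lam0) -mulrA ler_pM2l// distrC; apply: le_trans (pL x y) _.
    by apply: ler_pM => //; rewrite ?sqrtr_ge0 ?lerDr ?lerDl.
  apply: le_trans H; case: (i == j); rewrite ?mulr1n ?mulr0n ?normr0//.
Qed.

End whole_space_regularity.

Theorem theorem2p1 (R : realType) (n : nat) (Hn : (0 < n)%N)
    (Omega Omega' : set 'rV[R]_n) (psi : 'rV[R]_n -> R) (K : R -> R -> R)
    (HOmega : C11_domain Omega)
    (HOmega' : open Omega' /\ closure Omega `<=` Omega')
    (Hpsi : cutoff Omega Omega' psi)
    (lam A T : R) (Hlam : 0 < lam) (HA : 0 < A) (HT : 0 < T) :
  exists C Ct : R, [/\ 0 < C, 0 < Ct &
    forall (t0 t1 : R), t0 < t1 -> t1 - t0 = T ->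
    forall (L0 L1 : coeffs R n),
      admissible Omega t0 t1 lam A L0 ->
      admissible Omega' t0 t1 lam (K lam A) L1 ->
      extends Omega t0 t1 L0 L1 ->
      let L := whole_space lam psi L1 in
    forall E : 'rV[R]_n -> R -> 'rV[R]_n -> R -> R,
      fundamental_solution L t0 t1 E ->
      (forall (x : 'rV[R]_n) (t : R) (xi : 'rV[R]_n) (tau : R),
         t0 <= tau -> tau < t -> t <= t1 ->
         E x t xi tau = parametrix_solution L t1 x t xi tau) ->
    forall (x xi : 'rV[R]_n) (t tau : R), t0 < tau -> tau < t -> t < t1 ->
      gauss_c C (x - xi) (t - tau) <= E x t xi tau /\
      E x t xi tau <= gauss_c Ct (x - xi) (t - tau)].
Proof.
have [oO cO] := HOmega'; have [tp p01 cI] := Hpsi.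
have [x0 Ox0] : Omega !=set0 by have [_ _] := HOmega.
(* [psi] equals 1 on [Omega], which is not empty; this positive value is what produces the
   one-dimensional bump. *)
have px0 : 0 < psi x0.
  by have /cI/interior_subset/= -> := subset_closure Ox0.
(* [Lam] is obtained from [Omega'], [psi], [lam] and [K lam A] before any time interval or
   coefficients are given, so the final constants depend only on these data, [n] and [T]. *)
have [Lam Lam0 regL] := regular_whole_space (K lam A) Hn oO tp p01 (ex_intro _ x0 px0) Hlam.
have [C [Ct [C0 Ct0 H]]] := regular_two_sided Hn Hlam Lam0 HT.
exists C, Ct; split => // t0 t1 t01 tT L0 L1 _ adm _ L E [fE _] parE x xi t tau h1 h2 h3.
apply: (H t0 t1 L E) => //.
- exact: regL.
- by move=> xi' tau' a1 a2; apply: fE; rewrite (ltW a1) a2.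
- by move=> x' t' xi' tau' a1 a2 a3; apply: parE => //; exact: ltW.
Qed.
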